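(* Let $p$ be an even integer with $|p|\ge 6$. Let $(\zeta_1,\omega_1),\dots,(\zeta_N,\omega_N)\in\mathbb{C}^2$ be all the solutions $(z,w)$, with $zw\neq0$, of the system $$w=\frac{z+z^{p/2}}{z^{p/2}z+1},\qquad z^2-\Big(\frac{z+z^{p/2}}{z^{p/2}z+1}+1+\frac{1+z^{p/2}z}{z^{p/2}+z}\Big)z+1=0 .$$ For each $i$ choose integers $c_i,d_i\in\mathbb{Z}$ such that $$\frac{\partial\tilde V}{\partial z}(\zeta_i,\omega_i)+2\pi\sqrt{-1}\,\frac{c_i}{\zeta_i}=\frac{\partial\tilde V}{\partial w}(\zeta_i,\omega_i)+2\pi\sqrt{-1}\,\frac{d_i}{\omega_i}=0 .$$ Then $$\frac{6}{\pi^2}\sum_{i=1}^{N}\Big(\tilde V(\zeta_i,\omega_i)+2\pi\sqrt{-1}\,\big(c_i\,\mathrm{Log}\,\zeta_i+d_i\,\mathrm{Log}\,\omega_i\big)\Big)=0\in\mathbb{C}/\mathbb{Z}.$$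
   Context: $\mathrm{Log}$ is the principal branch of the logarithm and $\mathrm{Li}_2(z)=-\int_0^z\frac{\mathrm{Log}(1-t)}{t}\,dt$ is the classical dilogarithm, with values regarded modulo $\pi^2\mathbb{Z}$. For $(z,w)\in\mathbb{C}^2$ with $zw\neq0$, $$\tilde V(z,w):=-\mathrm{Li}_2(zw)+\mathrm{Li}_2(z/w)+\frac p4(\mathrm{Log}\,z)^2-\mathrm{Log}\,z\,\mathrm{Log}\,w\in\mathbb{C}/\pi^2\mathbb{Z}.$$ Its partial derivatives are given by $$z\,\frac{\partial\tilde V}{\partial z}=\mathrm{Log}(1-zw)-\mathrm{Log}(1-z/w)+\frac p2\mathrm{Log}\,z-\mathrm{Log}\,w,\qquad w\,\frac{\partial\tilde V}{\partial w}=\mathrm{Log}(1-zw)+\mathrm{Log}(1-z/w)-\mathrm{Log}\,z .$$ *)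

(* Defs.v *)
From HB Require Import structures.
From mathcomp Require Import all_boot all_order all_algebra.
From mathcomp Require Import all_classical all_reals all_analysis.
From mathcomp Require Import complex.

Set Implicit Arguments.
Unset Strict Implicit.
Unset Printing Implicit Defensive.

Import Order.TTheory GRing.Theory Num.Theory.
Import numFieldNormedType.Exports.

Local Open Scope classical_set_scope.
Local Open Scope ring_scope.
Local Open Scope complex_scope.

(* Principal argument, in ]-pi, pi]; negative reals have argument pi.
   The value at 0 is irrelevant. *)
Definition Arg (R : realType) (z : R[i]) : R :=
  let t := acos (complex.Re z / Normc.normc z) in
  if 0 <= complex.Im z then t else - t.

Definition Log (R : realType) (z : R[i]) : R[i] :=
  ln (Normc.normc z) +i* Arg z.

(* Integral of g along the straight segment from 0 to z, with t = s z and
   dt = z ds.  The Lebesgue integral absorbs the singularities of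
   Log (1 - t) / t at t = 0 and t = 1. *)
Definition segment_integral (R : realType) (g : R[i] -> R[i]) (z : R[i]) :
    R[i] :=
  (\int[@lebesgue_measure R]_(s in `[0, 1]) complex.Re (g (s%:C * z) * z))
  +i*
  (\int[@lebesgue_measure R]_(s in `[0, 1]) complex.Im (g (s%:C * z) * z)).

(* On the cut ]1, +oo[ the integrand takes the boundary value given by the
   principal branch, Log (1 - t) = ln (t - 1) + i pi for real t > 1. *)
Definition Li2 (R : realType) (z : R[i]) : R[i] :=
  - segment_integral (fun t => Log (1 - t) / t) z.

(* A complex representative of the class in C / pi^2 Z. *)
Definition Vtilde (R : realType) (p : int) (z w : R[i]) : R[i] :=
  - Li2 (z * w) + Li2 (z / w) + p%:~R / 4 * Log z ^+ 2 - Log z * Log w.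

(* The partial derivatives of Vtilde are the closed forms in principal
   logarithms, which also give them a value at points where a logarithm sits on
   its cut (e.g. w a negative real), where Vtilde is not differentiable. *)
Definition dVtilde_dz (R : realType) (p : int) (z w : R[i]) : R[i] :=
  (Log (1 - z * w) - Log (1 - z / w) + p%:~R / 2 * Log z - Log w) / z.

Definition dVtilde_dw (R : realType) (z w : R[i]) : R[i] :=
  (Log (1 - z * w) + Log (1 - z / w) - Log z) / w.

(* The nonvanishing conditions express that the fractions are defined
   (division by 0 is total here).  p is meant to be even, so that (p %/ 2)%Z is
   the exact half; it may be negative. *)
Definition is_solution (R : realType) (p : int) (z w : R[i]) : Prop :=
  let q := z ^ (p %/ 2)%Z in
  [/\ z * w != 0,
      q * z + 1 != 0,
      q + z != 0,
      w = (z + q) / (q * z + 1) &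
      z ^+ 2 - ((z + q) / (q * z + 1) + 1 + (1 + q * z) / (q + z)) * z + 1 = 0].

(* Main.v *)
Require Import Defs.
From HB Require Import structures.
From mathcomp Require Import all_boot all_order all_algebra.
From mathcomp Require Import all_classical all_reals all_analysis.
From mathcomp Require Import all_field complex ring lra zify.

Set Implicit Arguments.
Unset Strict Implicit.
Unset Printing Implicit Defensive.

Import Order.TTheory GRing.Theory Num.Theory.
Import numFieldNormedType.Exports.

(** Since [kappa = 12 i / pi] satisfies [kappa * t = 2 pi i k] exactly when
    [6 / pi^2 * t = k], the theorem says that the product over the solutions of
    the numbers [exp (kappa * H)] is 1, where [H] is the adjusted value of the
    potential.  The critical point equations eliminate the integers [c] and
    [d] from [H] ([Vtilde_critpot]), and what remains is built from the
    function [rogers u = exp (kappa * (Li2 (e^u) + u * Log (1 - e^u)))].  This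
    function extends to all [u] with [e^u <> 1], is differentiable there and
    satisfies the reflection and inversion formulas without error term, because
    [kappa * pi^2 / 6 = 2 pi i].  In particular the exponentiated critical
    value [crit] may be computed with any logarithms [u], [v] of [z], [w]
    ([crit_shift]).

    The product is computed by deformation.  Let [p = 2 n] with [n > 2].  The
    exponentiated critical point equations
      [(1 - z / w) w = z^n (1 - z w)] and [(1 - z w) (1 - z / w) = z / x]
    give the original system for [x = 1].  They are solved by [w = wcoord z],
    where [z] runs over the roots of a polynomial [pencil x = N - x D].  As [x]
    varies, all the terms of the logarithmic derivative of [crit] cancel by the
    critical point equations, except for [- kappa * Log x] times the logarithmic
    derivative of [w] ([cderiv_crit]).  The product of the [w] is a constant
    divided by [x^2] ([prod_wcoord]), so that the derivatives of the critical
    values add up to that of [kappa * Log x ^+ 2].  Hence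
      [energy x = prod crit * exp (- kappa * Log x ^+ 2)]
    is locally constant where the roots are simple ([cderiv_energy]); only
    finitely many parameters are exceptional, so a path from 1 to 0 in the
    slit plane avoids them ([energy_detour]).

    As [x] tends to 0 the roots tend to the roots of [z^(n-1) = -1], where [w]
    is equivalent to [- x], and of [z^(n+1) = -1], where [w] is equivalent to
    [- 1 / x].  All the dilogarithms disappear in the limit, and a root of
    [z^m = -1] contributes [exp (- kappa * m / 2 * Log z ^+ 2)].  The product
    of these over all such roots is 1, by the formula for the sum of the squares
    of the first odd numbers ([prod_gauss]).  Therefore [energy 1 = 1]
    ([energy1]).

    It remains to check that [x = 1] is not exceptional, and that its
    dilogarithms are evaluated off the cut.  In [t = z + z^-1] the equation at
    [x = 1] is [T_n t = t^2 - t - 4] with a Chebyshev polynomial [T_n].  A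
    double root would satisfy a quadratic equation with rational coefficients as
    well, which is excluded by comparing growth and signs ([pencil1_simple]);
    the same comparison shows that no root is real ([pencil1_not_real],
    [pencil1_slit]).  Finally the substitution of [w^-1] for [w] changes the
    sign of [p] and inverts [crit], which settles negative [p]. *)

Local Open Scope classical_set_scope.
Local Open Scope ring_scope.
Local Open Scope complex_scope.

Local Notation Re := complex.Re.
Local Notation Im := complex.Im.
Local Notation nm := Normc.normc.

(** * The modulus *)

Section Modulus.
Variable R : realType.
Local Notation C := R[i].
Implicit Types (x y z : C) (r s : R).

Lemma nmE z : nm z = Num.sqrt (Re z ^+ 2 + Im z ^+ 2).
Proof. by case: z. Qed.

Lemma nm_ge0 z : 0 <= nm z.
Proof. by rewrite nmE sqrtr_ge0. Qed.

Lemma nm0 : nm (0 : C) = 0.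
Proof. exact: Normc.normc0. Qed.

Lemma nm_eq0 z : (nm z == 0) = (z == 0).
Proof.
apply/eqP/eqP => [/Normc.eq0_normc //|->]; exact: nm0.
Qed.

Lemma nm_gt0 z : (0 < nm z) = (z != 0).
Proof. by rewrite lt_neqAle nm_ge0 andbT eq_sym nm_eq0. Qed.

Lemma nm1 : nm (1 : C) = 1.
Proof. exact: Normc.normc1. Qed.

Lemma nmM x y : nm (x * y) = nm x * nm y.
Proof. exact: Normc.normcM. Qed.

Lemma nmV x : nm x^-1 = (nm x)^-1.
Proof. exact: Normc.normcV. Qed.

Lemma nmX x n : nm (x ^+ n) = nm x ^+ n.
Proof. by elim: n => [|n IH]; rewrite ?expr0 ?nm1// !exprS nmM IH. Qed.

Lemma nmN x : nm (- x) = nm x.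
Proof. by rewrite !nmE !raddfN/= !sqrrN. Qed.

Lemma nmB x y : nm (x - y) = nm (y - x).
Proof. by rewrite -nmN opprB. Qed.

Lemma nmD x y : nm (x + y) <= nm x + nm y.
Proof. exact: le_normcD. Qed.

Lemma nmBD x y : nm (x - y) <= nm x + nm y.
Proof. by rewrite (le_trans (nmD _ _))// nmN. Qed.

Lemma nm_real r : nm (r%:C) = `|r|.
Proof. by rewrite nmE/= expr0n/= addr0 sqrtr_sqr. Qed.

Lemma nm_i : nm ('i : C) = 1.
Proof. by rewrite nmE/= expr0n/= add0r expr1n sqrtr1. Qed.

Lemma nm_Re z : `|Re z| <= nm z.
Proof. by rewrite nmE -sqrtr_sqr ler_sqrt ?lerDl ?addr_ge0 ?sqr_ge0. Qed.

Lemma nm_Im z : `|Im z| <= nm z.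
Proof. by rewrite nmE -sqrtr_sqr ler_sqrt ?lerDr ?addr_ge0 ?sqr_ge0. Qed.

Lemma nm_le z : nm z <= `|Re z| + `|Im z|.
Proof.
have -> : z = (Re z)%:C + 'i * (Im z)%:C by rewrite -complexE.
rewrite (le_trans (nmD _ _))// nmM nm_i mul1r !nm_real /=.
by simpc.
Qed.

Lemma nm_sqr z : nm z ^+ 2 = Re z ^+ 2 + Im z ^+ 2.
Proof. by rewrite nmE sqr_sqrtr// addr_ge0 ?sqr_ge0. Qed.

Lemma ReD x y : Re (x + y) = Re x + Re y. Proof. by case: x y => [? ?] []. Qed.
Lemma ImD x y : Im (x + y) = Im x + Im y. Proof. by case: x y => [? ?] []. Qed.
Lemma ReN x : Re (- x) = - Re x. Proof. by case: x. Qed.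
Lemma ImN x : Im (- x) = - Im x. Proof. by case: x. Qed.
Lemma ReM x y : Re (x * y) = Re x * Re y - Im x * Im y.
Proof. by case: x y => [? ?] []. Qed.
Lemma ImM x y : Im (x * y) = Re x * Im y + Im x * Re y.
Proof. by case: x y => [? ?] []. Qed.
(** Rewriting rules that reduce an identity of complex numbers to real ones. *)
Definition ReIm := (ReD, ImD, ReN, ImN, ReM, ImM).

Lemma complex_eq x y : Re x = Re y -> Im x = Im y -> x = y.
Proof. by case: x y => [? ?] [? ?] /= -> ->. Qed.

Lemma rcD r s : (r + s)%:C = r%:C + s%:C :> C. Proof. exact: rmorphD. Qed.
Lemma rcB r s : (r - s)%:C = r%:C - s%:C :> C. Proof. exact: rmorphB. Qed.
Lemma rcN r : (- r)%:C = - r%:C :> C. Proof. exact: rmorphN. Qed.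
Lemma rcM r s : (r * s)%:C = r%:C * s%:C :> C. Proof. exact: rmorphM. Qed.
Lemma rcV r : (r^-1)%:C = (r%:C)^-1 :> C. Proof. exact: fmorphV. Qed.

Lemma natC (k : nat) : k%:R = (k%:R : R)%:C :> C.
Proof. by rewrite rmorph_nat. Qed.

End Modulus.

(** * Derivatives with a quadratic remainder *)

(** The filter is generated by discs of real radius, so that the estimates below
    compare real numbers and not complex ones. *)
Definition cnbhs (R : realType) (z : R[i]) : set_system R[i] :=
  fun P => exists2 d : R, 0 < d & forall y, nm (y - z) < d -> P y.

Global Instance cnbhs_filter (R : realType) (z : R[i]) : ProperFilter (cnbhs z).
Proof.
apply: Build_ProperFilter_ex.
  by move=> P [d d0 H]; exists z; apply: H; rewrite subrr nm0.
split; first by exists 1.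
  move=> P Q [d d0 HP] [e e0 HQ]; exists (Num.min d e).
    by rewrite lt_min d0 e0.
  by move=> y; rewrite lt_min => /andP[/HP ? /HQ ?].
by move=> P Q PQ [d d0 H]; exists d => // y /H /PQ.
Qed.

Lemma cnbhs_singleton (R : realType) (z : R[i]) (P : set R[i]) :
  (\forall y \near cnbhs z, P y) -> P z.
Proof. by case=> d d0; apply; rewrite subrr nm0. Qed.

Lemma cnbhs_ball (R : realType) (z : R[i]) (d : R) : 0 < d ->
  \forall y \near cnbhs z, nm (y - z) < d.
Proof. by move=> d0; exists d. Qed.

(** Complex differentiability with a quadratic remainder.  All the functions
    below are analytic, so that nothing is lost; the explicit constant makes
    the calculus free of epsilons, and makes the estimates uniform enough to
    be integrated. *)
Definition cderiv (R : realType) (f : R[i] -> R[i]) (z l : R[i]) :=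
  exists K : R, \forall y \near cnbhs z,
    nm (f y - f z - l * (y - z)) <= K * nm (y - z) ^+ 2.

Section Calculus.
Variable R : realType.
Local Notation C := R[i].
Implicit Types (f g : C -> C) (x y z l m : C) (r s K : R).

Lemma cderivP f z l : cderiv f z l -> exists2 K : R, 0 < K &
  \forall y \near cnbhs z, nm (f y - f z - l * (y - z)) <= K * nm (y - z) ^+ 2.
Proof.
case=> K H; exists (`|K| + 1); first by rewrite ltr_wpDl.
apply: filterS H => y /le_trans; apply; apply: ler_wpM2r; rewrite ?sqr_ge0//.
by rewrite (le_trans (ler_norm _))// lerDl.
Qed.

Lemma cderiv_lip f z l : cderiv f z l -> exists2 K : R, 0 < K &
  \forall y \near cnbhs z, nm (f y - f z) <= K * nm (y - z).
Proof.
case/cderivP => K K0 H; exists (K + nm l + 1).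
  by rewrite ltr_wpDl// addr_ge0 ?nm_ge0 ?ltW.
have H1 := cnbhs_ball z (@ltr01 R).
near=> y.
have -> : f y - f z = (f y - f z - l * (y - z)) + l * (y - z) by ring.
rewrite (le_trans (nmD _ _))// nmM.
have h1 : nm (f y - f z - l * (y - z)) <= K * nm (y - z) ^+ 2 by near: y.
have h2 : nm (y - z) < 1 by near: y.
have h3 := nm_ge0 (y - z); have h4 := nm_ge0 l.
have h5 : K * nm (y - z) ^+ 2 <= K * nm (y - z).
  by rewrite ler_pM2l// expr2 ler_piMl// ltW.
by rewrite !mulrDl; lra.
Unshelve. all: by end_near. Qed.

Lemma cderiv_cont f z l : cderiv f z l -> forall P : set C,
  (\forall w \near cnbhs (f z), P w) -> \forall y \near cnbhs z, P (f y).
Proof.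
case/cderiv_lip => K K0 H P [d d0 HP].
have H1 : \forall y \near cnbhs z, nm (y - z) < d / K.
  by apply: cnbhs_ball; rewrite divr_gt0.
near=> y; apply: HP.
have h1 : nm (f y - f z) <= K * nm (y - z) by near: y.
have : nm (y - z) < d / K by near: y.
by rewrite ltr_pdivlMr// mulrC; apply: le_lt_trans.
Unshelve. all: by end_near. Qed.

(** Differentiability is local; functions are often known only near a point. *)
Lemma cderiv_near f g z l : (\forall y \near cnbhs z, f y = g y) ->
  cderiv g z l -> cderiv f z l.
Proof.
move=> H [K HK]; exists K; rewrite (cnbhs_singleton H).
by apply: filterS2 H HK => y ->.
Qed.

Lemma cderiv_eq f z l m : cderiv f z m -> m = l -> cderiv f z l.
Proof. by move=> + <-. Qed.

Lemma cderiv_cst c z : cderiv (fun _ => c) z 0.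
Proof.
by exists 0; near=> y; rewrite subrr mul0r subr0 nm0 mul0r.
Unshelve. all: by end_near. Qed.

Lemma cderiv_id z : cderiv (fun y => y) z 1.
Proof.
by exists 0; near=> y; rewrite mul1r subrr nm0 mul0r.
Unshelve. all: by end_near. Qed.

Lemma cderivD f g z l m : cderiv f z l -> cderiv g z m ->
  cderiv (fun y => f y + g y) z (l + m).
Proof.
move=> [K HK] [L HL]; exists (K + L); near=> y.
have -> : f y + g y - (f z + g z) - (l + m) * (y - z) =
  (f y - f z - l * (y - z)) + (g y - g z - m * (y - z)) by ring.
rewrite (le_trans (nmD _ _))// [leRHS]mulrDl lerD//; by near: y.
Unshelve. all: by end_near. Qed.

Lemma cderivM f g z l m : cderiv f z l -> cderiv g z m ->
  cderiv (fun y => f y * g y) z (l * g z + f z * m).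
Proof.
move=> Hf Hg.
have [K K0 HK] := cderivP Hf; have [L L0 HL] := cderivP Hg.
have [K' K'0 HK'] := cderiv_lip Hf; have [L' L'0 HL'] := cderiv_lip Hg.
exists (K * nm (g z) + nm (f z) * L + K' * L'); near=> y.
have -> : f y * g y - f z * g z - (l * g z + f z * m) * (y - z) =
  (f y - f z - l * (y - z)) * g z + f z * (g y - g z - m * (y - z)) +
  (f y - f z) * (g y - g z) by ring.
rewrite (le_trans (nmD _ _))// [leRHS]mulrDl lerD//.
  rewrite (le_trans (nmD _ _))// [leRHS]mulrDl lerD//.
    by rewrite nmM mulrAC ler_wpM2r ?nm_ge0//; near: y.
  by rewrite nmM -mulrA ler_wpM2l ?nm_ge0//; near: y.
rewrite nmM; have -> : K' * L' * nm (y - z) ^+ 2 =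
   (K' * nm (y - z)) * (L' * nm (y - z)) by ring.
by rewrite ler_pM ?nm_ge0//; near: y.
Unshelve. all: by end_near. Qed.

Lemma cderivN f z l : cderiv f z l -> cderiv (fun y => - f y) z (- l).
Proof.
move=> [K HK]; exists K; apply: filterS HK => y.
by rewrite -nmN; congr (nm _ <= _); ring.
Qed.

Lemma cderivB f g z l m : cderiv f z l -> cderiv g z m ->
  cderiv (fun y => f y - g y) z (l - m).
Proof. by move=> Hf Hg; apply: cderivD => //; apply: cderivN. Qed.

Lemma cderivZ c f z l : cderiv f z l -> cderiv (fun y => c * f y) z (c * l).
Proof.
move=> H; apply: cderiv_eq (cderivM (cderiv_cst c z) H) _.
by rewrite mul0r add0r.
Qed.

Lemma cderiv_comp f g z l m : cderiv g z m -> cderiv f (g z) l ->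
  cderiv (fun y => f (g y)) z (l * m).
Proof.
move=> Hg Hf; have [L L0 HL] := cderivP Hg.
have [L' L'0 HL'] := cderiv_lip Hg.
have [K K0 /(cderiv_cont Hg) HK] := cderivP Hf.
exists (K * L' ^+ 2 + nm l * L); near=> y.
have -> : f (g y) - f (g z) - l * m * (y - z) =
  (f (g y) - f (g z) - l * (g y - g z)) + l * (g y - g z - m * (y - z)) by ring.
rewrite (le_trans (nmD _ _))// [leRHS]mulrDl lerD//.
  have /le_trans : nm (f (g y) - f (g z) - l * (g y - g z)) <=
    K * nm (g y - g z) ^+ 2 by near: y.
  apply; rewrite -mulrA ler_pM2l// -exprMn ler_sqr ?nnegrE ?mulr_ge0 ?nm_ge0 ?(ltW L'0)//.
  by near: y.
rewrite nmM -mulrA; apply: ler_wpM2l; rewrite ?nm_ge0//; by near: y.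
Unshelve. all: by end_near. Qed.

Lemma cnbhs_half z : z != 0 -> \forall y \near cnbhs z, nm z / 2 < nm y.
Proof.
rewrite -nm_gt0 => z0; exists (nm z / 2); first by rewrite divr_gt0.
move=> y h; have := nmD y (z - y); rewrite addrC subrK nmB => h2.
by lra.
Qed.

Lemma cnbhs_neq0 z : z != 0 -> \forall y \near cnbhs z, y != 0.
Proof.
move=> z0; apply: filterS (cnbhs_half z0) => y.
by rewrite -nm_gt0; apply: le_lt_trans; rewrite divr_ge0 ?nm_ge0.
Qed.

Lemma cderiv_inv z : z != 0 -> cderiv (fun y => y^-1) z (- z ^- 2).
Proof.
move=> z0; exists (2 / nm z ^+ 3).
have z0' : 0 < nm z by rewrite nm_gt0.
have H := cnbhs_half z0; have H' := cnbhs_neq0 z0; near=> y.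
have y0 : y != 0 by near: y.
have -> : y^-1 - z^-1 - - z ^- 2 * (y - z) = (y - z) ^+ 2 / (y * z ^+ 2).
  by field; rewrite y0 z0.
rewrite nmM nmX nmV nmM nmX mulrC ler_wpM2r ?sqr_ge0//.
have h : nm z / 2 < nm y by near: y.
have -> : 2 / nm z ^+ 3 = ((nm z / 2) * nm z ^+ 2)^-1.
  by field; rewrite gt_eqF.
by rewrite lef_pV2 ?posrE ?mulr_gt0 ?exprn_gt0 ?nm_gt0 ?divr_gt0// ler_pM2r ?exprn_gt0// ltW.
Unshelve. all: by end_near. Qed.

Lemma cderivV f z l : cderiv f z l -> f z != 0 ->
  cderiv (fun y => (f y)^-1) z (- (f z) ^- 2 * l).
Proof. by move=> Hf f0; apply: (cderiv_comp Hf); apply: cderiv_inv. Qed.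

Lemma cderiv_div f g z l m : cderiv f z l -> cderiv g z m -> g z != 0 ->
  cderiv (fun y => f y / g y) z ((l * g z - f z * m) / g z ^+ 2).
Proof.
move=> Hf Hg g0; have H := cderivM Hf (cderivV Hg g0).
by apply: (cderiv_eq H) => /=; field.
Qed.

Lemma cderivX f z l n : cderiv f z l ->
  cderiv (fun y => f y ^+ n) z (n%:R * f z ^+ n.-1 * l).
Proof.
move=> Hf; elim: n => [|n IH]; first by rewrite !mul0r; apply: cderiv_cst.
apply: (@cderiv_near _ (fun y => f y * f y ^+ n)).
  by apply: nearW => y; rewrite exprS.
apply: cderiv_eq (cderivM Hf IH) _ => /=; rewrite -(natr1 n).
by case: n {IH} => [|n] /=; rewrite ?expr0 ?exprS; ring.
Qed.

Lemma cderiv_poly (p : {poly C}) z : cderiv (fun y => p.[y]) z p^`().[z].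
Proof.
elim/poly_ind: p => [|p c IH].
  apply: (@cderiv_near _ (fun=> 0)).
    by apply: nearW => y; rewrite horner0.
  by rewrite linear0 horner0; apply: cderiv_cst.
apply: (@cderiv_near _ (fun y => p.[y] * y + c)).
  by apply: nearW => y; rewrite !hornerE.
apply: cderiv_eq (cderivD (cderivM IH (cderiv_id z)) (cderiv_cst c z)) _.
rewrite derivD derivM derivX derivC !hornerE; ring.
Qed.

Lemma cderiv_uniq f z l m : cderiv f z l -> cderiv f z m -> l = m.
Proof.
move=> /cderivP[K K0 HK] /cderivP[L L0 HL].
have [//|lm] := eqVneq l m; exfalso.
have [d d0 Hd] : \forall y \near cnbhs z,
    nm (l - m) * nm (y - z) <= (K + L) * nm (y - z) ^+ 2.
  near=> y; rewrite -nmM.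
  have -> : (l - m) * (y - z) = (f y - f z - m * (y - z)) -
    (f y - f z - l * (y - z)) by ring.
  rewrite (le_trans (nmBD _ _))// addrC [leRHS]mulrDl; apply: lerD; by near: y.
have lm0 : 0 < nm (l - m) by rewrite nm_gt0 subr_eq0.
pose e := Num.min (d / 2) (nm (l - m) / (K + L) / 2).
have e0 : 0 < e by rewrite lt_min !divr_gt0// addr_gt0.
have ez : nm (z + e%:C - z) = e by rewrite addrC addKr nm_real gtr0_norm.
have := Hd (z + e%:C); rewrite ez => H.
have e1 : e <= d / 2 by rewrite ge_min lexx.
have e2 : e <= nm (l - m) / (K + L) / 2 by rewrite ge_min lexx orbT.
have {}H : nm (l - m) * e <= (K + L) * e ^+ 2 by apply: H; lra.
move: H; rewrite expr2 mulrA ler_pM2r// => H.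
move: e2; rewrite ler_pdivlMr// ler_pdivlMr ?addr_gt0// => e2.
by nra.
Unshelve. all: by end_near. Qed.

End Calculus.

(** * Vanishing derivatives *)

Section RealDerivative.
Variable R : realType.
Local Notation C := R[i].

(** Links the quadratic remainder with the derivatives of real functions. *)
Lemma is_derive_quad (g : R -> R) (s l K d : R) : 0 < d ->
  (forall t, `|t - s| < d -> `|g t - g s - l * (t - s)| <= K * `|t - s| ^+ 2) ->
  is_derive s 1 g l.
Proof.
move=> d0 H.
have Hl : h^-1 *: ((g \o shift s) (h *: 1) - g s) @[h --> 0^'] --> l.
  apply/cvgrPdist_lt => e e0.
  have Hd : 0 < Num.min d (e / (`|K| + 1)).
    by rewrite lt_min d0 divr_gt0// ltr_wpDl.
  near=> h.
  have h0 : h != 0 by near: h; exact: nbhs_dnbhs_neq.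
  have : `|h| < Num.min d (e / (`|K| + 1)).
    by near: h; apply: dnbhs0_lt.
  rewrite lt_min ltr_pdivlMr ?ltr_wpDl// => /andP[hd he].
  rewrite /= /shift /= scaler1.
  have hp : 0 < `|h| by rewrite normr_gt0.
  have := H (h + s); rewrite addrK => /(_ hd) Hh.
  have -> : l - h^-1 *: (g (h + s) - g s) = - h^-1 * (g (h + s) - g s - l * h).
    by rewrite /GRing.scale /=; field.
  rewrite normrM normrN normfV mulrC ltr_pdivrMr//.
  apply: le_lt_trans Hh _.
  apply: (@le_lt_trans _ _ ((`|K| + 1) * `|h| * `|h|)).
    rewrite -mulrA -expr2 ler_wpM2r ?sqr_ge0//.
    by rewrite (le_trans (ler_norm _))// lerDl.
  by rewrite ltr_pM2r// mulrC.
have D : derivable g s 1 by apply/cvg_ex; exists l.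
by apply: DeriveDef => //; apply: cvg_lim.
Unshelve. all: by end_near. Qed.

Lemma cnbhs_real (s : R) (P : set C) : (\forall y \near cnbhs (s%:C), P y) ->
  exists2 d : R, 0 < d & forall t, `|t - s| < d -> P (t%:C).
Proof.
case=> d d0 H; exists d => // t ht; apply: H.
by rewrite -rcB nm_real.
Qed.

Lemma cderiv_is_derive_Re (f : C -> C) (s : R) (l : C) : cderiv f (s%:C) l ->
  is_derive s 1 (fun t : R => Re (f (t%:C))) (Re l).
Proof.
case=> K /cnbhs_real [d d0 H]; apply: (is_derive_quad d0 (K := K)) => t ht.
have := H _ ht; rewrite -rcB nm_real; apply: le_trans.
by rewrite (le_trans _ (nm_Re _))// !ReIm/= mulr0 subr0.
Qed.

Lemma cderiv_is_derive_Im (f : C -> C) (s : R) (l : C) : cderiv f (s%:C) l ->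
  is_derive s 1 (fun t : R => Im (f (t%:C))) (Im l).
Proof.
case=> K /cnbhs_real [d d0 H]; apply: (is_derive_quad d0 (K := K)) => t ht.
have := H _ ht; rewrite -rcB nm_real; apply: le_trans.
by rewrite (le_trans _ (nm_Im _))// !ReIm/= mulr0 add0r.
Qed.

Lemma is_derive_continuous (g : R -> R) (s l : R) : is_derive s 1 g l ->
  {for s, continuous g}.
Proof.
move=> [D _]; apply: differentiable_continuous; exact/derivable1_diffP.
Qed.

Lemma real_cst (g : R -> R) (a b : R) : a <= b ->
  (forall s, a <= s <= b -> is_derive s 1 g 0) -> g a = g b.
Proof.
move=> ab H.
have H1 x : x \in `]a, b[%R -> is_derive x 1 g 0.
  by rewrite in_itv/= => /andP[? ?]; apply: H; rewrite !ltW.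
have H2 : {within `[a, b], continuous g}.
  apply: continuous_in_subspaceT => x.
  by rewrite inE/= in_itv/= => ?; apply: is_derive_continuous; apply: H.
have [c _] := MVT_segment ab H1 H2.
by rewrite mul0r => /eqP; rewrite subr_eq0 => /eqP ->.
Qed.

Lemma cderiv0_cst (f : C -> C) (a b : R) : a <= b ->
  (forall s : R, a <= s <= b -> cderiv f (s%:C) 0) -> f (a%:C) = f (b%:C).
Proof.
move=> ab H; apply: complex_eq.
  by apply: (real_cst (g := fun t => Re (f (t%:C)))) => // s /H /cderiv_is_derive_Re.
by apply: (real_cst (g := fun t => Im (f (t%:C)))) => // s /H /cderiv_is_derive_Im.
Qed.

(** The functional equations of the dilogarithm and the constancy of the energy
    are all deduced from the vanishing of a derivative along a path. *)
Lemma cderiv0_segment (f : C -> C) (a b : C) :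
  (forall s : R, 0 <= s <= 1 -> cderiv f (a + s%:C * (b - a)) 0) -> f a = f b.
Proof.
move=> H; pose g y := f (a + y * (b - a)).
have -> : f a = g (0%:C) by rewrite /g mul0r addr0.
have -> : f b = g (1%:C) by rewrite /g mul1r addrC subrK.
apply: cderiv0_cst => // s s01.
have D : cderiv (fun y => a + y * (b - a)) (s%:C) (b - a).
  apply: cderiv_eq (cderivD (cderiv_cst _ _) (cderivM (cderiv_id _) (cderiv_cst _ _))) _.
  by ring.
by apply: cderiv_eq (cderiv_comp D (H _ s01)) _; rewrite mul0r.
Qed.

End RealDerivative.

(** * The complex exponential *)

Section Exponential.
Variable R : realType.
Local Notation C := R[i].
Implicit Types (x y z : C) (r s t : R).

Definition cexp z : C := (expR (Re z))%:C * (cos (Im z) +i* sin (Im z)).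

Lemma cexpD x y : cexp (x + y) = cexp x * cexp y.
Proof.
rewrite /cexp ReD ImD expRD cosD sinD.
by apply: complex_eq; rewrite !ReIm/=; ring.
Qed.

Lemma cexp0 : cexp 0 = 1.
Proof. by rewrite /cexp/= expR0 cos0 sin0 mul1r. Qed.

Lemma cexpN_mul z : cexp z * cexp (- z) = 1.
Proof. by rewrite -cexpD subrr cexp0. Qed.

Lemma cexp_neq0 z : cexp z != 0.
Proof.
apply/eqP => h; have := cexpN_mul z; rewrite h mul0r => /eqP.
by rewrite eq_sym oner_eq0.
Qed.

Lemma cexpN z : cexp (- z) = (cexp z)^-1.
Proof.
by apply: (mulfI (cexp_neq0 z)); rewrite cexpN_mul divff// cexp_neq0.
Qed.

Lemma cexpB x y : cexp (x - y) = cexp x / cexp y.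
Proof. by rewrite cexpD cexpN. Qed.

Lemma cexpMn z (k : nat) : cexp (k%:R * z) = cexp z ^+ k.
Proof.
elim: k => [|k IH]; first by rewrite mul0r cexp0.
by rewrite -natr1 mulrDl mul1r cexpD IH exprSr.
Qed.

Lemma cexpMz z (k : int) : cexp (k%:~R * z) = cexp z ^ k.
Proof.
case: k => k; first by rewrite -pmulrn cexpMn.
by rewrite NegzE mulrNz mulNr cexpN -pmulrn cexpMn.
Qed.

Lemma cexp_sum (T : Type) (r : seq T) (f : T -> C) :
  cexp (\sum_(i <- r) f i) = \prod_(i <- r) cexp (f i).
Proof. exact: (big_morph cexp cexpD cexp0). Qed.

Lemma nm_cexp z : nm (cexp z) = expR (Re z).
Proof.
rewrite nmM nm_real nmE/= cos2Dsin2 sqrtr1 mulr1.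
by rewrite gtr0_norm// expR_gt0.
Qed.

Lemma cexp_real r : cexp (r%:C) = (expR r)%:C.
Proof. by rewrite /cexp/= cos0 sin0 mulr1. Qed.

Lemma cexp_imag r : cexp (r%:C * 'i) = cos r +i* sin r.
Proof.
rewrite /cexp !ReIm/= !mulr0 mul0r subrr expR0 mul1r mulr1 addr0.
by [].
Qed.

Lemma cexp_ipi : cexp (pi%:C * 'i) = -1.
Proof. by rewrite cexp_imag cospi sinpi; apply: complex_eq => /=; rewrite ?oppr0. Qed.

Definition twopii : C := 2 * pi%:C * 'i.

Lemma twopiiE : twopii = (2 * pi : R)%:C * 'i.
Proof. by rewrite /twopii rcM -natC. Qed.

Lemma cexp_twopii : cexp twopii = 1.
Proof.
have -> : twopii = pi%:C * 'i + pi%:C * 'i by rewrite /twopii; ring.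
by rewrite cexpD cexp_ipi mulrNN mulr1.
Qed.

Lemma cexp_twopiiz (k : int) : cexp (k%:~R * twopii) = 1.
Proof. by rewrite cexpMz cexp_twopii exp1rz. Qed.

Lemma intC (k : int) : k%:~R = (k%:~R : R)%:C :> C.
Proof. by rewrite rmorph_int. Qed.

(** Reduction of the imaginary part to [[-pi, pi]], where [cos] determines the
    absolute value of its argument. *)
Lemma cexp_eq1 z : cexp z = 1 -> exists k : int, z = k%:~R * twopii.
Proof.
move=> h.
have Re0 : Re z = 0.
  have := congr1 (@Normc.normc R) h; rewrite nm_cexp nm1 -expR0.
  by move/expR_inj.
have pi0 := @pi_gt0 R.
pose k := Num.floor ((Im z + pi) / (2 * pi)).
exists k; pose w := z - k%:~R * twopii.
have hw : cexp w = 1 by rewrite cexpB h cexp_twopiiz divr1.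
have Rew : Re w = 0.
  by rewrite /w intC twopiiE !ReIm/= Re0; ring.
have Imw : Im w = Im z - k%:~R * (2 * pi).
  by rewrite /w intC twopiiE !ReIm/=; ring.
have [k1 k2] : k%:~R <= (Im z + pi) / (2 * pi) /\
    (Im z + pi) / (2 * pi) < k%:~R + 1.
  by split; [exact: floor_le|have := floorD1_gt ((Im z + pi) / (2 * pi)); rewrite intrD].
move: k1 k2; rewrite ler_pdivlMr ?mulr_gt0// ltr_pdivrMr ?mulr_gt0// => k1 k2.
have hpi : `|Im w| <= pi by rewrite ler_norml Imw; apply/andP; split; lra.
suff w0 : w = 0 by move/eqP: w0; rewrite subr_eq0 => /eqP.
apply: complex_eq => //=; apply/eqP; rewrite -normr_eq0; apply/eqP.
apply: (@cos_inj R); rewrite ?in_itv/= ?normr_ge0 ?lexx ?pi_ge0//.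
rewrite cos0 cos_norm; have := congr1 (@Re R) hw.
by rewrite /cexp Rew expR0 mul1r.
Qed.

Lemma cexp_inj_mod x y : cexp x = cexp y -> exists k : int, x = y + k%:~R * twopii.
Proof.
move=> h; have /cexp_eq1[k hk] : cexp (x - y) = 1.
  by rewrite cexpB h divff// cexp_neq0.
by exists k; rewrite -hk; ring.
Qed.

(** ** Second-order estimates at the origin *)

Lemma expR_quad (t : R) : `|t| <= 1 / 2 -> `|expR t - 1 - t| <= 2 * t ^+ 2.
Proof.
rewrite ler_norml => /andP[t1 t2].
have h1 := expR_ge1Dx t; have h2 := expR_ge1Dx (- t).
rewrite ger0_norm; last by lra.
have h3 := expRxMexpNx_1 t; have h4 := expR_gt0 t.
have h5 : expR t * (1 - t) <= 1.
  rewrite -[leRHS]h3 ler_pM2l//.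
have : (expR t - 1 - t - 2 * t ^+ 2) * (1 - t) <= 0.
  have -> : (expR t - 1 - t - 2 * t ^+ 2) * (1 - t) =
    expR t * (1 - t) - 1 - t ^+ 2 * (1 - 2 * t) by ring.
  have : 0 <= t ^+ 2 * (1 - 2 * t) by apply: mulr_ge0; rewrite ?sqr_ge0//; lra.
  by lra.
by rewrite pmulr_lle0; lra.
Qed.

Lemma sin_norm_le (t : R) : `|sin t| <= `|t|.
Proof.
have P (u : R) : 0 <= u -> `|sin u| <= u.
  move=> u0; have [x _] := MVT_segment u0 (fun r _ => is_derive_sin r)
    (continuous_subspaceT (@continuous_sin R)).
  by rewrite sin0 !subr0 => ->; rewrite normrM (ger0_norm u0) ler_piMl// cos_max.
case: (leP 0 t) => t0; first by rewrite [leRHS]ger0_norm// P.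
have := P (- t); rewrite sinN normrN => h.
by rewrite [leRHS]ltr0_norm// h// oppr_ge0 ltW.
Qed.

Lemma cos_quad (t : R) : `|cos t - 1| <= t ^+ 2.
Proof.
have -> : cos t - 1 = - ((sin (t / 2)) ^+ 2 *+ 2).
  have -> : cos t = cos ((t / 2) *+ 2) by congr cos; rewrite -mulr_natr; field.
  rewrite cos_mulr2n cos2sin2; ring.
rewrite normrN normrMn normrX real_normK ?num_real// -[leLHS]mulr_natr.
have h := sin_norm_le (t / 2); have h0 := normr_ge0 (sin (t / 2)).
have : `|sin (t / 2)| ^+ 2 <= `|t / 2| ^+ 2 by rewrite ler_sqr ?nnegrE.
rewrite !real_normK ?num_real// => h2.
have h3 : (t / 2) ^+ 2 = t ^+ 2 / 4 by field.
by have := sqr_ge0 t; rewrite h3 in h2; lra.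
Qed.

Lemma sin_quad (t : R) : `|t| <= 1 -> `|sin t - t| <= t ^+ 2.
Proof.
have P (u : R) : 0 <= u <= 1 -> `|sin u - u| <= u ^+ 2.
  move=> /andP[u0 u1]; have [x] := MVT_segment u0 (fun r _ => is_derive_sin r)
    (continuous_subspaceT (@continuous_sin R)).
  rewrite in_itv/= => /andP[x0 xu]; rewrite sin0 !subr0 => ->.
  have -> : cos x * u - u = (cos x - 1) * u by ring.
  rewrite normrM (ger0_norm u0) expr2 ler_wpM2r// (le_trans (cos_quad x))//.
  by rewrite expr2 (le_trans _ xu)// ler_piMl// (le_trans xu).
rewrite ler_norml => /andP[t1 t2].
case: (lerP 0 t) => t0; first by rewrite P// t0.
have -> : sin t - t = - (sin (- t) - - t) by rewrite sinN; ring.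
by rewrite normrN -(sqrrN t) P//; lra.
Qed.

(** The constants in these estimates are not sharp: only the order matters. *)
Lemma cexp_quad z : nm z <= 1 / 2 -> nm (cexp z - 1 - z) <= 12 * nm z ^+ 2.
Proof.
move=> hz.
have hx : `|Re z| <= 1 / 2 := le_trans (nm_Re z) hz.
have hy : `|Im z| <= 1 / 2 := le_trans (nm_Im z) hz.
have hy1 : `|Im z| <= 1 by lra.
have e1 := expR_quad hx; have e2 := cos_quad (Im z); have e3 := sin_quad hy1.
have e4 : expR (Re z) <= 2.
  have := ler_norm (expR (Re z) - 1 - Re z).
  have : (Re z) ^+ 2 <= (1 / 2) ^+ 2 by rewrite -(real_normK (num_real (Re z))) ler_sqr ?nnegrE ?divr_ge0.
  have := ler_norm (Re z); lra.
have e0 := expR_gt0 (Re z).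
rewrite (le_trans (nm_le _))// nm_sqr /cexp !ReIm/= mul0r subr0 mul0r addr0 oppr0 addr0.
have h1 : `|expR (Re z) * cos (Im z) - 1 - Re z| <= 2 * Re z ^+ 2 + 2 * Im z ^+ 2.
  have -> : expR (Re z) * cos (Im z) - 1 - Re z =
    (expR (Re z) - 1 - Re z) + expR (Re z) * (cos (Im z) - 1) by ring.
  rewrite (le_trans (ler_normD _ _))// lerD// normrM (gtr0_norm e0).
  by apply: ler_pM => //; rewrite ltW.
have h2 : `|expR (Re z) * sin (Im z) - Im z| <= 2 * Im z ^+ 2 + (2 * Re z ^+ 2 + 2 * Im z ^+ 2).
  have -> : expR (Re z) * sin (Im z) - Im z =
    expR (Re z) * (sin (Im z) - Im z) + ((expR (Re z) - 1 - Re z) + Re z) * Im z by ring.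
  rewrite (le_trans (ler_normD _ _))// lerD//.
    by rewrite normrM (gtr0_norm e0); apply: ler_pM => //; rewrite ltW.
  rewrite normrM.
  have q1 : `|expR (Re z) - 1 - Re z + Re z| <= 2 * `|Re z|.
    rewrite (le_trans (ler_normD _ _))//.
    have : (Re z) ^+ 2 <= `|Re z| * (1 / 2).
      by rewrite -(real_normK (num_real (Re z))) expr2 ler_wpM2l.
    by lra.
  have q2 : `|expR (Re z) - 1 - Re z + Re z| * `|Im z| <= 2 * `|Re z| * `|Im z|.
    by rewrite ler_wpM2r.
  rewrite (le_trans q2)//.
  have := sqr_ge0 (`|Re z| - `|Im z|).
  rewrite -(real_normK (num_real (Re z))) -(real_normK (num_real (Im z))).
  by set a := `|Re z|; set b := `|Im z|; nra.
have := sqr_ge0 (Re z); have := sqr_ge0 (Im z).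
by lra.
Qed.

Lemma cderiv_cexp z : cderiv cexp z (cexp z).
Proof.
exists (nm (cexp z) * 12); have H : \forall y \near cnbhs z, nm (y - z) < 1 / 2.
  by apply: cnbhs_ball; rewrite divr_gt0.
near=> y.
have -> : cexp y - cexp z - cexp z * (y - z) =
  cexp z * (cexp (y - z) - 1 - (y - z)).
  by rewrite cexpB; field; exact: cexp_neq0.
rewrite nmM -mulrA ler_wpM2l ?nm_ge0// cexp_quad// ltW//; by near: y.
Unshelve. all: by end_near. Qed.

End Exponential.

(** * The principal logarithm *)

Section Logarithm.
Variable R : realType.
Local Notation C := R[i].
Implicit Types (x y z w : C) (r s t : R).

(** The complex plane slit along the nonpositive reals, where the principal
    logarithm is analytic. *)
Definition slit z := ~~ ((Im z == 0) && (Re z <= 0)).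

Lemma slit_neq0 z : slit z -> z != 0.
Proof. by apply: contraNneq => ->; rewrite /= eqxx lexx. Qed.

Lemma unit_cos z : z != 0 -> -1 <= Re z / nm z <= 1.
Proof.
rewrite -nm_gt0 => z0; have := nm_Re z.
by rewrite ler_norml ler_pdivlMr// ler_pdivrMr// mul1r mulN1r.
Qed.

Lemma cos_Arg z : z != 0 -> cos (Arg z) = Re z / nm z.
Proof.
move=> z0; have h := unit_cos z0; rewrite /Arg.
by case: ifP => _; rewrite ?cosN acosK// in_itv.
Qed.

Lemma sin_Arg z : z != 0 -> sin (Arg z) = Im z / nm z.
Proof.
move=> z0; have h := unit_cos z0.
have n0 : 0 < nm z by rewrite nm_gt0.
have E : sin (acos (Re z / nm z)) = `|Im z| / nm z.
  rewrite sin_acos// -[in RHS](ger0_norm (ltW n0)) -normf_div -sqrtr_sqr.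
  congr Num.sqrt; rewrite !expr_div_n nm_sqr; field.
  by rewrite -nm_sqr sqrf_eq0 gt_eqF.
rewrite /Arg; case: ifPn => [i0|]; first by rewrite E ger0_norm.
by rewrite -ltNge => i0; rewrite sinN E ltr0_norm// mulNr opprK.
Qed.

Lemma cexp_Log z : z != 0 -> cexp (Log z) = z.
Proof.
move=> z0; rewrite /cexp /Log/=.
have n0 : 0 < nm z by rewrite nm_gt0.
rewrite lnK ?posrE// cos_Arg// sin_Arg//.
by apply: complex_eq; rewrite !ReIm/=; field; rewrite gt_eqF.
Qed.

Lemma Arg_bounds z : z != 0 -> - pi < Arg z <= pi.
Proof.
move=> z0; have h := unit_cos z0; have p0 := @pi_gt0 R.
have h1 := acos_ge0 h; have h2 := acos_lepi h.
rewrite /Arg; case: ifPn => i0; first by rewrite h2 andbT; lra.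
rewrite ltrN2; apply/andP; split; last by lra.
apply: acos_ltpi; have [a1 ->] := andP h; rewrite andbT lt_neqAle a1 andbT.
have n0 : 0 < nm z by rewrite nm_gt0.
apply: contra i0 => /eqP h3.
have h4 : Re z = - nm z by rewrite -[RHS]mulN1r h3 divfK ?gt_eqF.
have := nm_sqr z; rewrite h4 sqrrN -[X in X = _]addr0 => /addrI /esym/eqP.
by rewrite sqrf_eq0 => /eqP ->.
Qed.

Lemma Log_uniq y z : cexp y = z -> - pi < Im y <= pi -> Log z = y.
Proof.
move=> <- /andP[h1 h2]; have h := cexp_Log (cexp_neq0 y).
have [k hk] := cexp_inj_mod h.
have /andP[h3 h4] := Arg_bounds (cexp_neq0 y).
have hI : Arg (cexp y) = Im y + k%:~R * (2 * pi).
  by have := congr1 (@complex.Im R) hk; rewrite /Log /= intC twopiiE !ReIm/= => ->; ring.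
have p0 := @pi_gt0 R.
have k1 : (k%:~R : R) < 1.
  by rewrite -(@ltr_pM2r _ (2 * pi)) ?mulr_gt0// mul1r; lra.
have k2 : (-1 : R) < k%:~R.
  by rewrite -(@ltr_pM2r _ (2 * pi)) ?mulr_gt0// mulN1r; lra.
have k0 : k = 0.
  move: k1 k2; rewrite -[1]/(1%:~R) -mulrNz !ltr_int => k1 k2.
  by apply/eqP; rewrite eq_le; apply/andP; split; lia.
by rewrite hk k0 mul0r addr0.
Qed.

Lemma Log1 : Log (1 : C) = 0.
Proof.
by apply: Log_uniq; rewrite ?cexp0//= oppr_lt0 pi_gt0 pi_ge0.
Qed.

(** The logarithm is additive as long as the sum of the arguments is principal. *)
Lemma LogM x y : x != 0 -> y != 0 -> - pi < Arg x + Arg y <= pi ->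
  Log (x * y) = Log x + Log y.
Proof.
by move=> x0 y0 h; apply: Log_uniq; rewrite ?cexpD ?cexp_Log.
Qed.

Lemma slit_Arg z : slit z -> `|Arg z| < pi.
Proof.
move=> hz; have z0 := slit_neq0 hz; have /andP[h1 h2] := Arg_bounds z0.
rewrite ltr_norml h1 lt_neqAle h2 andbT; apply/eqP => h.
have n0 : 0 < nm z by rewrite nm_gt0.
have := cos_Arg z0; rewrite h cospi => h3.
have := sin_Arg z0; rewrite h sinpi => h4.
move: hz; rewrite /slit; have -> : Im z = 0.
  by rewrite -[LHS](@divfK _ (nm z)) ?gt_eqF// -h4 mul0r.
have -> : Re z = - nm z by rewrite -[RHS]mulN1r h3 divfK ?gt_eqF.
by rewrite eqxx oppr_le0 ltW.
Qed.

(** ** The logarithm near 1 *)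

Lemma atan_norm_le t : `|atan t| <= `|t|.
Proof.
have P (u : R) : 0 <= u -> `|atan u| <= u.
  move=> u0; have [x _] := MVT_segment u0 (fun r _ => is_derive1_atan r)
    (continuous_subspaceT (@continuous_atan R)).
  rewrite atan0 !subr0 => ->; rewrite normrM (ger0_norm u0) ler_piMl//.
  by rewrite normfV invf_le1 ?ger0_norm ?addr_ge0 ?sqr_ge0 ?lerDl ?sqr_ge0// ltr_wpDr// sqr_ge0.
case: (leP 0 t) => t0; first by rewrite [leRHS]ger0_norm// P.
have := P (- t); rewrite atanN normrN => h.
by rewrite [leRHS]ltr0_norm// h// oppr_ge0 ltW.
Qed.

Lemma Arg_atan z : 0 < Re z -> Arg z = atan (Im z / Re z).
Proof.
move=> r0; have z0 : z != 0 by apply: contraTneq r0 => ->; rewrite ltxx.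
have n0 : 0 < nm z by rewrite nm_gt0.
have c0 : 0 < cos (Arg z) by rewrite cos_Arg// divr_gt0.
have p0 := @pi_gt0 R.
have hA : `|Arg z| < pi / 2.
  have := Arg_bounds z0 => /andP[h1 h2].
  have hn : `|Arg z| <= pi by rewrite ler_norml h2 ltW.
  rewrite ltNge; apply/negP => h3.
  suff : cos `|Arg z| <= 0 by rewrite cos_norm leNgt c0.
  have [->|h4] := eqVneq (`|Arg z|) (pi / 2); first by rewrite cos_pihalf.
  rewrite -(@cos_pihalf R) ltW// ltr_cos ?in_itv/= ?normr_ge0//.
    by rewrite lt_neqAle eq_sym h4.
  by apply/andP; split; lra.
have -> : Im z / Re z = tan (Arg z).
  by rewrite /tan cos_Arg// sin_Arg//; field; rewrite !gt_eqF.
by rewrite tanK// in_itv/= -ltr_norml.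
Qed.

Lemma ln_norm_near1 r : `|r - 1| <= 1 / 2 -> `|ln r| <= 2 * `|r - 1|.
Proof.
move=> h; move: (h); rewrite ler_norml => /andP[h1 h2].
have r0 : 0 < r by lra.
have e1 : ln r <= r - 1 by have := @le_ln1Dx R (r - 1); rewrite (_ : 1 + (r - 1) = r); [apply; lra | ring].
have e2 : - ln r <= r^-1 - 1.
  rewrite -lnV ?posrE//; have h0 : 0 < r^-1 by rewrite invr_gt0.
  by have := @le_ln1Dx R (r^-1 - 1); rewrite (_ : 1 + (r^-1 - 1) = r^-1); [apply; lra | ring].
have e3 : r^-1 - 1 <= 2 * `|r - 1|.
  have -> : r^-1 - 1 = - (r - 1) / r by field; rewrite gt_eqF.
  rewrite ler_pdivrMr// (@le_trans _ _ (`|r - 1|))//.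
    by rewrite -normrN ler_norm.
  have := normr_ge0 (r - 1); set a := `|r - 1|; nra.
have e4 := ler_norm (r - 1); have e5 := normr_ge0 (r - 1).
by rewrite ler_norml; apply/andP; split; lra.
Qed.

Lemma nm_near1 y : `|nm (1 + y) - 1| <= nm y.
Proof.
have h1 := nmD 1 y; have h2 := nmBD (1 + y) y; rewrite addrK in h2.
by rewrite nm1 in h1 h2; rewrite ler_norml; apply/andP; split; lra.
Qed.

Lemma Log_lip1 y : nm y <= 1 / 2 -> nm (Log (1 + y)) <= 4 * nm y.
Proof.
move=> hy; have hR := nm_Re y; have hI := nm_Im y.
have hr : 1 / 2 <= Re (1 + y) by rewrite ReD/=; move: hR; rewrite ler_norml => /andP[]; lra.
rewrite (le_trans (nm_le _))//=.
have h1 : `|ln (nm (1 + y))| <= 2 * nm y.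
  have h := nm_near1 y.
  by rewrite (le_trans (ln_norm_near1 _))// ?(le_trans h)// ler_pM2l.
have h2 : `|Arg (1 + y)| <= 2 * nm y.
  rewrite Arg_atan; last by lra.
  rewrite (le_trans (atan_norm_le _))// normrM normfV ImD/= add0r.
  rewrite (ger0_norm (_ : 0 <= Re _)); last by lra.
  rewrite ler_pdivrMr; last by lra.
  have := nm_ge0 y; have := normr_ge0 (Im y); nra.
by lra.
Qed.

Lemma Log_quad1 y : nm y <= 1 / 8 -> nm (Log (1 + y) - y) <= 192 * nm y ^+ 2.
Proof.
move=> hy; have y0 := nm_ge0 y; have h1 : nm (Log (1 + y)) <= 4 * nm y by apply: Log_lip1; lra.
have y1 : 1 + y != 0.
  rewrite -nm_gt0; have := nm_near1 y; rewrite ler_norml => /andP[]; lra.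
have := @cexp_quad R (Log (1 + y)); rewrite cexp_Log// => h2.
have -> : Log (1 + y) - y = - (1 + y - 1 - Log (1 + y)) by ring.
rewrite nmN (le_trans (h2 _))//; first by lra.
have -> : 192 * nm y ^+ 2 = 12 * (4 * nm y) ^+ 2 by ring.
by rewrite ler_pM2l// ler_sqr ?nnegrE ?nm_ge0// mulr_ge0.
Qed.

Lemma Arg_lip1 y : nm y <= 1 / 2 -> `|Arg (1 + y)| <= 4 * nm y.
Proof. by move=> /Log_lip1; apply: le_trans; exact: (nm_Im (Log (1 + y))). Qed.

(** The threshold depends only on the distance of the argument to [pi], hence it
    is uniform along a segment of integration. *)
Lemma Log_shift z y (th : R) : z != 0 -> `|Arg z| <= th -> nm y <= 1 / 2 ->
  4 * nm y < pi - th -> Log (z * (1 + y)) = Log z + Log (1 + y).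
Proof.
move=> z0 hz hy hth; apply: LogM => //.
  by rewrite -nm_gt0; have := nm_near1 y; rewrite ler_norml => /andP[]; lra.
have := Arg_lip1 hy; move: hz; rewrite !ler_norml => /andP[a1 a2] /andP[b1 b2].
by apply/andP; split; lra.
Qed.

Lemma cderiv_Log z : slit z -> cderiv (@Log R) z z^-1.
Proof.
move=> hz; have z0 := slit_neq0 hz; have hA := slit_Arg hz.
have n0 : 0 < nm z by rewrite nm_gt0.
pose d := Num.min (1 / 8) ((pi - `|Arg z|) / 8) * nm z.
have d0 : 0 < d by rewrite mulr_gt0// lt_min !divr_gt0// subr_gt0.
exists (192 / nm z ^+ 2); have H := cnbhs_ball z d0; near=> y.
have hy : nm (y - z) < d by near: y.
pose q := (y - z) / z.
have hq : nm q < Num.min (1 / 8) ((pi - `|Arg z|) / 8).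
  by rewrite nmM nmV ltr_pdivrMr.
move: hq; rewrite lt_min => /andP[q1 q2].
have -> : y = z * (1 + q) by rewrite /q; field.
have -> : z * (1 + q) - z = z * q by ring.
rewrite (@Log_shift z q `|Arg z|) ?lexx//; [|by lra|by have := nm_ge0 q; lra].
have -> : Log z + Log (1 + q) - Log z - z^-1 * (z * q) = Log (1 + q) - q.
  by field.
rewrite (le_trans (Log_quad1 (ltW q1)))// nmM le_eqVlt; apply/orP; left.
by apply/eqP; field; rewrite gt_eqF.
Unshelve. all: by end_near. Qed.

Lemma slit_near z : slit z -> \forall y \near cnbhs z, slit y.
Proof.
move=> hz; have [iz|iz] := eqVneq (Im z) 0; last first.
  exists (`|Im z|); first by rewrite normr_gt0.
  move=> y hy; rewrite /slit negb_and; apply/orP; left.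
  apply: contraTneq hy => iy; rewrite -leNgt.
  by have := nm_Im (y - z); rewrite ImD ImN iy add0r normrN.
have rz : 0 < Re z by move: hz; rewrite /slit iz eqxx/= -ltNge.
exists (Re z) => // y hy; rewrite /slit negb_and; apply/orP; right.
rewrite -ltNge; have := le_lt_trans (nm_Re (y - z)) hy.
by rewrite ReD ReN ltr_norml => /andP[]; lra.
Qed.

End Logarithm.

(** * Integrals over the unit interval *)

Section UnitIntegral.
Variable R : realType.
Local Notation C := R[i].
Local Notation mu := (@lebesgue_measure R).
Implicit Types (f g F : R -> R) (s t M : R).

Definition cont01 f := forall s, 0 <= s <= 1 -> {for s, continuous f}.

Lemma cont01_within f : cont01 f -> {within `[0, 1], continuous f}.
Proof.
move=> Hf; apply: continuous_in_subspaceT => x.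
by rewrite inE/= in_itv/= => ?; apply: Hf.
Qed.

Lemma cont01_integrable f : cont01 f -> mu.-integrable `[0, 1] (EFin \o f).
Proof.
move=> Hf; apply: continuous_compact_integrable; first exact: segment_compact.
exact: cont01_within.
Qed.

(** The integrand of the dilogarithm is continuous only after a change of its
    value at 0. *)
Lemma integral01_eq f g : cont01 f -> (forall s, 0 < s <= 1 -> f s = g s) ->
  \int[mu]_(s in `[0, 1]) g s = \int[mu]_(s in `[0, 1]) f s.
Proof.
move=> Hf E; have I := cont01_integrable Hf.
have If : mu.-integrable `]0, 1] (EFin \o f).
  by apply: integrableS I => //; apply: subset_itvr; rewrite bnd_simp.
have Ig : mu.-integrable `]0, 1] (EFin \o g).
  apply: eq_integrable If => // s.
  by rewrite inE/= in_itv/= => /E ->.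
rewrite -(Rintegral_itv_obnd_cbnd If) -(Rintegral_itv_obnd_cbnd Ig).
by apply: eq_Rintegral => s; rewrite inE/= in_itv/= => /E ->.
Qed.

Lemma integral01_cst M : \int[mu]_(s in `[0, 1]) M = M.
Proof.
rewrite Rintegral_cst//= lebesgue_measure_itv/= lte_fin ltr01 oppr0 adde0/=.
by rewrite mulr1.
Qed.

Lemma integral01_bound f M : cont01 f -> (forall s, 0 <= s <= 1 -> `|f s| <= M) ->
  `|\int[mu]_(s in `[0, 1]) f s| <= M.
Proof.
move=> Hf HM; rewrite (le_trans (le_normr_Rintegral _ (cont01_integrable Hf)))//.
have H1 : mu.-integrable `[0, 1] (EFin \o (fun s => `|f s|)).
  apply: cont01_integrable => s hs.
  by apply: (@cvg_norm _ _ _ _ _ f (f s)); exact: Hf.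
have H2 : mu.-integrable `[0, 1] (EFin \o (fun=> M)).
  by apply: cont01_integrable => s hs; exact: cvg_cst.
rewrite -[leRHS]integral01_cst; exact: (le_Rintegral _ H1 H2).
Qed.

Lemma integral01_FTC f F : cont01 f ->
  (forall s, 0 <= s <= 1 -> is_derive s 1 F (f s)) ->
  \int[mu]_(s in `[0, 1]) f s = F 1 - F 0.
Proof.
move=> Hf HF; rewrite /Rintegral (@continuous_FTC2 _ f F)//.
- exact: cont01_within.
- split.
  + move=> s; rewrite in_itv/= => /andP[s0 s1].
    by have [] := HF s; rewrite ?(ltW s0) ?(ltW s1).
  + apply: cvg_at_right_filter; apply: is_derive_continuous.
    by apply: HF; rewrite lexx ler01.
  + apply: cvg_at_left_filter; apply: is_derive_continuous.
    by apply: HF; rewrite lexx ler01.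
- move=> s; rewrite in_itv/= => /andP[s0 s1].
  rewrite derive1E; apply: derive_val; apply: HF; by rewrite !ltW.
Qed.

(** ** Complex-valued integrands *)

(** Real and imaginary parts are integrated separately, as in the definition of
    the dilogarithm. *)
Definition cint (f : R -> C) : C :=
  (\int[mu]_(s in `[0, 1]) Re (f s)) +i* (\int[mu]_(s in `[0, 1]) Im (f s)).

Definition ccont (f : R -> C) :=
  cont01 (fun s => Re (f s)) /\ cont01 (fun s => Im (f s)).

Lemma cint_eq (f g : R -> C) : ccont f -> (forall s, 0 < s <= 1 -> f s = g s) ->
  cint g = cint f.
Proof.
move=> [Hr Hi] E; rewrite /cint; congr (_ +i* _).
  by apply: (integral01_eq Hr) => s /E ->.
by apply: (integral01_eq Hi) => s /E ->.
Qed.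

Lemma cintB (f g : R -> C) : ccont f -> ccont g ->
  cint (fun s => f s - g s) = cint f - cint g.
Proof.
move=> [Hr Hi] [Kr Ki]; rewrite /cint; apply: complex_eq => /=.
  rewrite -RintegralB ?cont01_integrable//.
  by apply: eq_Rintegral => s _; rewrite ReD ReN.
rewrite -RintegralB ?cont01_integrable//.
by apply: eq_Rintegral => s _; rewrite ImD ImN.
Qed.

Lemma cont01D f g : cont01 f -> cont01 g -> cont01 (fun s => f s + g s).
Proof. by move=> Hf Hg s hs; apply: cvgD; [exact: Hf|exact: Hg]. Qed.

Lemma cont01N f : cont01 f -> cont01 (fun s => - f s).
Proof. by move=> Hf s hs; apply: cvgN; exact: Hf. Qed.

Lemma cont01Z M f : cont01 f -> cont01 (fun s => M * f s).
Proof. by move=> Hf s hs; apply: cvgMr; exact: Hf. Qed.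

Lemma cont01_ext f g : (forall s, f s = g s) -> cont01 f -> cont01 g.
Proof. by move=> /funext ->. Qed.

Lemma ccontB (f g : R -> C) : ccont f -> ccont g -> ccont (fun s => f s - g s).
Proof.
move=> [Hr Hi] [Kr Ki]; split.
  by apply: cont01_ext (cont01D Hr (cont01N Kr)) => s; rewrite !ReIm.
by apply: cont01_ext (cont01D Hi (cont01N Ki)) => s; rewrite !ReIm.
Qed.

Lemma ccontZ (c : C) (f : R -> C) : ccont f -> ccont (fun s => c * f s).
Proof.
move=> [Hr Hi]; split.
  have H := cont01D (cont01Z (M := Re c) Hr) (cont01N (cont01Z (M := Im c) Hi)).
  refine (cont01_ext _ H) => s.
  by rewrite !ReIm.
have H := cont01D (cont01Z (M := Re c) Hi) (cont01Z (M := Im c) Hr).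
refine (cont01_ext _ H) => s.
by rewrite !ReIm.
Qed.

Lemma cintZ (c : C) (f : R -> C) : ccont f ->
  cint (fun s => c * f s) = c * cint f.
Proof.
move=> [Hr Hi]; rewrite /cint; apply: complex_eq; rewrite !ReIm/=.
  rewrite -!RintegralZl ?cont01_integrable// -RintegralB//.
  - by apply: eq_Rintegral => s _; rewrite !ReIm.
  - by apply: cont01_integrable; exact: cont01Z.
  - by apply: cont01_integrable; exact: cont01Z.
rewrite -!RintegralZl ?cont01_integrable// -RintegralD//.
- by apply: eq_Rintegral => s _; rewrite !ReIm.
- by apply: cont01_integrable; exact: cont01Z.
- by apply: cont01_integrable; exact: cont01Z.
Qed.

Lemma cint_bound (f : R -> C) M : ccont f ->
  (forall s, 0 <= s <= 1 -> nm (f s) <= M) -> nm (cint f) <= 2 * M.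
Proof.
move=> [Hr Hi] HM; rewrite (le_trans (nm_le _))//= mulr2n mulrDl mul1r lerD//.
  by apply: integral01_bound => // s /HM; apply: le_trans; exact: nm_Re.
by apply: integral01_bound => // s /HM; apply: le_trans; exact: nm_Im.
Qed.

Lemma ccont_cderiv (f : C -> C) (l : R -> C) :
  (forall s : R, 0 <= s <= 1 -> cderiv f (s%:C) (l s)) ->
  ccont (fun s => f (s%:C)).
Proof.
move=> H; split => s hs.
  exact: is_derive_continuous (cderiv_is_derive_Re (H s hs)).
exact: is_derive_continuous (cderiv_is_derive_Im (H s hs)).
Qed.

Lemma cint_FTC (f F : C -> C) : ccont (fun s => f (s%:C)) ->
  (forall s : R, 0 <= s <= 1 -> cderiv F (s%:C) (f (s%:C))) ->
  cint (fun s => f (s%:C)) = F 1 - F 0.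
Proof.
move=> [Hr Hi] HF; rewrite /cint; apply: complex_eq; rewrite !ReIm/=.
  by rewrite (integral01_FTC Hr (fun s hs => cderiv_is_derive_Re (HF s hs))).
by rewrite (integral01_FTC Hi (fun s hs => cderiv_is_derive_Im (HF s hs))).
Qed.

End UnitIntegral.

(** * Differentiability of the dilogarithm *)

Section Dilogarithm.
Variable R : realType.
Local Notation C := R[i].
Implicit Types (x y z w h : C) (r s t : R).

Lemma acos_anti r s : -1 <= r -> r <= s -> s <= 1 -> acos s <= acos r.
Proof.
move=> r1 rs s1.
have hr : -1 <= r <= 1 by rewrite r1 (le_trans rs).
have hs : -1 <= s <= 1 by rewrite s1 (le_trans r1).
rewrite leNgt; apply/negP => h.
have : cos (acos s) < cos (acos r).
  by rewrite ltr_cos// in_itv/= ?acos_ge0 ?acos_lepi.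
by rewrite !acosK ?in_itv// ltNge rs.
Qed.

Lemma norm_Arg z : z != 0 -> `|Arg z| = acos (Re z / nm z).
Proof.
move=> z0; have h := acos_ge0 (unit_cos z0).
by rewrite /Arg; case: ifP => _; rewrite ?normrN ger0_norm.
Qed.

Lemma slit_segment z s : slit (1 - z) -> 0 <= s <= 1 -> slit (1 - s%:C * z).
Proof.
move=> hz /andP[s0 s1]; move: hz; rewrite /slit !ReIm/= !mul0r !subr0 !addr0 !add0r.
have [iz|iz] := eqVneq (Im z) 0.
  rewrite iz mulr0 oppr0 eqxx/= -!ltNge => rz.
  have [r0|r0] := leP (Re z) 0.
    have : s * Re z <= 0 by rewrite mulr_ge0_le0.
    by lra.
  have : s * Re z <= Re z by rewrite ler_piMl// ltW.
  by lra.
move=> _; have [->|s0'] := eqVneq s 0; first by rewrite !mul0r subr0 negb_and -ltNge ltr01 orbT.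
by rewrite negb_and oppr_eq0 mulf_eq0 negb_or s0' iz.
Qed.

(** With this the threshold of [Log_shift] is uniform along the segment that
    defines [Li2 z]. The argument is an arccosine, so the claim compares cosines. *)
Lemma Arg_segment z s : slit (1 - z) -> 0 <= s <= 1 ->
  `|Arg (1 - s%:C * z)| <= `|Arg (1 - z)|.
Proof.
move=> hz hs; have hs' := slit_segment hz hs.
have w0 := slit_neq0 hz; have w'0 := slit_neq0 hs'.
rewrite !norm_Arg//; have [/andP[a1 a2] /andP[b1 b2]] := (unit_cos w0, unit_cos w'0).
apply: acos_anti => //; set w := 1 - z; set w' := 1 - _ * z.
have n0 : 0 < nm w by rewrite nm_gt0.
have n'0 : 0 < nm w' by rewrite nm_gt0.
have /andP[s0 s1] := hs.
have e1 : w' = (1 - s)%:C + s%:C * w by rewrite rcB /w /w'; ring.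
have e2 : s%:C * w = w' - (1 - s)%:C by rewrite e1; ring.
have h1 : nm w' <= (1 - s) + s * nm w.
  by rewrite e1 (le_trans (nmD _ _))// nmM !nm_real !ger0_norm// subr_ge0.
have h2 : s * nm w <= nm w' + (1 - s).
  have := nmBD w' ((1 - s)%:C); rewrite -e2 nmM !nm_real !ger0_norm//.
  by rewrite subr_ge0.
have e3 : Re w' = (1 - s) + s * Re w by rewrite e1 !ReIm/=; ring.
have h3 : `|Re w| <= nm w := nm_Re w.
rewrite ler_pdivrMr// mulrAC ler_pdivlMr// e3.
have [A0|A0] := leP 0 (Re w).
  have hA : Re w <= nm w := le_trans (ler_norm _) h3.
  apply: (le_trans (ler_wpM2l A0 h1)).
  have : (1 - s) * Re w <= (1 - s) * nm w by rewrite ler_wpM2l// subr_ge0.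
  by lra.
have hA : - Re w <= nm w by rewrite (le_trans _ h3)// -normrN ler_norm.
have : - Re w * (s * nm w) <= - Re w * (nm w' + (1 - s)).
  by rewrite ler_wpM2l// oppr_ge0 ltW.
have : (1 - s) * - Re w <= (1 - s) * nm w by rewrite ler_wpM2l// subr_ge0.
by lra.
Qed.

(** Bounds the denominators of the difference quotients along the segment. *)
Lemma segment_away z : slit (1 - z) ->
  exists2 m : R, 0 < m & forall s, 0 <= s <= 1 -> m <= nm (1 - s%:C * z).
Proof.
move=> hz; have [iz|iz] := eqVneq (Im z) 0.
  have rz : 0 < 1 - Re z.
    by move: hz; rewrite /slit !ReIm/= iz oppr0 addr0 eqxx/= -ltNge.
  exists (Num.min 1 (1 - Re z)); first by rewrite lt_min ltr01.
  move=> s /andP[s0 s1]; rewrite (le_trans _ (nm_Re _))// (le_trans _ (ler_norm _))//.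
  have -> : Re (1 - s%:C * z) = 1 - s * Re z by rewrite !ReIm/= iz; ring.
  rewrite ge_min.
  have [r0|r0] := leP (Re z) 0.
    have : s * Re z <= 0 by rewrite mulr_ge0_le0.
    by move=> ?; apply/orP; left; lra.
  have : s * Re z <= Re z by rewrite ler_piMl// ltW.
  by move=> ?; apply/orP; right; lra.
have z0 : z != 0 by apply: contraNneq iz => ->.
have n0 : 0 < nm z by rewrite nm_gt0.
exists (`|Im z| / nm z); first by rewrite divr_gt0// normr_gt0.
move=> s _; rewrite ler_pdivrMr//.
rewrite -ler_sqr ?nnegrE ?mulr_ge0 ?nm_ge0// real_normK ?num_real// exprMn !nm_sqr.
rewrite !ReIm/= -subr_ge0.
rewrite (_ : _ - _ = (s * (Re z ^+ 2 + Im z ^+ 2) - Re z) ^+ 2) ?sqr_ge0//.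
by ring.
Qed.

(** The integrand of [- Li2], with the value at 0 that makes it continuous. *)
Definition Li2_integrand z (y : C) : C :=
  if y == 0 then - z else Log (1 - y * z) / (y * z) * z.

Lemma Li2_integrandE z y : y != 0 -> Li2_integrand z y = Log (1 - y * z) / y.
Proof.
move=> y0; rewrite /Li2_integrand (negbTE y0).
have [->|z0] := eqVneq z 0; last by field; rewrite y0 z0.
by rewrite !mulr0 subr0 Log1 mul0r.
Qed.

Lemma cderiv_Log1B z (y : C) : slit (1 - y * z) ->
  cderiv (fun y => Log (1 - y * z)) y (- z / (1 - y * z)).
Proof.
move=> hs.
have D : cderiv (fun y => 1 - y * z) y (- z).
  apply: (cderiv_eq (cderivB (cderiv_cst 1 y) (cderivM (cderiv_id y) (cderiv_cst z y)))).
  by ring.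
by apply: (cderiv_eq (cderiv_comp D (cderiv_Log hs))); rewrite mulrC.
Qed.

Lemma Li2_integrand_cont z : slit (1 - z) ->
  ccont (fun s : R => Li2_integrand z (s%:C)).
Proof.
move=> hz.
have P s : 0 <= s <= 1 -> s != 0 ->
    exists l, cderiv (Li2_integrand z) (s%:C) l.
  move=> hs s0; have s0' : s%:C != 0 :> C by rewrite -nm_eq0 nm_real normr_eq0.
  eexists; apply: (@cderiv_near _ _ (fun y => Log (1 - y * z) / y)).
    by apply: filterS (cnbhs_neq0 s0') => y; exact: Li2_integrandE.
  apply: cderiv_div (cderiv_id _) s0'; apply: cderiv_Log1B; exact: slit_segment.
have Q : exists2 d : R, 0 < d & forall s, `|s| < d ->
    nm (Li2_integrand z (s%:C) - Li2_integrand z 0) <= 192 * nm z ^+ 2 * `|s|.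
  exists (1 / 8 / (nm z + 1)); first by rewrite divr_gt0// ltr_wpDl ?nm_ge0.
  move=> s hs; have [->|s0] := eqVneq s 0.
    by rewrite subrr nm0 normr0 mulr0.
  have s0' : s%:C != 0 :> C by rewrite -nm_eq0 nm_real normr_eq0.
  rewrite (Li2_integrandE z s0') (_ : Li2_integrand z 0 = - z); last first.
    by rewrite /Li2_integrand eqxx.
  have hq : nm (- (s%:C * z)) <= 1 / 8.
    rewrite nmN nmM nm_real; move: hs; rewrite ltr_pdivlMr ?ltr_wpDl ?nm_ge0// => hs.
    have := normr_ge0 s; rewrite mulrDr mulr1 in hs; lra.
  have := Log_quad1 hq.
  have -> : Log (1 - s%:C * z) / s%:C - - z = (Log (1 - s%:C * z) - - (s%:C * z)) / s%:C.
    by field.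
  rewrite nmN [nm (_ / _)]nmM nmV nm_real ler_pdivrMr ?normr_gt0//.
  move/le_trans; apply; rewrite nmM nm_real exprMn [`|s| ^+ 2]expr2.
  by rewrite le_eqVlt; apply/orP; left; apply/eqP; ring.
have Q' (g : R -> R) : (forall s, `|g s - g 0| <= nm (Li2_integrand z (s%:C) - Li2_integrand z 0)) ->
    {for 0, continuous g}.
  move=> hg; case: Q => d d0 Hd; apply/cvgrPdist_le => /= e e0.
  have K0 : 0 < 192 * nm z ^+ 2 + 1 by rewrite ltr_wpDl// mulr_ge0 ?sqr_ge0.
  near=> s; rewrite distrC (le_trans (hg s))//.
  have h1 : `|s| < Num.min d (e / (192 * nm z ^+ 2 + 1)).
    near: s; have e'0 : 0 < Num.min d (e / (192 * nm z ^+ 2 + 1)).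
      by rewrite lt_min d0 divr_gt0.
    by exists (Num.min d (e / (192 * nm z ^+ 2 + 1))) => // t; rewrite /= sub0r normrN.
  move: h1; rewrite lt_min ltr_pdivlMr// => /andP[/Hd h1 h2].
  rewrite (le_trans h1)//; have := normr_ge0 s; rewrite mulrDr mulr1 in h2; lra.
split => s hs.
  have [->|s0] := eqVneq s 0.
    by apply: Q' => t; rewrite -ReN -ReD nm_Re.
  by have [l /cderiv_is_derive_Re/is_derive_continuous] := P s hs s0.
have [->|s0] := eqVneq s 0.
  by apply: Q' => t; rewrite -ImN -ImD nm_Im.
by have [l /cderiv_is_derive_Im/is_derive_continuous] := P s hs s0.
Unshelve. all: by end_near. Qed.

Lemma Li2E z : slit (1 - z) -> Li2 z = - cint (fun s => Li2_integrand z (s%:C)).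
Proof.
move=> hz; rewrite /Li2; congr (- _).
rewrite -(cint_eq (g := fun s => Log (1 - s%:C * z) / (s%:C * z) * z) (Li2_integrand_cont hz)) //.
move=> s /andP[s0 _]; rewrite /Li2_integrand ifF//.
by apply/negbTE; rewrite -nm_eq0 nm_real normr_eq0 gt_eqF.
Qed.

Definition dLi2 z := if z == 0 then 1 else - Log (1 - z) / z.

Lemma cderiv_inv1B z (y : C) : slit (1 - y * z) ->
  cderiv (fun y => (1 - y * z)^-1) y (z / (1 - y * z) ^+ 2).
Proof.
move=> hs.
have D : cderiv (fun y => 1 - y * z) y (- z).
  apply: (cderiv_eq (cderivB (cderiv_cst 1 y) (cderivM (cderiv_id y) (cderiv_cst z y)))).
  by ring.
apply: (cderiv_eq (cderivV D (slit_neq0 hs))).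
by field; exact: slit_neq0.
Qed.

(** Differentiation of [Li2] under the integral sign leads to this integral. *)
Lemma cint_inv1B z : slit (1 - z) ->
  cint (fun s : R => (1 - s%:C * z)^-1) = dLi2 z.
Proof.
move=> hz; rewrite /dLi2.
have K : ccont (fun s : R => (1 - s%:C * z)^-1).
  apply: (ccont_cderiv (f := fun y => (1 - y * z)^-1) (l := fun s => z / (1 - s%:C * z) ^+ 2)).
  by move=> s hs; apply: cderiv_inv1B; exact: slit_segment.
case: eqVneq => [->|z0].
  rewrite (_ : (fun s : R => _) = fun=> 1); last first.
    by apply/funext => s; rewrite mulr0 subr0 invr1.
  by rewrite /cint /= !integral01_cst.
rewrite (@cint_FTC _ (fun y => (1 - y * z)^-1) (fun y => - Log (1 - y * z) / z))//.
  by rewrite mul1r mul0r subr0 Log1 oppr0 mul0r subr0.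
move=> s hs; have hs' := slit_segment hz hs.
apply: (cderiv_eq (cderivM (cderivN (cderiv_Log1B hs')) (cderiv_cst z^-1 _))).
by have h0 := slit_neq0 hs'; field; rewrite ?h0 ?z0.
Qed.

(** Off its cut the dilogarithm is differentiable: the remainder of the
    integrand is quadratic, uniformly along the segment of integration. *)
Lemma cderiv_Li2 z : slit (1 - z) -> cderiv (@Li2 R) z (dLi2 z).
Proof.
move=> hz; have [m m0 Hm] := segment_away hz.
pose th := `|Arg (1 - z)|; have hth : th < pi := slit_Arg hz.
pose d := m * Num.min (1 / 8) ((pi - th) / 8).
have d0 : 0 < d by rewrite mulr_gt0// lt_min !divr_gt0// subr_gt0.
exists (2 * (192 / m ^+ 2)).
have H1 := cnbhs_ball z d0.
have H2 : \forall y \near cnbhs z, slit (1 - y).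
  have D : cderiv (fun y => 1 - y) z (- 1).
    by apply: (cderiv_eq (cderivB (cderiv_cst 1 z) (cderiv_id z))); rewrite sub0r.
  exact: (cderiv_cont D (slit_near hz)).
near=> y.
have hy : nm (y - z) < d by near: y.
have sy : slit (1 - y) by near: y.
pose h := y - z.
have K : ccont (fun s : R => (1 - s%:C * z)^-1).
  apply: (ccont_cderiv (f := fun y => (1 - y * z)^-1) (l := fun s => z / (1 - s%:C * z) ^+ 2)).
  by move=> s hs; apply: cderiv_inv1B; exact: slit_segment.
pose G (s : R) := Li2_integrand y (s%:C) - Li2_integrand z (s%:C) - (- h) * (1 - s%:C * z)^-1.
have KG : ccont G.
  apply: ccontB; first by apply: ccontB; exact: Li2_integrand_cont.
  exact: ccontZ.
have -> : Li2 y - Li2 z - dLi2 z * (y - z) = - cint G.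
  rewrite cintB; [|by apply: ccontB; exact: Li2_integrand_cont|exact: ccontZ].
  rewrite cintB; [|exact: Li2_integrand_cont|exact: Li2_integrand_cont].
  rewrite cintZ// cint_inv1B// !Li2E// -/h.
  by ring.
rewrite nmN -mulrA; apply: cint_bound => // s hs.
have ws := slit_segment hz hs; have w0 := slit_neq0 ws.
rewrite /G; have [->|s0] := eqVneq s 0.
  rewrite /Li2_integrand !eqxx mul0r subr0 invr1 mulr1 /h.
  rewrite (_ : - y - - z - - (y - z) = 0) ?nm0; last by ring.
  by rewrite mulr_ge0 ?sqr_ge0// divr_ge0// exprn_ge0// ltW.
have s0' : s%:C != 0 :> C by rewrite -nm_eq0 nm_real normr_eq0.
rewrite !Li2_integrandE//.
(* [1 - s y] is [1 - s z] times [1 + q] *)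
pose q := - (s%:C * h) / (1 - s%:C * z).
have mw := Hm s hs; have wpos : 0 < nm (1 - s%:C * z) by rewrite nm_gt0.
have /andP[s1 s2] := hs.
have hq : nm q <= s * nm h / m.
  rewrite nmM nmN nmV nmM nm_real ger0_norm// ler_wpM2l ?mulr_ge0 ?nm_ge0//.
  by rewrite lef_pV2.
have hq' : nm q < Num.min (1 / 8) ((pi - th) / 8).
  apply: le_lt_trans hq _; rewrite ltr_pdivrMr// [ltRHS]mulrC.
  apply: le_lt_trans hy; by rewrite ler_piMl ?nm_ge0.
move: hq'; rewrite lt_min => /andP[q1 q2].
have -> : 1 - s%:C * y = (1 - s%:C * z) * (1 + q) by rewrite /q /h; field.
rewrite (@Log_shift _ (1 - s%:C * z) q th)//; [|exact: Arg_segment|lra|]; last first.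
  by have := nm_ge0 q; lra.
have -> : (Log (1 - s%:C * z) + Log (1 + q)) / s%:C - Log (1 - s%:C * z) / s%:C -
   - h / (1 - s%:C * z) = (Log (1 + q) - q) / s%:C.
  by rewrite /q; field; rewrite s0' w0.
have sp : 0 < s by rewrite lt_neqAle eq_sym s0.
rewrite nmM nmV nm_real ger0_norm// ler_pdivrMr//.
rewrite (le_trans (Log_quad1 (ltW q1)))//.
have e1 : nm q ^+ 2 <= (s * nm h / m) ^+ 2.
  by rewrite ler_sqr ?nnegrE ?nm_ge0 ?divr_ge0 ?mulr_ge0 ?nm_ge0// ltW.
have -> : 192 / m ^+ 2 * nm h ^+ 2 * s = 192 * (s * (nm h / m) ^+ 2).
  by field; rewrite gt_eqF.
rewrite ler_pM2l// (le_trans e1)//.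
have -> : (s * nm h / m) ^+ 2 = s * (s * (nm h / m) ^+ 2) by ring.
by rewrite ler_piMl// mulr_ge0// sqr_ge0.
Unshelve. all: by end_near. Qed.

End Dilogarithm.

(** * Functional equations of the dilogarithm *)

Section FunctionalEquations.
Variable R : realType.
Local Notation C := R[i].
Implicit Types (x y z w u a : C) (r s t : R).

(** The slit plane is star-shaped about every positive real number. *)
Lemma slit_star r z s : 0 < r -> slit z -> 0 <= s <= 1 ->
  slit (r%:C + s%:C * (z - r%:C)).
Proof.
move=> r0 hz /andP[s0 s1]; move: hz; rewrite /slit.
have -> : Re (r%:C + s%:C * (z - r%:C)) = (1 - s) * r + s * Re z.
  by rewrite !ReIm/=; ring.
have -> : Im (r%:C + s%:C * (z - r%:C)) = s * Im z by rewrite !ReIm/=; ring.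
have [->|s0'] := eqVneq s 0.
  by move=> _; rewrite negb_and -!ltNge subr0 !mul0r mul1r addr0 r0 orbT.
have sp : 0 < s by rewrite lt_neqAle eq_sym s0'.
rewrite !negb_and mulf_eq0 negb_or s0' -!ltNge /=.
case: (Im z == 0) => //= hr; apply: ltr_wpDl; last exact: mulr_gt0.
by rewrite mulr_ge0 ?subr_ge0// ltW.
Qed.

Lemma slit_real r : slit (r%:C : C) = (0 < r).
Proof. by rewrite /slit/= eqxx/= -ltNge. Qed.

Lemma slit_Im z : Im z != 0 -> slit z.
Proof. by move=> h; rewrite /slit (negbTE h). Qed.

Lemma cderiv_Log1sub x : slit (1 - x) ->
  cderiv (fun y => Log (1 - y)) x (- (1 - x)^-1).
Proof.
move=> h; have D : cderiv (fun y : C => 1 - y) x (- 1).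
  by apply: (cderiv_eq (cderivB (cderiv_cst 1 x) (cderiv_id x))); rewrite sub0r.
by apply: (cderiv_eq (cderiv_comp D (cderiv_Log h))); rewrite mulrN1.
Qed.

(** The value at 1 of the dilogarithm, presented as the constant of the
    reflection formula; it is computed below. *)
Definition Li2_one : C := Li2 (1 / 2)%:C + Li2 (1 / 2)%:C + Log (1 / 2)%:C ^+ 2.

(** Both sides agree at [1 / 2], and the derivative of the left-hand side vanishes
    along the segment from there to [x]. *)
Lemma Li2_reflection x : slit x -> slit (1 - x) ->
  Li2 x + Li2 (1 - x) + Log x * Log (1 - x) = Li2_one.
Proof.
move=> h1 h2; pose f y := Li2 y + Li2 (1 - y) + Log y * Log (1 - y).
have e : 1 - (1 / 2)%:C = (1 / 2)%:C :> C.
  by rewrite -[1]/((1 : R)%:C) -rcB; congr (_%:C); field.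
have -> : Li2_one = f (1 / 2)%:C by rewrite /f e /Li2_one expr2.
apply/esym/cderiv0_segment => s hs; rewrite -/(f x).
set y := _ + _.
have s1 : slit y by apply: slit_star.
have s2 : slit (1 - y).
  have -> : 1 - y = (1 / 2)%:C + s%:C * (1 - x - (1 / 2)%:C).
    apply/eqP; rewrite -subr_eq0 /y; set h := (1 / 2)%:C in e *.
    rewrite (_ : _ - _ = (1 - s%:C) * (1 - h - h)); last by ring.
    by rewrite e subrr mulr0.
  exact: slit_star.
have y0 := slit_neq0 s1; have y1 := slit_neq0 s2.
have D1 := cderiv_Li2 s2.
have D : cderiv (fun y : C => 1 - y) y (- 1).
  by apply: (cderiv_eq (cderivB (cderiv_cst 1 y) (cderiv_id y))); rewrite sub0r.
have e1 : 1 - (1 - y) = y by ring.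
have D2 : cderiv (fun y => Li2 (1 - y)) y (Log y / (1 - y)).
  have h : slit (1 - (1 - y)) by rewrite e1.
  apply: (cderiv_eq (cderiv_comp D (cderiv_Li2 h))).
  by rewrite /dLi2 (negbTE y1) e1; field.
apply: (cderiv_eq (cderivD (cderivD D1 D2) (cderivM (cderiv_Log s1) (cderiv_Log1sub s2)))).
by rewrite /dLi2 (negbTE y0); field; rewrite y0 y1.
Qed.

Lemma sqrt_ge_small r : 0 <= r <= 1 -> r <= Num.sqrt r.
Proof.
move=> /andP[r0 r1]; have e : r = Num.sqrt r ^+ 2 by rewrite sqr_sqrtr.
rewrite {1}e expr2 ler_piMl ?sqrtr_ge0//.
by rewrite -[leRHS]sqrtr1 ler_sqrt.
Qed.

(** From [ln q < q] at [q = 1 / sqrt r]. *)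
Lemma rlnr r : 0 < r <= 1 -> r * `|ln r| <= 2 * Num.sqrt r.
Proof.
move=> /andP[r0 r1]; have s0 : 0 < Num.sqrt r by rewrite sqrtr_gt0.
have e : r = Num.sqrt r ^+ 2 by rewrite sqr_sqrtr// ltW.
have q1 : Num.sqrt r <= 1 by rewrite -[leRHS]sqrtr1 ler_sqrt.
set q := Num.sqrt r in s0 e q1 *.
have h : ln q^-1 < q^-1 by apply: ln_sublinear; rewrite invr_gt0.
rewrite lnV ?posrE// in h.
rewrite e lnXn// normrMn ler0_norm ?ln_le0//.
have : q * - ln q <= 1 by rewrite -ler_pdivlMl// mulr1 ltW.
rewrite mulr2n expr2; nra.
Qed.

Lemma nm_Log z : z != 0 -> nm (Log z) <= `|ln (nm z)| + 4.
Proof.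
move=> z0; rewrite (le_trans (nm_le _))//= lerD2l.
have := Arg_bounds z0 => /andP[h1 h2]; have := @pihalf_lt2 R => h3.
by rewrite ler_norml; apply/andP; split; lra.
Qed.

Lemma small_Log z : z != 0 -> nm z <= 1 ->
  nm z * nm (Log z) <= 6 * Num.sqrt (nm z).
Proof.
move=> z0 z1; have n0 : 0 < nm z by rewrite nm_gt0.
apply: le_trans (ler_wpM2l (nm_ge0 z) (nm_Log z0)) _.
have := @rlnr (nm z); rewrite n0 z1 => /(_ isT) h.
rewrite mulrDr.
have : nm z <= Num.sqrt (nm z) by rewrite sqrt_ge_small// nm_ge0.
by lra.
Qed.

Lemma Li2_0 : Li2 (0 : C) = 0.
Proof.
rewrite /Li2 /segment_integral.
under eq_Rintegral do rewrite mulr0.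
under [X in _ +i* X]eq_Rintegral do rewrite mulr0.
by rewrite /= !integral01_cst oppr0.
Qed.

Lemma Li2_near0 : exists2 K : R, 0 < K &
  \forall y \near cnbhs (0 : C), nm (Li2 y) <= K * nm y.
Proof.
have h : slit (1 - 0 : C) by rewrite subr0 slit_real.
have [K K0 HK] := cderiv_lip (cderiv_Li2 h); exists K => //.
by apply: filterS HK => y; rewrite Li2_0 !subr0.
Qed.

(** By reflection, since [y * Log y] tends to 0 with [y = 1 - x]. *)
Lemma Li2_near1 : exists2 K : R, 0 < K & exists2 d : R, 0 < d &
  forall x, slit x -> slit (1 - x) -> nm (1 - x) < d ->
  nm (Li2 x - Li2_one) <= K * Num.sqrt (nm (1 - x)).
Proof.
have [K K0 [d d0 Hd]] := Li2_near0.
exists (K + 24); first by rewrite addr_gt0.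
exists (Num.min d (1 / 2)); first by rewrite lt_min d0 divr_gt0.
move=> x s1 s2; set y := 1 - x; rewrite lt_min => /andP[yd y1].
have ex : x = 1 + - y by rewrite /y; ring.
have -> : Li2 x - Li2_one = - (Li2 y + Log y * Log (1 + - y)).
  by rewrite -(Li2_reflection s1 s2) -/y -ex; ring.
have y0 : y != 0 := slit_neq0 s2.
rewrite nmN (le_trans (nmD _ _))// mulrDl lerD//.
  have h := Hd y; rewrite subr0 in h; apply: le_trans (h yd) _.
  by rewrite ler_pM2l// sqrt_ge_small// nm_ge0/=; lra.
have h4 : nm (Log (1 + - y)) <= 4 * nm y by rewrite -(nmN y) Log_lip1// nmN ltW.
rewrite nmM; apply: le_trans (ler_wpM2l (nm_ge0 _) h4) _.
have : nm y * nm (Log y) <= 6 * Num.sqrt (nm y) by apply: small_Log => //; lra.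
by lra.
Qed.

(** All the limits needed for the value of [Li2_one] have error terms of order
    the square root of the parameter. *)
Lemma nm_small_eq0 (c : C) (K d : R) : 0 < d ->
  (forall r, 0 < r < d -> nm c <= K * Num.sqrt r) -> c = 0.
Proof.
move=> d0 H; apply/eqP; rewrite -nm_eq0 eq_le nm_ge0 andbT leNgt; apply/negP => c0.
have K0 : 0 < `|K| + 1 by rewrite ltr_wpDl.
pose q := Num.min (Num.sqrt d / 2) (nm c / (`|K| + 1) / 2).
have sd : 0 < Num.sqrt d by rewrite sqrtr_gt0.
have q0 : 0 < q by rewrite lt_min !divr_gt0.
have qd : q <= Num.sqrt d / 2 by rewrite ge_min lexx.
have qc : q <= nm c / (`|K| + 1) / 2 by rewrite ge_min lexx orbT.
have := H (q ^+ 2); rewrite sqrtr_sqr gtr0_norm//.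
have -> : 0 < q ^+ 2 < d.
  rewrite exprn_gt0//= -[ltRHS](@sqr_sqrtr _ d) ?ltW//.
  by rewrite ltr_sqr ?nnegrE ?ltW//; lra.
move=> /(_ isT) h.
have : K * q <= (`|K| + 1) * q.
  by rewrite ler_pM2r// (le_trans (ler_norm _))// lerDl.
have : (`|K| + 1) * q <= nm c / 2.
  rewrite mulrC -ler_pdivlMr//; lra.
by lra.
Qed.

(** Together with the behaviour near 1 this gives the value at [-1]. *)
Lemma Li2_duplication t : 0 <= t < 1 ->
  Li2 (t%:C ^+ 2) = 2 * Li2 t%:C + 2 * Li2 (- t%:C) :> C.
Proof.
move=> /andP[t0 t1].
pose f y : C := Li2 (y ^+ 2) - (2 * Li2 y + 2 * Li2 (- y)).
suff : f t%:C = f 0.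
  rewrite /f expr0n/= oppr0 Li2_0 mulr0 addr0 subr0.
  by move/eqP; rewrite subr_eq0 => /eqP.
apply/esym/cderiv0_segment => s /andP[s0 s1]; rewrite subr0 add0r -rcM.
have r0 : 0 <= s * t by rewrite mulr_ge0.
have r1 : s * t < 1 by rewrite (le_lt_trans _ t1)// ler_piMl.
move: (s * t) r0 r1 => r r0 r1 {s0 s1 s}.
have e1 : 1 - r%:C = (1 - r)%:C :> C by rewrite rcB.
have e2 : 1 - - r%:C = (1 + r)%:C :> C by rewrite rcD opprK.
have e3 : 1 - r%:C ^+ 2 = ((1 - r) * (1 + r))%:C :> C.
  by rewrite rcM -e1 -e2; ring.
have s1 : slit (1 - r%:C : C) by rewrite e1 slit_real subr_gt0.
have s2 : slit (1 - - r%:C : C) by rewrite e2 slit_real; lra.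
have s3 : slit (1 - r%:C ^+ 2 : C).
  by rewrite e3 slit_real mulr_gt0 ?subr_gt0//; lra.
have D3 := cderiv_comp (f := @Li2 R) (cderivX 2 (cderiv_id (r%:C : C))) (cderiv_Li2 s3).
have D2 := cderiv_comp (f := @Li2 R) (cderivN (cderiv_id (r%:C : C))) (cderiv_Li2 s2).
apply: (cderiv_eq (cderivB D3 (cderivD (cderivZ 2 (cderiv_Li2 s1)) (cderivZ 2 D2)))).
rewrite /dLi2 oppr_eq0 expf_eq0/=.
have [->|r0'] := eqVneq (r%:C : C) 0; first by ring.
rewrite e1 e2 e3.
have -> : Log ((1 - r) * (1 + r))%:C = Log (1 - r)%:C + Log (1 + r)%:C :> C.
  have A0 q : 0 < q -> Arg (q%:C : C) = 0.
    by move=> q0; rewrite Arg_atan//= mul0r atan0.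
  have p1 : 0 < 1 - r by lra.
  have p2 : 0 < 1 + r by lra.
  have q1 : (1 - r)%:C != 0 :> C by apply: slit_neq0; rewrite slit_real.
  have q2 : (1 + r)%:C != 0 :> C by apply: slit_neq0; rewrite slit_real.
  by rewrite rcM LogM// !A0// addr0 oppr_lt0 pi_gt0 pi_ge0.
by field.
Qed.

Lemma Li2_N1 : 2 * Li2 (-1 : C) = - Li2_one.
Proof.
have [K K0 [d d0 HK]] := Li2_near1.
have s1 : slit (1 - (-1) : C).
  by rewrite (_ : 1 - -1 = (2 : R)%:C) ?slit_real// -(natC R 2); ring.
have [L L0 [e e0 HL]] := cderiv_lip (cderiv_Li2 s1).
apply/eqP; rewrite -subr_eq0 opprK; apply/eqP.
apply: (@nm_small_eq0 _ (2 * K + 2 * K + 2 * L) (Num.min (1 / 2) (Num.min (d / 2) e))).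
  by rewrite !lt_min !divr_gt0.
move=> r; rewrite !lt_min => /andP[r0 /and3P[r1 rd re]].
have t01 : 0 <= 1 - r < 1 by apply/andP; split; lra.
have t1 : 0 < 1 - r by lra.
have e1 : 1 - (1 - r)%:C = r%:C :> C by rewrite rcB; ring.
have e2 : 1 - (1 - r)%:C ^+ 2 = (r * (2 - r))%:C :> C.
  by rewrite rcM !rcB -(natC R 2); ring.
have h1 : nm (Li2 (1 - r)%:C - Li2_one) <= K * Num.sqrt r.
  have := HK (1 - r)%:C; rewrite e1 !slit_real nm_real gtr0_norm//.
  by apply => //; lra.
have h2 : nm (Li2 ((1 - r)%:C ^+ 2) - Li2_one) <= K * (2 * Num.sqrt r).
  have := HK ((1 - r)%:C ^+ 2); rewrite e2 expr2 -rcM !slit_real nm_real.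
  have p : 0 < r * (2 - r) by rewrite mulr_gt0//; lra.
  rewrite gtr0_norm// mulr_gt0// => /(_ isT p) h.
  apply: le_trans (h _) _; first by nra.
  rewrite ler_pM2l//.
  have -> : 2 * Num.sqrt r = Num.sqrt (4 * r).
    rewrite (_ : 4 = 2 ^+ 2 :> R); last by ring.
    by rewrite sqrtrM ?sqr_ge0// sqrtr_sqr gtr0_norm.
  by rewrite ler_sqrt//; nra.
have h3 : nm (Li2 (- (1 - r)%:C) - Li2 (-1)) <= L * Num.sqrt r.
  have := HL (- (1 - r)%:C).
  have -> : - (1 - r)%:C - -1 = r%:C :> C by rewrite rcB; ring.
  rewrite nm_real gtr0_norm// => /(_ re) h; apply: le_trans h _.
  by rewrite ler_pM2l// sqrt_ge_small// ltW//=; lra.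
have -> : 2 * Li2 (-1) + Li2_one = (Li2 ((1 - r)%:C ^+ 2) - Li2_one)
   - 2 * (Li2 (1 - r)%:C - Li2_one) - 2 * (Li2 (- (1 - r)%:C) - Li2 (-1)) :> C.
  by rewrite (Li2_duplication t01); ring.
have n2 : nm (2 : C) = 2 by rewrite (natC R 2) nm_real gtr0_norm.
apply: (le_trans (nmBD _ _)); rewrite [leRHS]mulrDl lerD//; last first.
  by rewrite nmM n2 -mulrA ler_pM2l.
apply: (le_trans (nmBD _ _)); rewrite [leRHS]mulrDl lerD//.
  by rewrite [2 * K]mulrC -mulrA.
by rewrite nmM n2 -mulrA ler_pM2l.
Qed.

(** ** Inversion *)

(** The arguments of [- x] and [1 - x^-1] have opposite signs, so their sum is
    principal. *)
Lemma Log_inversion x : slit (- x) -> slit (1 - x) /\ slit (1 - x^-1) /\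
  Log (1 - x^-1) = Log (1 - x) - Log (- x).
Proof.
move=> hx; have x0 : x != 0 by have := slit_neq0 hx; rewrite oppr_eq0.
have n0 : 0 < nm x ^+ 2 by rewrite exprn_gt0// nm_gt0.
have eV : Re x^-1 = Re x / nm x ^+ 2 /\ Im x^-1 = - Im x / nm x ^+ 2.
  by rewrite nm_sqr mulNr; case: x {hx x0 n0} => a b.
have [ix|ix] := eqVneq (Im x) 0.
  have rx : Re x < 0 by move: hx; rewrite /slit !ReIm ix oppr0 eqxx/= -ltNge oppr_gt0.
  have ex : x = (Re x)%:C by apply: complex_eq.
  have e1 : 1 - x = (1 - Re x)%:C by rewrite {1}ex rcB.
  have e2 : 1 - x^-1 = (1 - (Re x)^-1)%:C by rewrite {1}ex rcB rcV.
  have e3 : - x = (- Re x)%:C by rewrite {1}ex rcN.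
  have rv : (Re x)^-1 < 0 by rewrite invr_lt0.
  rewrite e1 e2 e3 !slit_real; split; [lra|split; [lra|]].
  have A0 q : 0 < q -> Log (q%:C : C) = (ln q)%:C.
    move=> q0; apply: Log_uniq; last by rewrite /= oppr_lt0 pi_gt0 pi_ge0.
    by rewrite cexp_real lnK.
  rewrite !A0 ?oppr_gt0//; [|lra|lra].
  rewrite -rcB -ln_div ?posrE ?oppr_gt0//; last by lra.
  by congr ((ln _)%:C); field; rewrite lt_eqF.
have s1 : slit (1 - x) by apply: slit_Im; rewrite !ReIm/= add0r oppr_eq0.
have s2 : slit (1 - x^-1).
  apply: slit_Im; rewrite !ReIm/= add0r oppr_eq0 eV.2 mulf_eq0 oppr_eq0 negb_or ix.
  by rewrite invr_eq0 gt_eqF.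
split=> //; split=> //.
have pos z : z != 0 -> 0 < Im z -> 0 < Arg z < pi.
  move=> z0 iz; have z1 : `|Arg z| < pi by apply/slit_Arg/slit_Im; rewrite gt_eqF.
  have : 0 < sin (Arg z) by rewrite sin_Arg// divr_gt0// nm_gt0.
  move: z1; rewrite ltr_norml => /andP[z1 -> hs]; rewrite andbT ltNge; apply/negP => h.
  move: hs; rewrite -[Arg z]opprK sinN oppr_gt0 ltNge sin_ge0_pi//.
  by rewrite oppr_ge0 h/=; lra.
have neg z : z != 0 -> Im z < 0 -> - pi < Arg z < 0.
  move=> z0 iz; have z1 : `|Arg z| < pi by apply/slit_Arg/slit_Im; rewrite lt_eqF.
  have : sin (Arg z) < 0 by rewrite sin_Arg// pmulr_llt0 ?invr_gt0 ?nm_gt0.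
  move: z1; rewrite ltr_norml => /andP[-> z1 hs]; rewrite ltNge; apply/negP => h.
  by move: hs; rewrite ltNge sin_ge0_pi// h ltW.
have n1 := slit_neq0 s1; have n2 := slit_neq0 s2; have n3 := slit_neq0 hx.
suff : Log (- x * (1 - x^-1)) = Log (- x) + Log (1 - x^-1).
  by rewrite (_ : - x * (1 - x^-1) = 1 - x); [move=> ->; ring|field].
apply: LogM => //.
have i1 : Im (- x) = - Im x by rewrite ImN.
have i2 : Im (1 - x^-1) = Im x / nm x ^+ 2 by rewrite !ReIm/= eV.2 mulNr opprK add0r.
case: (ltgtP (Im x) 0) ix => // h _.
  have := pos (- x) n3; rewrite i1 oppr_gt0 => /(_ h) /andP[a1 a2].
  have := neg _ n2; rewrite i2 pmulr_llt0 ?invr_gt0// => /(_ h) /andP[b1 b2].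
  by apply/andP; split; lra.
have := neg (- x) n3; rewrite i1 oppr_lt0 => /(_ h) /andP[a1 a2].
have := pos _ n2; rewrite i2 pmulr_lgt0 ?invr_gt0// => /(_ h) /andP[b1 b2].
by apply/andP; split; lra.
Qed.

(** Differentiation along the segment from [-1] to [x]. *)
Lemma Li2_inversion x : slit (- x) ->
  Li2 x + Li2 x^-1 + Log (- x) ^+ 2 / 2 = 2 * Li2 (-1).
Proof.
move=> hx; pose f y := Li2 y + Li2 y^-1 + Log (- y) ^+ 2 / 2.
have -> : 2 * Li2 (-1) = f (-1).
  by rewrite /f opprK Log1 invrN1 expr0n/= mul0r addr0 mulr2n mulrDl mul1r.
apply/esym/cderiv0_segment => s hs; rewrite -/(f x).
set y := _ + _.
have hy : slit (- y).
  have -> : - y = 1%:C + s%:C * (- x - 1%:C) by rewrite /y; ring.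
  exact: slit_star.
have [s1 [s2 eL]] := Log_inversion hy.
have y0 : y != 0 by have := slit_neq0 hy; rewrite oppr_eq0.
have n1 := slit_neq0 s1; have n2 := slit_neq0 s2.
have D2 := cderiv_comp (f := @Li2 R) (cderiv_inv y0) (cderiv_Li2 s2).
have D3 := cderiv_comp (f := @Log R) (cderivN (cderiv_id y)) (cderiv_Log hy).
apply: (cderiv_eq (cderivD (cderivD (cderiv_Li2 s1) D2) (cderivM (cderivX 2 D3) (cderiv_cst 2^-1 y)))).
by rewrite /dLi2 invr_eq0 (negbTE y0) eL; field.
Qed.

(** The Basel sum: inversion at [e^(i t)] and duplication at [1 - t], both as
    [t] tends to 0. *)
Lemma Li2_oneE : Li2_one = (pi%:C ^+ 2 / 6 : C).
Proof.
have [K K0 [d d0 HK]] := Li2_near1.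
suff E : 3 * Li2_one - pi%:C ^+ 2 / 2 = 0 :> C.
  apply: (@mulfI _ 3); first by rewrite pnatr_eq0.
  by move/eqP: E; rewrite subr_eq0 => /eqP ->; field.
have p0 := @pi_gt0 R; have p2 := @pihalf_lt2 R; have p3 := @pi_ge2 R.
apply: (@nm_small_eq0 _ (8 * K + 5) (Num.min (1 / 8) (d / 4))).
  by rewrite !lt_min !divr_gt0.
move=> r; rewrite !lt_min => /andP[r0 /andP[r1 rd]].
have D q : q \in [:: r; - r] ->
    nm (Li2 (cexp (q%:C * 'i)) - Li2_one) <= 4 * K * Num.sqrt r.
  move=> hq; have nq : `|q| = r.
    by move: hq; rewrite !inE => /orP[] /eqP ->; rewrite ?normrN gtr0_norm.
  have e : nm (1 - cexp (q%:C * 'i)) <= 4 * r.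
    have h : nm (q%:C * 'i) = r by rewrite nmM nm_i mulr1 nm_real.
    have := @cexp_quad R (q%:C * 'i); rewrite h => h2.
    rewrite nmB (_ : _ - 1 = (cexp (q%:C * 'i) - 1 - q%:C * 'i) + q%:C * 'i); last by ring.
    rewrite (le_trans (nmD _ _))// h.
    have : nm (cexp (q%:C * 'i) - 1 - q%:C * 'i) <= 12 * r ^+ 2 by apply: h2; lra.
    have : r ^+ 2 <= r * (1 / 8) by rewrite expr2 ler_pM2l// ltW.
    by lra.
  have iq : sin q != 0.
    move: hq; rewrite !inE => /orP[] /eqP ->; rewrite ?sinN ?oppr_eq0 gt_eqF//.
      by apply: sin_gt0_pi; have := @pi_ge2 R; lra.
    by apply: sin_gt0_pi; have := @pi_ge2 R; lra.
  have s1 : slit (cexp (q%:C * 'i)) by rewrite slit_Im// cexp_imag.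
  have s2 : slit (1 - cexp (q%:C * 'i)).
    by rewrite slit_Im// cexp_imag !ReIm/= add0r oppr_eq0.
  apply: (le_trans (HK _ s1 s2 _)); first by apply: le_lt_trans e _; lra.
  rewrite [4 * K]mulrC -mulrA ler_pM2l//.
  have -> : 4 * Num.sqrt r = Num.sqrt (16 * r).
    rewrite (_ : 16 = 4 ^+ 2 :> R); last by ring.
    by rewrite sqrtrM ?sqr_ge0// sqrtr_sqr gtr0_norm.
  by rewrite ler_sqrt//; lra.
have L : Log (- cexp (r%:C * 'i)) = (r - pi)%:C * 'i :> C.
  apply: Log_uniq; last first.
    have -> : Im ((r - pi)%:C * 'i : C) = r - pi by rewrite !ReIm/=; ring.
    by apply/andP; split; lra.
  by rewrite rcB mulrBl cexpB cexp_ipi invrN1 mulrN1.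
have V : (cexp (r%:C * 'i))^-1 = cexp ((- r)%:C * 'i) :> C.
  by rewrite -cexpN rcN mulNr.
have S : slit (- cexp (r%:C * 'i) : C).
  apply: slit_Im; rewrite cexp_imag ReIm/= oppr_eq0 gt_eqF//.
  by apply: sin_gt0_pi; have := @pi_ge2 R; lra.
have := Li2_inversion S; rewrite L V Li2_N1 => E.
set x1 := Li2 (cexp (r%:C * 'i)) in E; set x2 := Li2 (cexp ((- r)%:C * 'i)) in E.
have -> : 3 * Li2_one - pi%:C ^+ 2 / 2 = - (x1 - Li2_one) - (x2 - Li2_one)
   + (r * (r - 2 * pi) / 2)%:C :> C.
  have {}E : Li2_one = - (x1 + x2 + ((r - pi)%:C * 'i) ^+ 2 / 2) by rewrite E opprK.
  rewrite {1}(_ : 3 * Li2_one = 2 * Li2_one + Li2_one); last by ring.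
  rewrite {2}E exprMn sqr_i !rcM !rcB rcM rcV -(natC R 2).
  by field.
have h1 : nm (x1 - Li2_one) <= 4 * K * Num.sqrt r by apply: D; rewrite inE eqxx.
have h2 : nm (x2 - Li2_one) <= 4 * K * Num.sqrt r by apply: D; rewrite !inE eqxx orbT.
rewrite (le_trans (nmD _ _))// nm_real.
have h3 : `|r * (r - 2 * pi) / 2| <= 5 * Num.sqrt r.
  have hs : r <= Num.sqrt r by apply: sqrt_ge_small; rewrite ltW//=; lra.
  rewrite ler0_norm; last by rewrite pmulr_lle0 ?invr_gt0// pmulr_rle0//; lra.
  by apply: le_trans (ler_wpM2l _ hs) => //; nra.
have := nmBD (- (x1 - Li2_one)) (x2 - Li2_one); rewrite nmN => h4.
by rewrite [leRHS]mulrDl; lra.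
Qed.

End FunctionalEquations.

(** * The exponentiated dilogarithm *)

Section ExponentiatedDilogarithm.
Variable R : realType.
Local Notation C := R[i].
Implicit Types (x y z w u v a : C) (r s t : R).

Local Notation twopii := (@twopii R).

(** Chosen so that [kappa * t] is an integral multiple of [2 pi i] exactly when
    [6 / pi^2 * t] is an integer. *)
Definition kappa : C := 12 * 'i / pi%:C.

Lemma pi_neq0 : pi%:C != 0 :> C.
Proof. by rewrite -nm_eq0 nm_real normr_eq0 gt_eqF// pi_gt0. Qed.

Lemma kappa_twopii : kappa * twopii = - 24.
Proof.
have -> : kappa * twopii = 24 * 'i ^+ 2.
  by rewrite /kappa /twopii; move: (pi%:C) pi_neq0 => P P0; field.
by rewrite sqr_i mulrN1.
Qed.

(** Used to compare exponents that agree up to a multiple of the period. *)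
Lemma cexp_mod x y w : cexp w = 1 -> x = y + w -> cexp x = cexp y.
Proof. by move=> h ->; rewrite cexpD h mulr1. Qed.

Lemma cexp_kappa_int (k : int) y :
  cexp (kappa * (k%:~R * twopii * y)) = cexp (- 24 * k%:~R * y).
Proof.
by congr cexp; rewrite -kappa_twopii; ring.
Qed.

Lemma cexp_kappa_sqr (k : int) : cexp (kappa * (k%:~R * twopii ^+ 2)) = 1.
Proof.
have -> : kappa * (k%:~R * twopii ^+ 2) = (-24 * k)%:~R * twopii.
  by rewrite intrM -[(-24)%:~R]/(- 24 : C) -kappa_twopii; ring.
exact: cexp_twopiiz.
Qed.

Lemma cexp_kappa_one (k : int) : cexp (kappa * (k%:~R * Li2_one R)) = 1.
Proof.
have -> : kappa * (k%:~R * Li2_one R) = k%:~R * twopii.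
  by rewrite Li2_oneE /kappa /twopii; move: (pi%:C) pi_neq0 => P P0; field.
exact: cexp_twopiiz.
Qed.

Lemma cexp_kappa_oneE : cexp (kappa * Li2_one R) = 1.
Proof. by have := cexp_kappa_one 1; rewrite mul1r. Qed.

Definition rogers0 u := cexp (kappa * (Li2 (cexp u) + Log (1 - cexp u) * u)).

(** The continuation of [rogers0] across the cut of the dilogarithm, by the
    reflection formula, whose constant is invisible after exponentiation. *)
Definition rogers u :=
  if slit (1 - cexp u) then rogers0 u
  else cexp (kappa * (u * Log (1 - cexp u))) / rogers0 (Log (1 - cexp u)).

Lemma rogersE u : slit (1 - cexp u) -> rogers u = rogers0 u.
Proof. by rewrite /rogers => ->. Qed.

Lemma not_slit_1B x : ~~ slit (1 - x) -> Im x = 0 /\ 1 <= Re x.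
Proof.
rewrite /slit negbK !ReIm/= => /andP[/eqP h1 h2].
have e : Im x = 0 by apply/eqP; rewrite -oppr_eq0; apply/eqP; move: h1; rewrite add0r.
by split=> //; lra.
Qed.

(** The value is independent of the logarithm [a] since
    [kappa * (2 pi i)^2] is a multiple of the period. *)
Lemma rogers_reflection u a : slit (cexp u) -> cexp u != 1 ->
  cexp a = 1 - cexp u -> rogers u = cexp (kappa * (u * a)) / rogers0 a.
Proof.
move=> su u1 ea.
have e1 : 1 - cexp a = cexp u by rewrite ea; ring.
have x0 : cexp u != 0 := slit_neq0 su.
have x1 : 1 - cexp u != 0 by rewrite subr_eq0 eq_sym.
have [l el] : exists l : int, a = Log (1 - cexp u) + l%:~R * twopii.
  by apply: cexp_inj_mod; rewrite ea cexp_Log.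
have [k ek] : exists k : int, u = Log (cexp u) + k%:~R * twopii.
  by apply: cexp_inj_mod; rewrite cexp_Log.
rewrite /rogers; case: ifPn => s1.
  apply: (mulIf (cexp_neq0 (kappa * (Li2 (cexp a) + Log (1 - cexp a) * a)))).
  rewrite -/(rogers0 a) divfK ?cexp_neq0// /rogers0 -cexpD e1 ea.
  have := Li2_reflection su s1 => E.
  have q : cexp (kappa * ((- (k * l))%:~R * twopii ^+ 2) + kappa * Li2_one R) = 1.
    by rewrite cexpD cexp_kappa_sqr cexp_kappa_oneE mulr1.
  apply: (cexp_mod q); rewrite -E.
  set U := Log (cexp u) in ek *; set A := Log _ in el *.
  move: (Li2 (cexp u)) (Li2 (1 - cexp u)) => p r.
  by rewrite ek el mulrNz intrM; ring.
rewrite el; set A := Log (1 - cexp u).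
rewrite /rogers0 -!cexpB.
have eA : cexp A = 1 - cexp u by rewrite cexp_Log.
have ec : cexp (A + l%:~R * twopii) = 1 - cexp u by rewrite cexpD cexp_twopiiz mulr1.
rewrite eA ec (_ : 1 - (1 - cexp u) = cexp u); last by ring.
set U := Log (cexp u) in ek *.
apply/esym; apply: (cexp_mod (cexp_kappa_sqr (k * l))).
move: (Li2 (1 - cexp u)) => r.
by rewrite ek intrM; ring.
Qed.

Lemma cderiv_cexpK f z l : cderiv f z l ->
  cderiv (fun y => cexp (kappa * f y)) z (cexp (kappa * f z) * (kappa * l)).
Proof.
by move=> Hf; apply: (cderiv_comp (cderivZ kappa Hf) (cderiv_cexp _)).
Qed.

(** The logarithmic derivative of [rogers]; the reflection formula carries
    it across the cut. *)
Lemma cderiv_rogers u : cexp u != 1 ->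
  cderiv rogers u (rogers u * (kappa * (- u * cexp u / (1 - cexp u)))).
Proof.
move=> u1; have x1 : 1 - cexp u != 0 by rewrite subr_eq0 eq_sym.
have x0 := cexp_neq0 u; have De := cderiv_cexp u.
have D1e : cderiv (fun y => 1 - cexp y) u (- cexp u).
  by apply: (cderiv_eq (cderivB (cderiv_cst 1 u) De)); rewrite sub0r.
have [s1|s1] := boolP (slit (1 - cexp u)).
  have s1' := slit_near s1.
  have N : \forall y \near cnbhs u, slit (1 - cexp y).
    exact: (cderiv_cont D1e s1').
  apply: (@cderiv_near _ _ rogers0).
    by apply: filterS N => y /rogersE.
  rewrite rogersE//; have D1 := cderiv_comp De (cderiv_Li2 s1).
  have D2 := cderiv_comp De (cderiv_Log1sub s1).
  apply: (cderiv_eq (cderiv_cexpK (cderivD D1 (cderivM D2 (cderiv_id u))))).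
  rewrite /rogers0 /dLi2 (negbTE x0); congr (_ * (_ * _)); field.
  by rewrite x1 x0.
have [ix rx] := not_slit_1B s1.
have su : slit (cexp u) by rewrite /slit ix eqxx andTb -ltNge (lt_le_trans ltr01).
pose a y := Log (1 - cexp u) + Log ((1 - cexp y) / (1 - cexp u)).
have Da : cderiv a u (- cexp u / (1 - cexp u)).
  have D : cderiv (fun y => (1 - cexp y) / (1 - cexp u)) u (- cexp u / (1 - cexp u)).
    apply: (cderiv_eq (cderivM (cderivB (cderiv_cst 1 u) De) (cderiv_cst (1 - cexp u)^-1 u))).
    by ring.
  have e1 : (1 - cexp u) / (1 - cexp u) = 1 by rewrite divff.
  have s : slit ((1 - cexp u) / (1 - cexp u)) by rewrite e1 slit_real.
  apply: (cderiv_eq (cderivD (cderiv_cst (Log (1 - cexp u)) u) (cderiv_comp D (cderiv_Log s)))).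
  by rewrite e1; field.
have au : a u = Log (1 - cexp u) by rewrite /a divff// Log1 addr0.
have N1 : \forall y \near cnbhs u, slit (cexp y) by exact: (cderiv_cont De (slit_near su)).
have N2 : \forall y \near cnbhs u, 1 - cexp y != 0.
  exact: (cderiv_cont D1e (cnbhs_neq0 x1)).
have ea y : 1 - cexp y != 0 -> cexp (a y) = 1 - cexp y.
  by move=> h; rewrite cexpD !cexp_Log ?mulf_neq0 ?invr_eq0//; field.
have E : \forall y \near cnbhs u, rogers y =
   cexp (kappa * (y * a y - (Li2 (cexp (a y)) + Log (cexp y) * a y))).
  near=> y.
  have h1 : slit (cexp y) by near: y.
  have h2 : 1 - cexp y != 0 by near: y.
  rewrite (@rogers_reflection y (a y)) ?ea//; last by rewrite eq_sym -subr_eq0.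
  by rewrite /rogers0 ea// -cexpB; congr cexp; rewrite (_ : 1 - (1 - cexp y) = cexp y); ring.
apply: (cderiv_near E); rewrite (cnbhs_singleton E).
have sa : slit (1 - cexp (a u)) by rewrite ea//; rewrite (_ : 1 - (1 - cexp u) = cexp u)//; ring.
have Dea := cderiv_comp Da (cderiv_cexp (a u)).
have D1 := cderivM (cderiv_id u) Da.
have D2 := cderiv_comp Dea (cderiv_Li2 sa).
have D3 := cderivM (cderiv_comp De (cderiv_Log su)) Da.
apply: (cderiv_eq (cderiv_cexpK (cderivB D1 (cderivD D2 D3)))).
congr (_ * (_ * _)); rewrite /dLi2 ea// (negbTE x1).
rewrite (_ : 1 - (1 - cexp u) = cexp u); last by ring.
by field; rewrite x1 x0.
Unshelve. all: by end_near. Qed.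

(** The monodromy of [rogers]: a change of the logarithm by [k] periods
    multiplies it by a power of [1 - e^u]. *)
Lemma rogers_shift u a (k : int) : cexp u != 1 -> cexp a = 1 - cexp u ->
  rogers (u + k%:~R * twopii) = rogers u * cexp (- 24 * k%:~R * a).
Proof.
move=> u1 ea; have x1 : 1 - cexp u != 0 by rewrite subr_eq0 eq_sym.
have [l el] : exists l : int, a = Log (1 - cexp u) + l%:~R * twopii.
  by apply: cexp_inj_mod; rewrite ea cexp_Log.
have e : cexp (u + k%:~R * twopii) = cexp u by rewrite cexpD cexp_twopiiz mulr1.
have -> : cexp (- 24 * k%:~R * a) = cexp (kappa * (k%:~R * twopii * Log (1 - cexp u))).
  rewrite -(cexp_kappa_int k a); apply: (cexp_mod (cexp_kappa_sqr (k * l))).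
  by rewrite {1}el intrM; ring.
rewrite /rogers e; case: (slit _); first by rewrite /rogers0 e -cexpD; congr cexp; ring.
by rewrite [RHS]mulrAC -cexpD; congr (cexp _ / _); ring.
Qed.

(** Off the cut of the logarithm this is the inversion formula; the other points
    are joined to it by a vertical segment, along which the quotient of both sides
    has vanishing derivative. *)
Lemma rogers_inversion u : cexp u != 1 ->
  rogers u * rogers (- u) = cexp (kappa * (u ^+ 2 / 2)).
Proof.
have G v : slit (- cexp v) -> rogers v * rogers (- v) = cexp (kappa * (v ^+ 2 / 2)).
  move=> hv; have [s1 [s2 eL]] := Log_inversion hv.
  have := Li2_inversion hv => E.
  rewrite !rogersE ?cexpN// /rogers0 -cexpD cexpN eL.
  have [k ek] : exists k : int, v = Log (- cexp v) + (2 * k + 1)%:~R * (twopii / 2).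
    have [k ek] : exists k : int, v = Log (- cexp v) + pi%:C * 'i + k%:~R * twopii.
      apply: cexp_inj_mod; rewrite cexpD cexp_ipi cexp_Log ?mulrN1 ?opprK//.
      by rewrite oppr_eq0 cexp_neq0.
    by exists k; rewrite {1}ek intrD intrM /twopii; field.
  set L := Log (- cexp v) in E ek *; set A := Log _; set m := 2 * k + 1 in ek.
  have q : cexp (kappa * (m%:~R ^+ 2 * twopii ^+ 2 / 8)) = 1.
    have -> : kappa * (m%:~R ^+ 2 * twopii ^+ 2 / 8) = (- 3 * m ^+ 2)%:~R * twopii.
      rewrite intrM rmorphXn/= -[(-3)%:~R]/(- 3 : C).
      rewrite (_ : - 3 = kappa * twopii / 8); first by ring.
      by rewrite kappa_twopii; field.
    exact: cexp_twopiiz.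
  have q' : cexp (kappa * ((-1)%:~R * Li2_one R) + - (kappa * (m%:~R ^+ 2 * twopii ^+ 2 / 8))) = 1.
    by rewrite cexpD cexpN cexp_kappa_one q divr1.
  apply: (cexp_mod q'); have {}E : Li2 (cexp v) = - Li2_one R - Li2 (cexp v)^-1 - L ^+ 2 / 2.
    by rewrite -Li2_N1 -E; ring.
  have eL2 : L = v - m%:~R * (twopii / 2) by rewrite {1}ek; ring.
  by rewrite E eL2 mulrNz; field.
move=> u1; have [s1|s1] := boolP (slit (- cexp u)); first exact: G.
pose F y := rogers y * rogers (- y) * cexp (kappa * (- (y ^+ 2 / 2))).
have F1 v : slit (- cexp v) -> F v = 1.
  by move=> /G h; rewrite /F h -cexpD -mulrDr subrr mulr0 cexp0.
have [i0 r0] : Im (cexp u) = 0 /\ 0 <= Re (cexp u).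
  move: s1; rewrite /slit negbK !ReIm oppr_eq0 oppr_le0.
  by move=> /andP[/eqP ? ?].
have r1 : 0 < Re (cexp u).
  rewrite lt_neqAle r0 andbT eq_sym; apply/eqP => h.
  by have := cexp_neq0 u; rewrite (_ : cexp u = 0) ?eqxx//; apply: complex_eq.
have off s : 0 < s <= 1 -> Im (cexp (u + s%:C * 'i)) != 0.
  move=> /andP[s0 s2]; rewrite cexpD cexp_imag ReIm i0 mul0r addr0/=.
  rewrite mulf_eq0 negb_or gt_eqF//= gt_eqF//; apply: sin_gt0_pi.
  by have := @pi_ge2 R; rewrite s0/=; lra.
have FE : F u = F (u + 1%:C * 'i).
  apply: cderiv0_segment => s /andP[s0 s2].
  rewrite (_ : u + _ = u + s%:C * 'i); last by rewrite -[1%:C]/(1 : C); ring.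
  set y := u + _; have y1 : cexp y != 1.
    have [s0'|s0'] := eqVneq s 0; first by rewrite /y s0' mul0r addr0.
    apply: contraTneq (off s _) => [->|]; rewrite ?eqxx//.
    by rewrite lt_neqAle eq_sym s0' s0.
  have y1' : cexp (- y) != 1 by rewrite cexpN invr_eq1.
  have x1 : 1 - cexp y != 0 by rewrite subr_eq0 eq_sym.
  have x0 := cexp_neq0 y.
  have D1 := cderiv_rogers y1.
  have D2 := cderiv_comp (cderivN (cderiv_id y)) (cderiv_rogers y1').
  have D3 := cderivN (cderivM (cderivX 2 (cderiv_id y)) (cderiv_cst 2^-1 y)).
  apply: (cderiv_eq (cderivM (cderivM D1 D2) (cderiv_cexpK D3))).
  rewrite cexpN; set A := rogers y; set B := rogers (- y); set E := cexp (kappa * _).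
  have x2 : 1 - (cexp y)^-1 != 0 by rewrite subr_eq0 eq_sym invr_eq1.
  have x3 : cexp y - 1 != 0 by rewrite subr_eq0.
  by field; rewrite ?x0 ?x1 ?x2 ?x3.
have : F u = 1 by rewrite FE F1// slit_Im// ImN oppr_eq0 off// ltr01 lexx.
rewrite /F mulrN cexpN => h.
by apply: (mulIf (invr_neq0 (cexp_neq0 (kappa * (u ^+ 2 / 2))))); rewrite h divff// cexp_neq0.
Qed.
End ExponentiatedDilogarithm.

(** * Exponentiated critical values *)

Section CriticalValue.
Variable R : realType.
Local Notation C := R[i].
Implicit Types (x y z w u v a b nu : C) (r s t : R) (n k l : int).

Local Notation twopii := (@twopii R).
Local Notation kappa := (@kappa R).
Local Notation rogers := (@rogers R).

(** The quantity [e^y * (1 + |y|)] is small along the logarithm of a variable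
    that tends to 0. *)
Lemma rogers_near0 : exists2 K : R, 0 < K & exists2 d : R, 0 < d &
  forall y, nm (cexp y) * (1 + nm y) < d ->
  nm (rogers y - 1) <= K * (nm (cexp y) * (1 + nm y)).
Proof.
have [L L0 [e e0 HL]] := Li2_near0 R.
pose M := (nm kappa + 1) * (L + 4).
have M0 : 0 < M by apply: mulr_gt0; [rewrite ltr_wpDl// nm_ge0|rewrite addr_gt0].
exists (7 * M); first by rewrite mulr_gt0.
exists (Num.min e (Num.min (1 / 2) (1 / 2 / M))); first by rewrite !lt_min e0 !divr_gt0.
move=> y; rewrite !lt_min => /and3P[h1 h2 h3].
have y0 := nm_ge0 y; have x0 := nm_ge0 (cexp y).
have hx : nm (cexp y) <= nm (cexp y) * (1 + nm y) by rewrite ler_peMr// lerDl.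
have hs : slit (1 - cexp y).
  rewrite /slit negb_and -!ltNge; apply/orP; right.
  have q := le_trans (ler_norm _) (nm_Re (cexp y)).
  rewrite !ReIm subr_gt0 (le_lt_trans q)// (le_lt_trans hx)// (lt_trans h2)//=.
  by lra.
rewrite rogersE// /rogers0; set E := kappa * _.
have hE : nm E <= M * (nm (cexp y) * (1 + nm y)).
  rewrite /E nmM /M -mulrA ler_pM ?nm_ge0//; first by rewrite lerDl.
  rewrite (le_trans (nmD _ _))// [leRHS]mulrDl lerD//.
    have := HL (cexp y); rewrite subr0 => q; apply: le_trans (q _) _; first by lra.
    by rewrite ler_pM2l.
  rewrite nmM.
  have : nm (Log (1 - cexp y)) <= 4 * nm (cexp y).
    by rewrite -(nmN (cexp y)) Log_lip1// nmN; lra.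
  move=> /(ler_wpM2r y0) q; apply: le_trans q _.
  by rewrite -mulrA ler_pM2l// ler_wpM2l// lerDr.
move: h3; rewrite ltr_pdivlMr// mulrC => h3.
have E2 : nm E <= 1 / 2 by lra.
have := cexp_quad E2 => q.
rewrite (_ : cexp E - 1 = (cexp E - 1 - E) + E); last by ring.
rewrite (le_trans (nmD _ _))// -mulrA.
have : nm E ^+ 2 <= nm E * (1 / 2) by rewrite expr2 ler_wpM2l ?nm_ge0.
by lra.
Qed.

(** The exponential of [kappa] times the critical value of the deformed
    potential, as a function of arbitrary logarithms [u] and [v] of [z] and [w];
    [nu] is the logarithm of the inverse of the deformation parameter. *)
Definition crit n u v nu :=
  (rogers (u + v))^-1 * rogers (u - v) *
  cexp (kappa * (- (n%:~R / 2 * u ^+ 2) + u * v + v * nu)).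

Lemma rogers_neq0 u : rogers u != 0.
Proof.
rewrite /rogers; case: ifP => _; first exact: cexp_neq0.
by apply: mulf_neq0; rewrite ?invr_eq0 cexp_neq0.
Qed.

(** Independence of the choice of the logarithms: this is where the critical
    point equations enter, in exponentiated form. *)
Lemma crit_shift n k l u v nu : cexp (u + v) != 1 -> cexp (u - v) != 1 ->
  (1 - cexp (u - v)) * cexp v = cexp (n%:~R * u) * (1 - cexp (u + v)) ->
  (1 - cexp (u + v)) * (1 - cexp (u - v)) = cexp nu * cexp u ->
  crit n (u + k%:~R * twopii) (v + l%:~R * twopii) nu = crit n u v nu.
Proof.
move=> x1 y1 E1 E2.
pose a := Log (1 - cexp (u + v)); pose b := Log (1 - cexp (u - v)).
have ea : cexp a = 1 - cexp (u + v) by rewrite cexp_Log// subr_eq0 eq_sym.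
have eb : cexp b = 1 - cexp (u - v) by rewrite cexp_Log// subr_eq0 eq_sym.
rewrite -ea -eb in E1 E2.
have w1 : cexp (a - b + n%:~R * u - v) = 1.
  rewrite cexpB cexpD cexpB -[_ * cexp (_ * u)]mulrAC [cexp a * _]mulrC -E1.
  by field; rewrite !cexp_neq0.
have w2 : cexp (a + b - u - nu) = 1.
  by rewrite !cexpB cexpD E2; field; rewrite !cexp_neq0.
rewrite /crit.
have -> : u + k%:~R * twopii + (v + l%:~R * twopii) = u + v + (k + l)%:~R * twopii.
  by rewrite intrD; ring.
have -> : u + k%:~R * twopii - (v + l%:~R * twopii) = u - v + (k - l)%:~R * twopii.
  by rewrite intrB; ring.
rewrite (@rogers_shift R (u + v) a)// (@rogers_shift R (u - v) b)//.
rewrite invfM -cexpN.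
set r1 := (rogers _)^-1; set r2 := rogers _.
set e1 := - (_ * _ * a); set e2 := _ * _ * b; set e3 := kappa * _; set e4 := kappa * _.
have -> : r1 * cexp e1 * (r2 * cexp e2) * cexp e3 = r1 * r2 * cexp (e1 + e2 + e3).
  by rewrite !cexpD; ring.
congr (_ * _).
(* [w0] collects the terms quadratic in the periods and [w3] is the combination of
   the logarithms of the two equations by the number of periods *)
pose w0 := (12 * n * k ^+ 2)%:~R * twopii + kappa * ((k * l)%:~R * twopii ^+ 2).
have w0E : cexp w0 = 1 by rewrite cexpD cexp_twopiiz cexp_kappa_sqr mulr1.
pose w3 := (24 * k)%:~R * (a - b + n%:~R * u - v) + (24 * l)%:~R * (a + b - u - nu).
have w3E : cexp w3 = 1 by rewrite cexpD !cexpMz w1 w2 !exp1rz mulr1.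
apply: (@cexp_mod _ _ _ (w0 + w3)); first by rewrite cexpD w0E w3E mulr1.
have kT : kappa * twopii = - 24 := kappa_twopii R.
rewrite /e1 /e2 /e3 /e4 /w0 /w3 !intrM !intrB !intrD expr2 ?intrM.
apply/eqP; rewrite -subr_eq0; apply/eqP.
(* what remains is a multiple of [kappa * twopii + 24], which is zero *)
pose q : C := (k%:~R * (v - n%:~R * u) + l%:~R * (u + nu) - n%:~R * k%:~R ^+ 2 * twopii / 2).
rewrite (_ : _ - _ = (kappa * twopii + 24) * q); first by rewrite kT addNr mul0r.
by rewrite /q; field.
Qed.

(** The equations, differentiated in logarithmic form, cancel every term of the
    logarithmic derivative but [v' * nu]. *)
Lemma cderiv_crit n (u v nu : C -> C) (s u' v' nu' : C) :
  cderiv u s u' -> cderiv v s v' -> cderiv nu s nu' ->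
  (\forall y \near cnbhs s, (1 - cexp (u y - v y)) * cexp (v y) =
     cexp (n%:~R * u y) * (1 - cexp (u y + v y))) ->
  (\forall y \near cnbhs s, (1 - cexp (u y + v y)) * (1 - cexp (u y - v y)) =
     cexp (nu y) * cexp (u y)) ->
  cderiv (fun y => crit n (u y) (v y) (nu y)) s
         (crit n (u s) (v s) (nu s) * (kappa * (v' * nu s))).
Proof.
move=> Du Dv Dnu E1 E2.
have x0 : (1 - cexp (u s + v s)) * (1 - cexp (u s - v s)) != 0.
  by rewrite (cnbhs_singleton E2) mulf_neq0 ?cexp_neq0.
move: (x0); rewrite mulf_eq0 negb_or => /andP[xa xb].
have x1 : cexp (u s + v s) != 1 by rewrite eq_sym -subr_eq0.
have y1 : cexp (u s - v s) != 1 by rewrite eq_sym -subr_eq0.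
have Dp := cderivD Du Dv; have Dm := cderivB Du Dv.
have Dep := cderiv_comp Dp (cderiv_cexp _); have Dem := cderiv_comp Dm (cderiv_cexp _).
have Da := cderivB (cderiv_cst 1 s) Dep; have Db := cderivB (cderiv_cst 1 s) Dem.
have Dev := cderiv_comp Dv (cderiv_cexp _); have Deu := cderiv_comp Du (cderiv_cexp _).
have Denu := cderiv_comp Dnu (cderiv_cexp _).
have Den := cderiv_comp (cderivZ n%:~R Du) (cderiv_cexp _).
have F1 := cderiv_uniq (cderivM Db Dev) (cderiv_near E1 (cderivM Den Da)).
have F2 := cderiv_uniq (cderivM Da Db) (cderiv_near E2 (cderivM Denu Deu)).
have {}E1 := cnbhs_singleton E1; have {}E2 := cnbhs_singleton E2.
pose a' := - cexp (u s + v s) / (1 - cexp (u s + v s)) * (u' + v').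
pose b' := - cexp (u s - v s) / (1 - cexp (u s - v s)) * (u' - v').
have G1 : a' - b' + n%:~R * u' - v' = 0.
  apply: (mulfI (mulf_neq0 xb (cexp_neq0 (v s)))); rewrite mulr0.
  have -> : (1 - cexp (u s - v s)) * cexp (v s) * (a' - b' + n%:~R * u' - v') =
    cexp (n%:~R * u s) * (1 - cexp (u s + v s)) * (a' + n%:~R * u') -
    (1 - cexp (u s - v s)) * cexp (v s) * (b' + v') by rewrite -E1; ring.
  rewrite /a' /b'; apply/eqP; rewrite subr_eq0 eq_sym; apply/eqP.
  by transitivity ((0 - cexp (u s - v s) * (u' - v')) * cexp (v s) +
     (1 - cexp (u s - v s)) * (cexp (v s) * v')); [field|rewrite F1; field].
have G2 : a' + b' - u' - nu' = 0.
  apply: (mulfI x0); rewrite mulr0.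
  have -> : (1 - cexp (u s + v s)) * (1 - cexp (u s - v s)) * (a' + b' - u' - nu') =
    (1 - cexp (u s + v s)) * (1 - cexp (u s - v s)) * (a' + b') -
    cexp (nu s) * cexp (u s) * (nu' + u') by rewrite -E2; ring.
  rewrite /a' /b'; apply/eqP; rewrite subr_eq0; apply/eqP.
  transitivity ((0 - cexp (u s + v s) * (u' + v')) * (1 - cexp (u s - v s)) +
     (1 - cexp (u s + v s)) * (0 - cexp (u s - v s) * (u' - v'))).
    by field; rewrite xa xb.
  by rewrite F2; ring.
have H1 := cderiv_comp Dp (cderiv_rogers x1).
have H2 := cderiv_comp Dm (cderiv_rogers y1).
have H3 := cderivD (cderivD (cderivN (cderivZ (n%:~R / 2) (cderivX 2 Du))) (cderivM Du Dv)) (cderivM Dv Dnu).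
apply: (cderiv_eq (cderivM (cderivM (cderivV H1 (rogers_neq0 _)) H2) (cderiv_cexpK H3))).
rewrite /crit.
have r1 := rogers_neq0 (u s + v s).
set A := rogers (u s + v s) in r1 *; set B := rogers _; set E := cexp (kappa * _).
have ea : - (u s + v s) * cexp (u s + v s) / (1 - cexp (u s + v s)) * (u' + v') =
  (u s + v s) * a' by rewrite /a'; ring.
have eb : - (u s - v s) * cexp (u s - v s) / (1 - cexp (u s - v s)) * (u' - v') =
  (u s - v s) * b' by rewrite /b'; ring.
rewrite -[A * _ * _]mulrA -[kappa * _ * (u' + v')]mulrA ea.
rewrite -[B * _ * _]mulrA -[kappa * _ * (u' - v')]mulrA eb.
apply/eqP; rewrite -subr_eq0; apply/eqP.
rewrite (_ : _ - _ = - (A^-1 * B * E * kappa) *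
  (u s * (a' - b' + n%:~R * u' - v') + v s * (a' + b' - u' - nu'))).
  by rewrite G1 G2 !mulr0 addr0 mulr0.
by rewrite /= expr1; field; rewrite r1.
Qed.

End CriticalValue.

(** * Roots of a pencil of polynomials *)

Section RootTracking.
Variable R : realType.
Local Notation C := R[i].
Implicit Types (p q : {poly C}) (x y z w : C) (s t : seq C).

(** The roots with their multiplicities. *)
Definition rootseq p : seq C := sval (closed_field_poly_normal p).

Lemma rootseqE p : p \is monic -> p = \prod_(z <- rootseq p) ('X - z%:P).
Proof.
move=> /monicP p1; rewrite /rootseq; case: closed_field_poly_normal => /= r.
by rewrite p1 scale1r.
Qed.

Lemma mem_rootseq p z : p \is monic -> (z \in rootseq p) = root p z.
Proof. by move=> pm; rewrite {2}(rootseqE pm) root_prod_XsubC. Qed.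

Lemma size_rootseq p : p \is monic -> size (rootseq p) = (size p).-1.
Proof. by move=> pm; rewrite {2}(rootseqE pm) size_prod_XsubC. Qed.

Definition simple_roots p := forall z, root p z -> p^`().[z] != 0.

Lemma uniq_rootseq p : p \is monic -> simple_roots p -> uniq (rootseq p).
Proof.
move=> pm H; have {}H z : z \in rootseq p ->
    (\prod_(x <- rootseq p) ('X - x%:P))^`().[z] != 0.
  by rewrite -rootseqE// mem_rootseq//; exact: H.
elim: (rootseq p) H => //= a s IH H.
have E z : (\prod_(x <- a :: s) ('X - x%:P))^`().[z] =
    (\prod_(x <- s) ('X - x%:P)).[z] + (z - a) * (\prod_(x <- s) ('X - x%:P))^`().[z].
  by rewrite big_cons derivM derivXsubC mul1r hornerD hornerM hornerXsubC.
rewrite IH ?andbT => [|z zs].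
  have := H a; rewrite inE eqxx E subrr mul0r addr0 => /(_ isT).
  by apply: contraNN => h; rewrite -/(root _ _) root_prod_XsubC.
have := H z; rewrite inE zs orbT E => /(_ isT).
have /eqP -> : (\prod_(x <- s) ('X - x%:P)).[z] == 0.
  by rewrite -/(root _ _) root_prod_XsubC.
by rewrite add0r mulf_eq0 negb_or => /andP[].
Qed.

(** The logarithmic derivative of a product of linear factors is a sum of
    inverses of differences, hence large only if some root is near. *)
Lemma deriv_prod_bound s z (m : R) : (forall x, x \in s -> m <= nm (z - x)) ->
  m * nm (\prod_(x <- s) ('X - x%:P))^`().[z] <=
  (size s)%:R * nm (\prod_(x <- s) ('X - x%:P)).[z].
Proof.
elim: s => [|a s IH] H.
  by rewrite big_nil -[1]/(1%:P) derivC horner0 nm0 mulr0 mul0r.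
rewrite !big_cons derivM derivXsubC mul1r hornerD !hornerM !hornerXsubC.
set Q := \prod_(x <- s) _ in IH *.
have {}IH : m * nm Q^`().[z] <= (size s)%:R * nm Q.[z].
  by apply: IH => x xs; apply: H; rewrite inE xs orbT.
have ma : m <= nm (z - a) by apply: H; rewrite inE eqxx.
rewrite nmM /= -natr1.
have [m0|m0] := leP 0 m; last first.
  apply: (@le_trans _ _ 0); first by rewrite mulr_le0_ge0 ?nm_ge0 ?ltW.
  by rewrite !mulr_ge0 ?nm_ge0// addr_ge0.
apply: (le_trans (ler_wpM2l m0 (nmD _ _))).
rewrite nmM mulrDr mulrDl mul1r addrC lerD//.
  rewrite mulrCA [leRHS]mulrCA ler_wpM2l ?nm_ge0//.
by rewrite ler_wpM2r ?nm_ge0.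
Qed.

Lemma seq_min (T : eqType) (f : T -> R) (a : T) (s : seq T) :
  exists2 b, b \in a :: s & forall c : T, c \in a :: s -> f b <= f c.
Proof.
elim: s a => [|c s IH] a; first by exists a; rewrite ?inE// => x; rewrite inE => /eqP ->.
have [b bs H] := IH c; have [h|h] := leP (f a) (f b).
  exists a; first by rewrite inE eqxx.
  by move=> x; rewrite inE => /orP[/eqP ->//|/H]; apply: le_trans.
exists b; first by rewrite inE bs orbT.
by move=> x; rewrite inE => /orP[/eqP ->|/H//]; exact: ltW.
Qed.

(** Some root is as near to [z] as the Newton step times the size of [p]. *)
Lemma root_near p z : p \is monic -> (1 < size p)%N ->
  exists2 x, root p x & nm (z - x) * nm p^`().[z] <= (size p)%:R * nm p.[z].
Proof.
move=> pm p1.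
have : size (rootseq p) != 0%N by rewrite size_rootseq//; lia.
case E : (rootseq p) => [//|a s] _.
have [b bs Hb] := seq_min (fun x => nm (z - x)) a s.
rewrite -E in bs Hb; exists b; first by rewrite -mem_rootseq.
have := deriv_prod_bound Hb; rewrite -(rootseqE pm) size_rootseq// => /le_trans; apply.
by rewrite ler_wpM2r ?nm_ge0// ler_nat leq_pred.
Qed.

Lemma near_all_seq (T : eqType) (s : seq T) (x0 : C) (Q : T -> C -> Prop) :
  (forall c : T, c \in s -> \forall y \near cnbhs x0, Q c y) ->
  \forall y \near cnbhs x0, forall c : T, c \in s -> Q c y.
Proof.
elim: s => [|a s IH] H; first by apply: nearW.
have h1 : \forall y \near cnbhs x0, Q a y by apply: H; rewrite inE eqxx.
have h2 : \forall y \near cnbhs x0, forall c : T, c \in s -> Q c y.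
  by apply: IH => c cs; apply: H; rewrite inE cs orbT.
by apply: filterS2 h1 h2 => y qa qs z; rewrite inE => /orP[/eqP ->//|/qs].
Qed.

Section Pencil.
Variables (N D : {poly C}).
Hypothesis N_monic : N \is monic.
Hypothesis DN : (size D < size N)%N.
Hypothesis N1 : (1 < size N)%N.

Definition pencil x : {poly C} := N - x *: D.

Lemma pencil_size x : size (pencil x) = size N.
Proof.
rewrite /pencil size_polyDl// size_polyN.
by apply: leq_ltn_trans DN; exact: size_scale_leq.
Qed.

Lemma pencil_monic x : pencil x \is monic.
Proof.
rewrite monicE lead_coefDl; first by rewrite -monicE.
by rewrite size_polyN; apply: leq_ltn_trans DN; exact: size_scale_leq.
Qed.

Lemma pencil_horner x z : (pencil x).[z] = N.[z] - x * D.[z].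
Proof. by rewrite !hornerE. Qed.

Lemma pencil_deriv x z : (pencil x)^`().[z] = N^`().[z] - x * D^`().[z].
Proof. by rewrite derivB derivZ !hornerE. Qed.

Lemma pencil_root x z : root (pencil x) z = (N.[z] == x * D.[z]).
Proof. by rewrite /root pencil_horner subr_eq0. Qed.

(** The Newton step at a simple root is of the order of the change of the
    parameter. *)
Lemma simple_root_lip x0 z : root (pencil x0) z -> (pencil x0)^`().[z] != 0 ->
  exists K : R, \forall x \near cnbhs x0,
    exists2 y, root (pencil x) y & nm (y - z) <= K * nm (x - x0).
Proof.
move=> rz dz; set p' := (pencil x0)^`().[z] in dz.
have p0 : 0 < nm p' by rewrite nm_gt0.
exists ((size N)%:R * nm D.[z] * 2 / nm p').
have H := @cnbhs_ball R x0 (nm p' / 2 / (nm D^`().[z] + 1)).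
have {H} H : \forall x \near cnbhs x0, nm (x - x0) < nm p' / 2 / (nm D^`().[z] + 1).
  by apply: H; rewrite !divr_gt0// ltr_wpDl// nm_ge0.
near=> x.
have hx : nm (x - x0) < nm p' / 2 / (nm D^`().[z] + 1) by near: x.
have e1 : (pencil x).[z] = - ((x - x0) * D.[z]).
  by move: rz; rewrite pencil_root pencil_horner => /eqP ->; ring.
have e2 : p' = (pencil x)^`().[z] + (x - x0) * D^`().[z].
  by rewrite /p' !pencil_deriv; ring.
have e3 : nm p' / 2 <= nm (pencil x)^`().[z].
  have := nmD (pencil x)^`().[z] ((x - x0) * D^`().[z]); rewrite -e2 nmM.
  move: hx; rewrite ltr_pdivlMr ?ltr_wpDl ?nm_ge0// mulrDr mulr1.
  have := nm_ge0 (x - x0); have := nm_ge0 D^`().[z]; lra.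
have s1 : (1 < size (pencil x))%N by rewrite pencil_size.
have [y ry] := root_near z (pencil_monic x) s1.
rewrite pencil_size e1 nmN nmM => hy; exists y => //; rewrite [leLHS]nmB.
have -> : (size N)%:R * nm D.[z] * 2 / nm p' * nm (x - x0) =
    (size N)%:R * (nm (x - x0) * nm D.[z]) / (nm p' / 2).
  by field; rewrite gt_eqF.
rewrite ler_pdivlMr ?divr_gt0// (le_trans _ hy)//.
by rewrite ler_wpM2l ?nm_ge0.
Unshelve. all: by end_near. Qed.

(** The implicit function theorem for the roots: [simple_root_lip] selects roots
    that depend on the parameter in a Lipschitz way, the equation then gives their
    derivatives, and they exhaust all roots because they are distinct and in the
    right number. *)
Lemma local_roots x0 : simple_roots (pencil x0) ->
  exists zeta : C -> C -> C,
  [/\ forall z, z \in rootseq (pencil x0) -> exists l, cderiv (zeta z) x0 l,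
      forall z, z \in rootseq (pencil x0) -> zeta z x0 = z &
      \forall x \near cnbhs x0,
        perm_eq (rootseq (pencil x)) [seq zeta z x | z <- rootseq (pencil x0)]].
Proof.
move=> S; set r0 := rootseq (pencil x0).
have rP x z : (z \in rootseq (pencil x)) = root (pencil x) z.
  by rewrite mem_rootseq// pencil_monic.
have /choice[K HK] : forall z, exists K : R, z \in r0 -> \forall x \near cnbhs x0,
    exists2 y, root (pencil x) y & nm (y - z) <= K * nm (x - x0).
  move=> z; have [zr|zr] := boolP (z \in r0); last by exists 0.
  by rewrite rP in zr; have [K HK] := simple_root_lip zr (S z zr); exists K.
pose zeta z x := xget z [set y | root (pencil x) y /\ nm (y - z) <= K z * nm (x - x0)].
have Z z : z \in r0 -> \forall x \near cnbhs x0,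
    root (pencil x) (zeta z x) /\ nm (zeta z x - z) <= K z * nm (x - x0).
  move=> zr; apply: filterS (HK z zr) => x [y ry hy].
  by apply: (@xgetPex _ z [set y | root (pencil x) y /\ nm (y - z) <= K z * nm (x - x0)]); exists y.
have Z0 z : z \in r0 -> zeta z x0 = z.
  move=> zr; have [_] := cnbhs_singleton (Z z zr).
  rewrite subrr nm0 mulr0 => h; apply/eqP; rewrite -subr_eq0 -nm_eq0.
  by rewrite eq_le h nm_ge0.
have D1 z : z \in r0 -> exists l, cderiv (zeta z) x0 l.
  move=> zr; have := zr; rewrite rP => rz; have p0 := S z rz.
  set p' := _.[z] in p0.
  have Hz := Z z zr.
  have [L L0 HL] := cderivP (cderiv_poly (pencil x0) z).
  have [M M0 HM] := cderiv_lip (cderiv_poly D z).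
  have T (P : set C) : (\forall y \near cnbhs z, P y) -> \forall x \near cnbhs x0, P (zeta z x).
    move=> [d d0 HP].
    have HB : \forall x \near cnbhs x0, nm (x - x0) < d / (`|K z| + 1).
      by apply: cnbhs_ball; rewrite divr_gt0// ltr_wpDl.
    near=> x; apply: HP.
    have [_ h] : root (pencil x) (zeta z x) /\ nm (zeta z x - z) <= K z * nm (x - x0) by near: x.
    have : nm (x - x0) < d / (`|K z| + 1) by near: x.
    rewrite ltr_pdivlMr ?ltr_wpDl// mulrDr mulr1 => h2.
    have := nm_ge0 (x - x0); have := ler_norm (K z); nra.
  have {HL}HL := T _ HL; have {HM}HM := T _ HM.
  exists (D.[z] / p'); rewrite /cderiv Z0//.
  exists ((M * `|K z| + L * `|K z| ^+ 2) / nm p'); near=> x.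
  have [rx hx] : root (pencil x) (zeta z x) /\ nm (zeta z x - z) <= K z * nm (x - x0) by near: x.
  have h1 : nm ((pencil x0).[zeta z x] - (pencil x0).[z] - (pencil x0)^`().[z] * (zeta z x - z)) <=
     L * nm (zeta z x - z) ^+ 2 by near: x.
  have h2 : nm (D.[zeta z x] - D.[z]) <= M * nm (zeta z x - z) by near: x.
  set y := zeta z x in rx hx h1 h2 *.
  have e0 : (pencil x0).[z] = 0 by apply/eqP.
  have e1 : (pencil x0).[y] = (x - x0) * D.[y].
    by move: rx; rewrite pencil_root pencil_horner => /eqP ->; ring.
  rewrite e0 subr0 e1 -/p' in h1.
  have -> : y - z - D.[z] / p' * (x - x0) =
    ((x - x0) * (D.[y] - D.[z]) - ((x - x0) * D.[y] - p' * (y - z))) / p'.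
    by field.
  have hx' : nm (y - z) <= `|K z| * nm (x - x0).
    by rewrite (le_trans hx)// ler_wpM2r ?nm_ge0// ler_norm.
  rewrite nmM nmV mulrAC ler_wpM2r ?invr_ge0 ?nm_ge0//.
  apply: (le_trans (nmBD _ _)); rewrite [leRHS]mulrDl lerD//.
    rewrite nmM expr2.
    have -> : M * `|K z| * (nm (x - x0) * nm (x - x0)) =
       nm (x - x0) * (M * (`|K z| * nm (x - x0))) by ring.
    rewrite ler_wpM2l ?nm_ge0// (le_trans h2)// ler_pM2l//.
  rewrite (le_trans h1)// -mulrA -exprMn ler_pM2l// ler_sqr ?nnegrE ?nm_ge0//.
  by rewrite mulr_ge0 ?nm_ge0.
exists zeta; split=> //.
have U : uniq r0 by apply: uniq_rootseq => //; exact: pencil_monic.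
have Sep : \forall x \near cnbhs x0, forall z, z \in r0 -> forall z', z' \in r0 ->
    z != z' -> zeta z x != zeta z' x.
  apply: near_all_seq => z zr; apply: near_all_seq => z' z'r.
  have [->|zz'] := eqVneq z z'; first exact: nearW.
  have [l Dz] := D1 z zr; have [l' Dz'] := D1 z' z'r.
  have h : zeta z x0 - zeta z' x0 != 0 by rewrite !Z0// subr_eq0.
  apply: filterS (cderiv_cont (cderivB Dz Dz') (cnbhs_neq0 h)) => x.
  by rewrite subr_eq0.
have Zall : \forall x \near cnbhs x0, forall z, z \in r0 -> root (pencil x) (zeta z x).
  by apply: near_all_seq => z zr; apply: filterS (Z z zr) => x [].
near=> x.
have h1 : forall z, z \in r0 -> root (pencil x) (zeta z x) by near: x.
have h2 : forall z, z \in r0 -> forall z', z' \in r0 ->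
    z != z' -> zeta z x != zeta z' x by near: x.
have u2 : uniq [seq zeta z x | z <- r0].
  rewrite map_inj_in_uniq// => z z' zr z'r E; apply/eqP; apply: contraT => zz'.
  by have := h2 z zr z' z'r zz'; rewrite E eqxx.
have sub : {subset [seq zeta z x | z <- r0] <= rootseq (pencil x)}.
  by move=> y /mapP[z zr ->]; rewrite rP h1.
have sz : (size (rootseq (pencil x)) <= size [seq zeta z x | z <- r0])%N.
  by rewrite size_map !size_rootseq ?pencil_monic// !pencil_size.
have [_ E] := uniq_min_size u2 sub sz.
apply: uniq_perm => //; first exact: leq_size_uniq u2 sub sz.
Unshelve. all: by end_near. Qed.

End Pencil.
End RootTracking.

(** * The deformed system *)

Section Family.
Variable R : realType.
Local Notation C := R[i].
Variable n : nat.
Hypothesis n3 : (2 < n)%N.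
Implicit Types (x y z w : C).

(** When [n] is even, [z = -1] solves the polynomial equation for every
    value of the deformation parameter without being a solution of the system;
    the factor [cpoly] removes this spurious root. *)
Definition cpoly : {poly C} := if odd n then 1 else 'X - (-1)%:P.
Definition pa : {poly C} := ('X^(n.-1) + 1) %/ cpoly.
Definition pb : {poly C} := ('X^(n.+1) + 1) %/ cpoly.
Definition pd : {poly C} := ('X^2 - 1) %/ cpoly.

Lemma expN1_odd k : odd k -> (-1) ^+ k = -1 :> C.
Proof. by move=> h; rewrite -signr_odd h expr1. Qed.

Lemma expN1_even k : ~~ odd k -> (-1) ^+ k = 1 :> C.
Proof. by move=> h; rewrite -signr_odd (negbTE h) expr0. Qed.

Lemma paE : pa * cpoly = 'X^(n.-1) + 1.
Proof.
rewrite divpK// /cpoly; case: ifPn => h; first exact: dvd1p.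
rewrite dvdp_XsubCl /root !hornerE expN1_odd ?addNr//.
by case: n n3 h => //= m _; rewrite negbK.
Qed.

Lemma pbE : pb * cpoly = 'X^(n.+1) + 1.
Proof.
rewrite divpK// /cpoly; case: ifPn => h; first exact: dvd1p.
by rewrite dvdp_XsubCl /root !hornerE expN1_odd ?addNr.
Qed.

Lemma pdE : pd * cpoly = 'X^2 - 1.
Proof.
rewrite divpK// /cpoly; case: ifPn => h; first exact: dvd1p.
by rewrite dvdp_XsubCl /root !hornerE expN1_even ?subrr.
Qed.

Lemma cpoly_monic : cpoly \is monic.
Proof. by rewrite /cpoly; case: ifP => _; rewrite ?monic1 ?monicXsubC. Qed.

Lemma cpoly_neq0 : cpoly != 0.
Proof. exact: monic_neq0 cpoly_monic. Qed.

Lemma Xn1_monic k : (0 < k)%N -> ('X^k + 1 : {poly C}) \is monic.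
Proof. by move=> k0; rewrite -[1]/(1%:P) monicXnaddC. Qed.

Lemma pa_monic : pa \is monic.
Proof. by rewrite -(monicMr _ cpoly_monic) paE Xn1_monic//; case: n n3 => [|[]]. Qed.

Lemma pb_monic : pb \is monic.
Proof. by rewrite -(monicMr _ cpoly_monic) pbE Xn1_monic. Qed.

Lemma pd_monic : pd \is monic.
Proof.
by rewrite -(monicMr _ cpoly_monic) pdE -[1]/(1%:P) monicXnsubC.
Qed.

Lemma size_sub p (q : {poly C}) : p \is monic -> p * cpoly = q ->
  (size q = size p + (size cpoly).-1)%N.
Proof.
move=> pm <-; rewrite size_monicM ?cpoly_neq0//.
by have := size_poly_gt0 cpoly; rewrite cpoly_neq0; case: (size cpoly) => // k _; rewrite addnS.
Qed.

Lemma size_pa : (n = size pa + (size cpoly).-1)%N.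
Proof. by rewrite -(size_sub pa_monic paE) -[1]/(1%:P) size_XnaddC; case: n n3 => [|[]]. Qed.

Lemma size_pb : (n.+2 = size pb + (size cpoly).-1)%N.
Proof. by rewrite -(size_sub pb_monic pbE) -[1]/(1%:P) size_XnaddC. Qed.

Lemma size_pd : (3 = size pd + (size cpoly).-1)%N.
Proof. by rewrite -(size_sub pd_monic pdE) -[1]/(1%:P) size_XnsubC. Qed.

Lemma size_cpoly : (0 < size cpoly <= 2)%N.
Proof. by rewrite /cpoly; case: ifP => _; rewrite ?size_poly1 ?size_XsubC. Qed.

Lemma paH z : pa.[z] * cpoly.[z] = z ^+ n.-1 + 1.
Proof. by rewrite -hornerM paE !hornerE. Qed.

Lemma pbH z : pb.[z] * cpoly.[z] = z ^+ n.+1 + 1.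
Proof. by rewrite -hornerM pbE !hornerE. Qed.

Lemma pdH z : pd.[z] * cpoly.[z] = z ^+ 2 - 1.
Proof. by rewrite -hornerM pdE !hornerE. Qed.

Lemma nE : n = n.-2.+2 :> nat. Proof. by case: n n3 => [|[]]. Qed.

Lemma pb_sub_pa : pb - pa = 'X^(n.-1) * pd.
Proof.
apply: (mulIf cpoly_neq0); rewrite mulrBl -mulrA paE pbE pdE [in LHS]nE [in RHS]nE /=.
rewrite !exprS expr0; ring.
Qed.

Lemma pb_sub_X2pa : pb - 'X^2 * pa = - pd.
Proof.
apply: (mulIf cpoly_neq0); rewrite mulrBl mulNr -mulrA paE pbE pdE [in LHS]nE /=.
rewrite !exprS expr0; ring.
Qed.

Lemma pb_paH z : pb.[z] = pa.[z] + z ^+ n.-1 * pd.[z].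
Proof.
have := congr1 (horner^~ z) pb_sub_pa; rewrite !hornerE => <-; ring.
Qed.

Lemma pb_pdH z : pb.[z] = z ^+ 2 * pa.[z] - pd.[z].
Proof.
have := congr1 (horner^~ z) pb_sub_X2pa; rewrite !hornerE => h.
have -> : pd.[z] = - - pd.[z] by rewrite opprK.
by rewrite -h; ring.
Qed.

Lemma pd_root z : pd.[z] = 0 -> z ^+ n.-1 != -1.
Proof.
move=> h; have := pdH z; rewrite h mul0r => /esym/eqP.
rewrite subr_eq0 -[X in _ == X](expr1n _ 2) eqf_sqr => /orP[] /eqP ez.
  rewrite ez expr1n -addr_eq0 -[1]/(1%:R : C) -natrD pnatr_eq0//.
move: h; rewrite ez /pd /cpoly; case: ifPn => hn.
  move=> _; rewrite expN1_even; last by case: n n3 hn => //= m _; rewrite negbK.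
  by rewrite -addr_eq0 -[1]/(1%:R : C) -natrD pnatr_eq0.
have -> : 'X^2 - 1 = ('X - 1) * ('X - (-1)%:P) :> {poly C}.
  by rewrite polyCN opprK; ring.
rewrite mulpK ?polyXsubC_eq0// !hornerE => /eqP.
rewrite -opprD oppr_eq0 -[1]/(1%:R : C) -natrD pnatr_eq0//.
Qed.

(** The system at parameter [x] becomes [Npol = x * Dpol] after elimination of
    the second coordinate; the zeros of [Npol] are roots of unity. *)
Definition Npol : {poly C} := pa * pb.
Definition Dpol : {poly C} := 'X^(n.-2) * pd ^+ 2.

Lemma Npol_monic : Npol \is monic.
Proof. by rewrite /Npol monicMl// ?pa_monic// pb_monic. Qed.

Lemma Dpol_size : (size Dpol < size Npol)%N.
Proof.
have pb0 : pb != 0 by rewrite monic_neq0 ?pb_monic.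
have pd0 : pd != 0 by rewrite monic_neq0 ?pd_monic.
rewrite /Dpol /Npol (size_monicM pa_monic pb0).
have Xm : ('X^(n.-2) : {poly C}) \is monic by exact: monicXn.
rewrite (size_monicM Xm) ?expf_neq0// expr2 (size_monicM pd_monic pd0) size_polyXn.
have := size_pa; have := size_pb; have := size_pd; have := size_cpoly; have := n3.
by move: (size pa) (size pb) (size pd) (size cpoly) => ? ? ? ?; lia.
Qed.

Lemma Npol_size1 : (1 < size Npol)%N.
Proof.
have pb0 : pb != 0 by rewrite monic_neq0 ?pb_monic.
rewrite /Npol (size_monicM pa_monic pb0).
have := size_pa; have := size_pb; have := size_cpoly; have := n3.
by move: (size pa) (size pb) (size cpoly) => ? ? ?; lia.
Qed.

Lemma cpoly0 : cpoly.[0] = 1.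
Proof. by rewrite /cpoly; case: ifP => _; rewrite !hornerE ?opprK. Qed.

Lemma pa0 : pa.[0] = 1.
Proof. by have := paH 0; rewrite cpoly0 mulr1 nE /= expr0n add0r. Qed.

Lemma pb0 : pb.[0] = 1.
Proof. by have := pbH 0; rewrite cpoly0 mulr1 expr0n add0r. Qed.

Lemma NpolH z : Npol.[z] = pa.[z] * pb.[z]. Proof. exact: hornerM. Qed.
Lemma DpolH z : Dpol.[z] = z ^+ n.-2 * pd.[z] ^+ 2. Proof. by rewrite !hornerE. Qed.

Lemma Dpol0 : Dpol.[0] = 0.
Proof. by rewrite DpolH expr0n; case: n n3 => [|[|[]]]//= m _; rewrite mul0r. Qed.

Local Notation pencil := (pencil Npol Dpol).

Lemma pa_root z : pa.[z] = 0 -> z ^+ n.-1 = -1.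
Proof. by move=> h; have := paH z; rewrite h mul0r => /esym/eqP; rewrite addr_eq0 => /eqP. Qed.

Lemma pa_root_neq0 z : pa.[z] = 0 -> z != 0.
Proof. by move=> h; apply/eqP => z0; move/eqP: h; rewrite z0 pa0 oner_eq0. Qed.

Lemma pa_root_pd z : pa.[z] = 0 -> pd.[z] != 0.
Proof. by move=> h; apply/eqP => /pd_root; rewrite (pa_root h) eqxx. Qed.

Lemma pa_root_pb z : pa.[z] = 0 -> pb.[z] = - pd.[z].
Proof. by move=> h; rewrite pb_pdH h mulr0 sub0r. Qed.

Lemma pb_root z : pb.[z] = 0 -> z ^+ n.+1 = -1.
Proof. by move=> h; have := pbH z; rewrite h mul0r => /esym/eqP; rewrite addr_eq0 => /eqP. Qed.

Lemma pb_root_neq0 z : pb.[z] = 0 -> z != 0.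
Proof. by move=> h; apply/eqP => z0; move/eqP: h; rewrite z0 pb0 oner_eq0. Qed.

Lemma pb_root_pd z : pb.[z] = 0 -> pd.[z] != 0.
Proof.
move=> h; apply/eqP => hd; have := pb_pdH z; rewrite h hd subr0 => /esym/eqP.
rewrite mulf_eq0 expf_eq0/= (negbTE (pb_root_neq0 h))/= => /eqP ha.
by have := pa_root_pd ha; rewrite hd eqxx.
Qed.

Lemma Dpol_neq0 z : z != 0 -> pd.[z] != 0 -> Dpol.[z] != 0.
Proof. by move=> z0 d0; rewrite DpolH mulf_neq0// expf_neq0. Qed.

(** After division by [cpoly] no two of the three factors have a common zero, so
    that away from parameter 0 no root of the pencil is degenerate. *)
Lemma pencil_rootP x z : x != 0 -> root (pencil x) z ->
  [/\ z != 0, pa.[z] != 0, pb.[z] != 0 & pd.[z] != 0].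
Proof.
move=> x0; rewrite pencil_root => /eqP E.
have z0 : z != 0.
  apply/eqP => h; move: E; rewrite h Dpol0 mulr0 NpolH pa0 pb0 mulr1 => /eqP.
  by rewrite oner_eq0.
have a0 : pa.[z] != 0.
  apply/eqP => h; have := Dpol_neq0 z0 (pa_root_pd h).
  by move: E; rewrite NpolH h mul0r => /esym/eqP; rewrite mulf_eq0 (negbTE x0)/= => ->.
have b0 : pb.[z] != 0.
  apply/eqP => h; have := Dpol_neq0 z0 (pb_root_pd h).
  by move: E; rewrite NpolH h mulr0 => /esym/eqP; rewrite mulf_eq0 (negbTE x0)/= => ->.
split=> //; apply/eqP => h; move: E; rewrite DpolH h expr0n/= !mulr0 NpolH => /eqP.
by rewrite mulf_eq0 (negbTE a0) (negbTE b0).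
Qed.

(** The first equation of the system, [w = (z + z^n) / (z^n z + 1)], after
    cancellation of [cpoly]. *)
Definition wcoord z := z * pa.[z] / pb.[z].

Lemma wcoord_neq0 x z : x != 0 -> root (pencil x) z -> wcoord z != 0.
Proof.
move=> x0 /(pencil_rootP x0)[z0 a0 b0 _].
by rewrite mulf_neq0 ?invr_eq0// mulf_neq0.
Qed.

Lemma wcoord_eq1 x z : x != 0 -> root (pencil x) z ->
  (1 - z / wcoord z) * wcoord z = z ^+ n * (1 - z * wcoord z).
Proof.
move=> x0 rz; have [z0 a0 b0 _] := pencil_rootP x0 rz.
have w0 := wcoord_neq0 x0 rz.
rewrite mulrBl mul1r divfK// /wcoord; apply: (mulIf b0).
have -> : (z * pa.[z] / pb.[z] - z) * pb.[z] = z * (pa.[z] - pb.[z]) by field.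
have -> : z ^+ n * (1 - z * (z * pa.[z] / pb.[z])) * pb.[z] =
  z ^+ n * (pb.[z] - z ^+ 2 * pa.[z]) by field.
rewrite {1}pb_paH pb_pdH [in RHS]nE [in LHS]nE /= !exprS; ring.
Qed.

Lemma wcoord_eq2 x z : x != 0 -> root (pencil x) z ->
  (1 - z * wcoord z) * (1 - z / wcoord z) = x^-1 * z.
Proof.
move=> x0 rz; have [z0 a0 b0 d0] := pencil_rootP x0 rz.
have D0 := Dpol_neq0 z0 d0.
have ex : x = Npol.[z] / Dpol.[z].
  by move: rz; rewrite pencil_root => /eqP ->; rewrite mulfK.
have e1 : 1 - z * wcoord z = - pd.[z] / pb.[z].
  rewrite /wcoord; apply: (mulIf b0); rewrite divfK//.
  have -> : (1 - z * (z * pa.[z] / pb.[z])) * pb.[z] = pb.[z] - z ^+ 2 * pa.[z] by field.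
  by rewrite pb_pdH; ring.
have e2 : 1 - z / wcoord z = - (z ^+ n.-1 * pd.[z]) / pa.[z].
  rewrite /wcoord; apply: (mulIf a0); rewrite divfK//.
  have -> : (1 - z / (z * pa.[z] / pb.[z])) * pa.[z] = pa.[z] - pb.[z].
    by field; rewrite z0 a0 b0.
  by rewrite pb_paH; ring.
rewrite e1 e2 ex NpolH DpolH.
have -> : z ^+ n.-1 = z * z ^+ n.-2 by rewrite [in LHS]nE -exprS.
by field; rewrite a0 b0 d0/= expf_neq0.
Qed.

(** ** Roots at parameter zero *)

Lemma derivXn1 k : ('X^k + 1 : {poly C})^`() = 'X^(k.-1) *+ k.
Proof. by rewrite derivD derivXn -polyC1 derivC addr0. Qed.

Lemma pa_simple z : pa.[z] = 0 -> pa^`().[z] != 0.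
Proof.
move=> h; have := congr1 (fun p : {poly C} => p^`().[z]) paE.
rewrite /= derivM derivXn1 hornerD !hornerM h mul0r addr0 hornerMn hornerXn => E.
apply: contraTneq (pa_root_neq0 h) => h'; rewrite negbK.
move: E; rewrite h' mul0r => /esym/eqP; rewrite mulrn_eq0 expf_eq0.
by case/orP => [|/andP[]//]; rewrite [in X in X -> _]nE.
Qed.

Lemma pb_simple z : pb.[z] = 0 -> pb^`().[z] != 0.
Proof.
move=> h; have := congr1 (fun p : {poly C} => p^`().[z]) pbE.
rewrite /= derivM derivXn1 hornerD !hornerM h mul0r addr0 hornerMn hornerXn => E.
apply: contraTneq (pb_root_neq0 h) => h'; rewrite negbK.
move: E; rewrite h' mul0r => /esym/eqP; rewrite mulrn_eq0 expf_eq0.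
by case/orP => [//|/andP[]].
Qed.

Lemma Npol_simple : simple_roots (pencil 0).
Proof.
move=> z; rewrite pencil_root mul0r NpolH pencil_deriv mul0r subr0 => /eqP h.
rewrite /Npol derivM !hornerE.
move/eqP: h; rewrite mulf_eq0 => /orP[/eqP h|/eqP h].
  rewrite h mul0r addr0 mulf_neq0 ?pa_simple//.
  by rewrite (pa_root_pb h) oppr_eq0 pa_root_pd.
rewrite h mulr0 add0r mulf_neq0 ?pb_simple//.
by apply/eqP => /pa_root_pb; rewrite h => /esym/eqP; rewrite oppr_eq0 (negbTE (pb_root_pd h)).
Qed.

(** ** The product of the second coordinates *)

Lemma prod_pencil x y : \prod_(z <- rootseq (pencil x)) (y - z) = (pencil x).[y].
Proof.
have pm : pencil x \is monic by apply: pencil_monic; [exact: Npol_monic|exact: Dpol_size].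
by rewrite {2}(rootseqE pm) horner_prod; apply: eq_bigr => z _; rewrite hornerXsubC.
Qed.

Lemma size_roots_pencil x : size (rootseq (pencil x)) = (size Npol).-1.
Proof.
rewrite size_rootseq ?pencil_size//; first exact: Dpol_size.
by apply: pencil_monic; [exact: Npol_monic|exact: Dpol_size].
Qed.

Lemma prod_const (T : Type) (s : seq T) (a : C) : \prod_(z <- s) a = a ^+ size s.
Proof. by rewrite big_const_seq count_predT; elim: (size s) => //= k ->; rewrite exprS. Qed.

(** The resultant of [p] and the pencil, in two ways: the pencil reduces to
    [- x * Dpol] at the roots of [p]. *)
Lemma prod_horner_roots (p : {poly C}) : p \is monic -> p.[0] = 1 ->
  (forall z, p.[z] = 0 -> Dpol.[z] != 0) -> (forall z, p.[z] = 0 -> Npol.[z] = 0) ->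
  exists2 k : C, k != 0 & forall x,
    \prod_(z <- rootseq (pencil x)) p.[z] = k * x ^+ (size p).-1.
Proof.
move=> pm p0 pD pN.
exists ((-1) ^+ (size Npol).-1 ^+ (size p).-1 * (-1) ^+ (size p).-1 *
   \prod_(t <- rootseq p) Dpol.[t]).
  rewrite !mulf_neq0 ?expf_neq0 ?oppr_eq0 ?oner_eq0//.
  rewrite prodf_seq_neq0; apply/allP => t; rewrite mem_rootseq// => /eqP h.
  exact: pD.
move=> x; transitivity (\prod_(t <- rootseq p) \prod_(z <- rootseq (pencil x)) (z - t)).
  rewrite exchange_big; apply: eq_bigr => z _.
  by rewrite {1}(rootseqE pm) horner_prod; apply: eq_bigr => t _; rewrite hornerXsubC.
transitivity (\prod_(t <- rootseq p) ((-1) ^+ (size Npol).-1 * (- 1 * x * Dpol.[t]))).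
  rewrite big_seq [RHS]big_seq; apply: eq_bigr => t; rewrite mem_rootseq// => /eqP h.
  rewrite -(size_roots_pencil x) -prod_const.
  transitivity (\prod_(z <- rootseq (pencil x)) (-1 * (t - z))).
    by apply: eq_bigr => z _; ring.
  rewrite big_split/= prod_pencil pencil_horner pN//.
  by congr (_ * _); ring.
rewrite !big_split/= !prod_const size_rootseq//; ring.
Qed.

(** The product of the roots is constant, and the resultants with [pa] and [pb]
    are monomials in [x] whose degrees differ by 2. *)
Lemma prod_wcoord : exists2 k : C, k != 0 & forall x, x != 0 ->
  \prod_(z <- rootseq (pencil x)) wcoord z * x ^+ 2 = k.
Proof.
have Na z : pa.[z] = 0 -> Npol.[z] = 0 by rewrite NpolH => ->; rewrite mul0r.
have Nb z : pb.[z] = 0 -> Npol.[z] = 0 by rewrite NpolH => ->; rewrite mulr0.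
have Da z : pa.[z] = 0 -> Dpol.[z] != 0.
  by move=> h; exact: Dpol_neq0 (pa_root_neq0 h) (pa_root_pd h).
have Db z : pb.[z] = 0 -> Dpol.[z] != 0.
  by move=> h; exact: Dpol_neq0 (pb_root_neq0 h) (pb_root_pd h).
have [ka ka0 Ha] := prod_horner_roots pa_monic pa0 Da Na.
have [kb kb0 Hb] := prod_horner_roots pb_monic pb0 Db Nb.
exists ((-1) ^+ (size Npol).-1 * ka / kb).
  by rewrite mulf_neq0 ?invr_eq0// mulf_neq0// expf_neq0// oppr_eq0 oner_eq0.
move=> x x0; rewrite /wcoord !big_split/= prodfV Ha Hb.
have -> : \prod_(z <- rootseq (pencil x)) z = (-1) ^+ (size Npol).-1.
  transitivity (\prod_(z <- rootseq (pencil x)) (-1 * (0 - z))).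
    by apply: eq_bigr => z _; ring.
  rewrite big_split/= prod_pencil prod_const size_roots_pencil pencil_horner.
  by rewrite Dpol0 mulr0 subr0 NpolH pa0 pb0 !mulr1.
have -> : (size pb).-1 = ((size pa).-1 + 2)%N.
  have := size_pa; have := size_pb; have := size_cpoly; have := n3.
  by move: (size pa) (size pb) (size cpoly) => ? ? ?; lia.
rewrite exprD; move: (x ^+ _) (expf_neq0 (size pa).-1 x0) ((-1) ^+ _) => X X0 e.
by field; rewrite ?kb0 ?x0 ?X0.
Qed.

(** Only finitely many members of the pencil have a multiple root: such a root
    is a critical point of the quotient [Npol / Dpol]. *)
Lemma pencil_generic : exists s : seq C, forall x, x \notin s -> simple_roots (pencil x).
Proof.
pose K := Dpol^`() * Npol - Dpol * Npol^`().
have K0 : K != 0.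
  (* the coefficient of degree [n - 3] is [n - 2] *)
  apply/eqP => h; have := congr1 (fun p : {poly C} => p`_(n.-2.-1)) h.
  rewrite coef0 /=; set m := n.-2.-1.
  have hm : n.-2 = m.+1 by rewrite /m; case: n n3 => [|[|[]]].
  have eD : Dpol = 'X^m * ('X * pd ^+ 2) by rewrite /Dpol hm exprS; ring.
  have dD : Dpol^`() = 'X^m * (pd ^+ 2 *+ m.+1 + 'X * (pd ^+ 2)^`()).
    by rewrite /Dpol hm derivM derivXn /= (exprSr 'X m) mulrDr mulrnAl mulrnAr mulrA.
  rewrite /K dD eD coefB -!mulrA.
  rewrite !coefXnM !ltnn !subnn -!horner_coef0 !hornerM hornerD hornerM hornerMn hornerX.
  rewrite !mul0r addr0 subr0 pa0 pb0 !mulr1.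
  move/eqP; rewrite mulrn_eq0 /= ?horner_exp expf_eq0/=.
  have := pdH 0; rewrite cpoly0 mulr1 expr0n/= sub0r => ->.
  by rewrite oppr_eq0 oner_eq0.
pose K1 := (lead_coef K)^-1 *: K.
have K1m : K1 \is monic by rewrite monicE lead_coefZ mulVf// lead_coef_eq0.
(* the critical values of [Npol / Dpol]; at 0 the roots may be degenerate *)
exists (0 :: [seq Npol.[z] / Dpol.[z] | z <- rootseq K1]) => x.
rewrite inE negb_or => /andP[x0 xs] z rz; apply: contra xs => /eqP h.
have [z0 _ _ d0] := pencil_rootP x0 rz; have D0 := Dpol_neq0 z0 d0.
move: rz; rewrite pencil_root => /eqP E.
apply/mapP; exists z; last by rewrite E mulfK.
rewrite mem_rootseq// /root hornerZ mulf_eq0; apply/orP; right.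
move: h; rewrite pencil_deriv => /eqP; rewrite subr_eq0 => /eqP h.
by rewrite /K hornerD hornerN (hornerM Dpol^`()) (hornerM Dpol) E h; apply/eqP; ring.
Qed.

End Family.

(** * Constancy of the energy *)

Section Constancy.
Variable R : realType.
Local Notation C := R[i].
Implicit Types (x y z w u v : C).

Lemma cderiv_prod (T : eqType) (r : seq T) (f : T -> C -> C) (l : T -> C) x :
  (forall c : T, c \in r -> cderiv (f c) x (f c x * l c)) ->
  cderiv (fun y => \prod_(z <- r) f z y) x (\prod_(z <- r) f z x * \sum_(z <- r) l z).
Proof.
elim: r => [|a r IH] H.
  apply: (@cderiv_near _ _ (fun=> 1)); first by apply: nearW => y; rewrite big_nil.
  by rewrite !big_nil mulr0; exact: cderiv_cst.
apply: (@cderiv_near _ _ (fun y => f a y * \prod_(z <- r) f z y)).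
  by apply: nearW => y; rewrite big_cons.
have Ha := H a; rewrite inE eqxx in Ha.
have Hr : cderiv (fun y => \prod_(z <- r) f z y) x (\prod_(z <- r) f z x * \sum_(z <- r) l z).
  by apply: IH => c cr; apply: H; rewrite inE cr orbT.
by apply: (cderiv_eq (cderivM (Ha isT) Hr)); rewrite !big_cons; ring.
Qed.

(** A branch of the logarithm of [f], continued from the principal value at
    the base point. *)
Definition loglift (f : C -> C) x0 y := Log (f x0) + Log (f y / f x0).

Lemma cderiv_loglift f x0 l : cderiv f x0 l -> f x0 != 0 ->
  cderiv (loglift f x0) x0 (l / f x0).
Proof.
move=> Df f0.
have D : cderiv (fun y => f y / f x0) x0 (l / f x0).
  by apply: (cderiv_eq (cderivM Df (cderiv_cst (f x0)^-1 x0))); rewrite mulr0 addr0.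
have e1 : f x0 / f x0 = 1 by rewrite divff.
have s : slit (f x0 / f x0) by rewrite e1 slit_real.
apply: (cderiv_eq (cderivD (cderiv_cst (Log (f x0)) x0) (cderiv_comp D (cderiv_Log s)))).
by rewrite e1 invr1 mul1r add0r.
Qed.

Lemma cexp_loglift f x0 y : f x0 != 0 -> f y != 0 -> cexp (loglift f x0 y) = f y.
Proof.
move=> f0 fy; rewrite /loglift cexpD !cexp_Log ?mulf_neq0 ?invr_eq0//.
by rewrite mulrC divfK.
Qed.

Lemma loglift_base f x0 : f x0 != 0 -> loglift f x0 x0 = Log (f x0).
Proof. by move=> f0; rewrite /loglift divff// Log1 addr0. Qed.

Variable n : nat.
Hypothesis n3 : (2 < n)%N.

Local Notation kappa := (@kappa R).
Local Notation pencil := (pencil (Npol R n) (Dpol R n)).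
Local Notation wcoord := (@wcoord R n).

Definition critval x z := crit n (Log z) (Log (wcoord z)) (- Log x).

(** The last factor compensates the variation of the product of the critical
    values, computed in [cderiv_energy]. *)
Definition energy x :=
  \prod_(z <- rootseq (pencil x)) critval x z * cexp (- (kappa * Log x ^+ 2)).

Let Nm := @Npol_monic R n n3.
Let DN := @Dpol_size R n n3.
Let N1 := @Npol_size1 R n n3.

Lemma pencilm x : pencil x \is monic.
Proof. exact: pencil_monic. Qed.

(** The equations of the solutions, in the form that [crit_shift] and
    [cderiv_crit] require. *)
Lemma logs_eq1 x z u v : x != 0 -> root (pencil x) z -> cexp u = z ->
  cexp v = wcoord z ->
  (1 - cexp (u - v)) * cexp v = cexp (n%:~R * u) * (1 - cexp (u + v)).
Proof.
move=> x0 rz eu ev; rewrite cexpB cexpD eu ev cexpMz eu.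
exact: (wcoord_eq1 n3 x0 rz).
Qed.

Lemma logs_eq2 x z u v nu : x != 0 -> root (pencil x) z -> cexp u = z ->
  cexp v = wcoord z -> cexp nu = x^-1 ->
  (1 - cexp (u + v)) * (1 - cexp (u - v)) = cexp nu * cexp u.
Proof.
move=> x0 rz eu ev en; rewrite cexpB cexpD eu ev en.
exact: (wcoord_eq2 n3 x0 rz).
Qed.

(** [crit_shift] for the solutions of the deformed system. *)
Lemma critval_logs x z u v nu : x != 0 -> root (pencil x) z -> cexp u = z ->
  cexp v = wcoord z -> cexp nu = x^-1 -> crit n u v nu = crit n (Log z) (Log (wcoord z)) nu.
Proof.
move=> x0 rz eu ev en; have [z0 _ _ _] := pencil_rootP n3 x0 rz.
have w0 := wcoord_neq0 n3 x0 rz.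
have [k ek] : exists k : int, u = Log z + k%:~R * twopii R.
  by apply: cexp_inj_mod; rewrite cexp_Log.
have [l el] : exists l : int, v = Log (wcoord z) + l%:~R * twopii R.
  by apply: cexp_inj_mod; rewrite cexp_Log.
have eu' := cexp_Log z0; have ev' := cexp_Log w0.
have E1 := logs_eq1 x0 rz eu' ev'; have E2 := logs_eq2 x0 rz eu' ev' en.
have : (1 - cexp (Log z + Log (wcoord z))) * (1 - cexp (Log z - Log (wcoord z))) != 0.
  by rewrite E2 mulf_neq0 ?cexp_neq0.
rewrite mulf_eq0 negb_or !subr_eq0 ![1 == _]eq_sym => /andP[h1 h2].
by rewrite ek el crit_shift.
Qed.

Lemma cexp_NLog x : x != 0 -> cexp (- Log x) = x^-1.
Proof. by move=> x0; rewrite cexpN cexp_Log. Qed.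

Lemma cderiv_wcoord z : (pb R n).[z] != 0 -> exists l, cderiv wcoord z l.
Proof.
move=> b0; eexists; apply: cderiv_div b0; last exact: cderiv_poly.
exact: (cderivM (cderiv_id z) (cderiv_poly _ z)).
Qed.

(** By [cderiv_crit] the sum of the logarithmic derivatives of the critical values
    is a multiple of that of the product of the second coordinates, which is known
    from [prod_wcoord]. *)
Lemma cderiv_energy x0 : slit x0 -> simple_roots (pencil x0) -> cderiv energy x0 0.
Proof.
move=> sx S; have x00 := slit_neq0 sx.
have [zeta [Dz Z0 P]] := local_roots Nm DN N1 S.
set r0 := rootseq (pencil x0) in Dz Z0 P.
have r0P z : z \in r0 -> root (pencil x0) z by rewrite /r0 mem_rootseq// pencilm.
have N0 := cnbhs_neq0 x00.
pose om z x := wcoord (zeta z x).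
have Dom z : z \in r0 -> exists l, cderiv (om z) x0 l.
  move=> zr; have [_ _ b0 _] := pencil_rootP n3 x00 (r0P z zr).
  have [l Hl] := Dz z zr; have [m Hm] := cderiv_wcoord b0.
  by exists (m * l); apply: (cderiv_comp Hl); rewrite Z0.
have om0 z : z \in r0 -> om z x0 != 0.
  by move=> zr; rewrite /om Z0//; exact: (wcoord_neq0 n3 x00 (r0P z zr)).
have /choice[om' Hom'] : forall z, exists l, z \in r0 -> cderiv (om z) x0 l.
  by move=> z; case: (boolP (z \in r0)) => [/Dom[l Hl]|_]; [exists l|exists 0].
pose u z x := loglift (zeta z) x0 x; pose v z x := loglift (om z) x0 x.
pose nu x := - Log x.
have Dnu : cderiv nu x0 (- x0^-1) := cderivN (cderiv_Log sx).
have Rall : \forall x \near cnbhs x0, forall z, z \in r0 -> root (pencil x) (zeta z x).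
  apply: filterS P => x Px z zr; rewrite -mem_rootseq ?pencilm// (perm_mem Px).
  exact: map_f.
have z00 z : z \in r0 -> zeta z x0 != 0.
  by move=> zr; rewrite Z0//; have [] := pencil_rootP n3 x00 (r0P z zr).
have eu x z : x != 0 -> z \in r0 -> root (pencil x) (zeta z x) -> cexp (u z x) = zeta z x.
  by move=> hx zr rz; rewrite cexp_loglift ?z00//; have [] := pencil_rootP n3 hx rz.
have ev x z : x != 0 -> z \in r0 -> root (pencil x) (zeta z x) -> cexp (v z x) = om z x.
  by move=> hx zr rz; rewrite cexp_loglift ?om0//; exact: (wcoord_neq0 n3 hx rz).
pose f z x := crit n (u z x) (v z x) (nu x).
have Df z : z \in r0 -> cderiv (f z) x0 (f z x0 * (kappa * (om' z / om z x0 * nu x0))).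
  move=> zr; have [l Hl] := Dz z zr.
  apply: (cderiv_crit (cderiv_loglift Hl (z00 z zr)) (cderiv_loglift (Hom' z zr) (om0 z zr)) Dnu).
    near=> x.
    have hx : x != 0 by near: x.
    have rz : root (pencil x) (zeta z x) by near: x; apply: filterS Rall => x; exact.
    exact: (logs_eq1 hx rz (eu _ _ hx zr rz) (ev _ _ hx zr rz)).
  near=> x.
  have hx : x != 0 by near: x.
  have rz : root (pencil x) (zeta z x) by near: x; apply: filterS Rall => x; exact.
  exact: (logs_eq2 hx rz (eu _ _ hx zr rz) (ev _ _ hx zr rz) (cexp_NLog hx)).
have E : \forall x \near cnbhs x0, energy x =
    \prod_(z <- r0) f z x * cexp (- (kappa * Log x ^+ 2)).
  near=> x.
  have hx : x != 0 by near: x.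
  have Rx : forall z, z \in r0 -> root (pencil x) (zeta z x) by near: x.
  have Px : perm_eq (rootseq (pencil x)) [seq zeta z x | z <- r0] by near: x.
  rewrite /energy (perm_big _ Px)/= big_map; congr (_ * _).
  rewrite big_seq [RHS]big_seq; apply: eq_bigr => z zr; have rz := Rx z zr.
  by rewrite /critval -(critval_logs hx rz (eu _ _ hx zr rz) (ev _ _ hx zr rz) (cexp_NLog hx)).
have [k k0 Hk] := @prod_wcoord R n n3.
(* the sum of the logarithmic derivatives of the second coordinates *)
have W : \forall x \near cnbhs x0, \prod_(z <- r0) om z x * x ^+ 2 = k.
  near=> x.
  have hx : x != 0 by near: x.
  have Px : perm_eq (rootseq (pencil x)) [seq zeta z x | z <- r0] by near: x.
  by rewrite -(Hk x hx) (perm_big _ Px)/= big_map.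
have DW : cderiv (fun x => \prod_(z <- r0) om z x * x ^+ 2) x0
    (\prod_(z <- r0) om z x0 * (\sum_(z <- r0) om' z / om z x0) * x0 ^+ 2 +
     \prod_(z <- r0) om z x0 * (2%:R * x0 ^+ 1 * 1)).
  apply: cderivM (cderivX 2 (cderiv_id x0)); apply: cderiv_prod => z zr.
  by apply: (cderiv_eq (Hom' z zr)); rewrite mulrC divfK// om0.
have := cderiv_uniq (cderiv_near W (cderiv_cst k x0)) DW => /esym.
set pr := \prod_(z <- r0) om z x0; set S1 := \sum_(z <- r0) _ => HS.
have pr0 : pr != 0.
  by rewrite /pr prodf_seq_neq0; apply/allP => z zr; exact: om0.
have {}HS : S1 = - 2 / x0.
  apply: (mulfI pr0); apply: (mulIf (expf_neq0 2 x00)).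
  move/eqP: HS; rewrite addr_eq0 => /eqP ->.
  by rewrite expr1; field.
have Dprod := cderiv_prod Df.
have DL := cderiv_comp (cderivN (cderivZ kappa (cderivX 2 (cderiv_Log sx)))) (cderiv_cexp _).
apply: (cderiv_near E); apply: (cderiv_eq (cderivM Dprod DL)).
have -> : \sum_(z <- r0) kappa * (om' z / om z x0 * nu x0) = kappa * nu x0 * S1.
  by rewrite /S1 mulr_sumr; apply: eq_bigr => z _; ring.
by rewrite HS /nu /= expr1; field.
Unshelve. all: by end_near. Qed.

(** A family of paths from 0 to 1 in the right half plane. Two of them meet only
    at the ends, so that a finite set can be avoided by the choice of [eta]. *)
Definition detour (eta : R) (y : C) : C := y + eta%:C * 'i * (y * (1 - y)).

Lemma Re_detour eta (s : R) : Re (detour eta (s%:C)) = s.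
Proof. by rewrite /detour !ReIm/=; ring. Qed.

Lemma Im_detour eta (s : R) : Im (detour eta (s%:C)) = eta * (s * (1 - s)).
Proof. by rewrite /detour !ReIm/=; ring. Qed.

Lemma detour1 eta : detour eta 1 = 1.
Proof. by rewrite /detour subrr !mulr0 addr0. Qed.

Lemma fresh_real (s : seq R) : exists t, t \notin s.
Proof.
exists (1 + \sum_(t <- s) `|t|); apply/negP => h.
have : 1 + \sum_(t <- s) `|t| <= \sum_(t <- s) `|t|.
  rewrite (le_trans (ler_norm _))// [leRHS](big_rem _ h)/= lerDl.
  by rewrite sumr_ge0.
by rewrite gerDr ler10.
Qed.

Lemma energy_detour : simple_roots (pencil 1) -> exists eta : R, forall s : R, 0 < s <= 1 ->
  energy (detour eta (s%:C)) = energy 1.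
Proof.
move=> simple1; have [bad Hbad] := @pencil_generic R n n3.
(* an exceptional parameter [b] lies on the path of at most one [eta] *)
have [eta He] := fresh_real [seq Im b / (Re b * (1 - Re b)) | b <- bad].
exists eta => s /andP[s0 s1].
have -> : energy 1 = energy (detour eta (1%:C)) by rewrite detour1.
apply: (cderiv0_cst (f := fun y => energy (detour eta y))) => // t /andP[st t1].
have t0 : 0 < t := lt_le_trans s0 st.
have D : exists l, cderiv (detour eta) (t%:C) l.
  eexists; apply: cderivD (cderiv_id _) _; apply: cderivZ.
  exact: (cderivM (cderiv_id _) (cderivB (cderiv_cst 1 _) (cderiv_id _))).
have [l Hl] := D.
apply: (cderiv_eq (cderiv_comp Hl (cderiv_energy _ _))); last by rewrite mul0r.
  by rewrite /slit Re_detour negb_and -!ltNge t0 orbT.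
have [->|tn1] := eqVneq t 1; first by rewrite detour1.
apply: Hbad; apply: contra He => hb; apply/mapP; exists (detour eta (t%:C)) => //.
rewrite Re_detour Im_detour mulfK// mulf_neq0 ?gt_eqF//.
by rewrite subr_gt0 lt_neqAle tn1.
Qed.

End Constancy.

(** * The limit at parameter zero *)

Section Limit.
Variable R : realType.
Local Notation C := R[i].
Implicit Types (x y z w u v l m : C) (f g : C -> C).

Local Notation kappa := (@kappa R).
Local Notation twopii := (@twopii R).

(** Limits at 0 inside the slit plane, where the logarithm of the parameter is
    differentiable. *)
Definition ctends f l := forall e : R, 0 < e ->
  \forall x \near cnbhs (0 : C), slit x -> nm (f x - l) < e.

Lemma ctends_near f g l : (\forall x \near cnbhs (0 : C), slit x -> f x = g x) ->
  ctends g l -> ctends f l.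
Proof. by move=> E H e /H; apply: filterS2 E => x E h s; rewrite E// h. Qed.

Lemma ctends_cderiv f l : cderiv f 0 l -> ctends f (f 0).
Proof.
move=> Df e e0.
have B : \forall w \near cnbhs (f 0), nm (w - f 0) < e by exact: cnbhs_ball.
by apply: filterS (cderiv_cont Df B).
Qed.

Lemma ctends_comp f g l m : ctends f l -> cderiv g l m -> ctends (fun x => g (f x)) (g l).
Proof.
move=> Hf Dg e e0.
have B : \forall w \near cnbhs (g l), nm (w - g l) < e by exact: cnbhs_ball.
have [d d0 Hd] := cderiv_cont Dg B.
by apply: filterS (Hf d d0) => x h s; apply: Hd; exact: h.
Qed.

Lemma ctendsM f g l m : ctends f l -> ctends g m -> ctends (fun x => f x * g x) (l * m).
Proof.
move=> Hf Hg e e0.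
pose M := 1 + nm l + nm m; have M0 : 0 < M by rewrite /M -addrA ltr_pwDl// addr_ge0 ?nm_ge0.
pose d := Num.min 1 (e / M); have d0 : 0 < d by rewrite lt_min ltr01 divr_gt0.
apply: filterS2 (Hf d d0) (Hg d d0) => x h1 h2 s; move: (h1 s) (h2 s) => {h1 h2}.
set a := f x - l; set b := g x - m => ha hb.
have -> : f x * g x - l * m = a * b + a * m + l * b by rewrite /a /b; ring.
have := nmD (a * b + a * m) (l * b); have := nmD (a * b) (a * m); rewrite !nmM => q1 q2.
have d1 : d <= 1 by rewrite /d ge_min lexx.
have dM : d * M <= e by rewrite -ler_pdivlMr// /d ge_min lexx orbT.
have a0 := nm_ge0 a; have b0 := nm_ge0 b; have l0 := nm_ge0 l; have m0 := nm_ge0 m.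
have p1 : nm a * nm b <= nm a by rewrite ler_piMr// ltW// (lt_le_trans hb).
have p2 : nm a * nm m <= d * nm m by rewrite ler_wpM2r// ltW.
have p3 : nm l * nm b <= nm l * d by rewrite ler_wpM2l// ltW.
have : d * M = d + d * nm m + nm l * d by rewrite /M; ring.
by lra.
Qed.

Lemma ctends_prod (T : eqType) (r : seq T) (f : T -> C -> C) (l : T -> C) :
  (forall c : T, c \in r -> ctends (f c) (l c)) ->
  ctends (fun x => \prod_(c <- r) f c x) (\prod_(c <- r) l c).
Proof.
elim: r => [|a r IH] H.
  move=> e e0; apply: nearW => x _.
  by rewrite !big_nil subrr nm0.
apply: (@ctends_near _ (fun x => f a x * \prod_(c <- r) f c x)).
  by apply: nearW => x _; rewrite big_cons.
rewrite big_cons; apply: ctendsM; first by apply: H; rewrite inE eqxx.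
by apply: IH => c cr; apply: H; rewrite inE cr orbT.
Qed.

Lemma ctendsV f l : ctends f l -> l != 0 -> ctends (fun x => (f x)^-1) l^-1.
Proof. by move=> Hf l0; exact: (ctends_comp Hf (cderiv_inv l0)). Qed.

(** Since [x * Log x] tends to 0, the exponentiated dilogarithm tends to 1 along
    any function asymptotic to the logarithm. *)
Lemma ctends_rogers f l : cderiv f 0 l -> ctends (fun x => rogers (Log x + f x)) 1.
Proof.
move=> Df e e0.
have [K K0 [d d0 Hd]] := rogers_near0 R.
have [L L0 HL] := cderiv_lip Df.
have [L' L'0 HL'] := cderiv_lip (cderiv_comp Df (cderiv_cexp (f 0))).
pose A := nm (cexp (f 0)) + 1 + (nm (f 0) + 1).
pose B := A * (8 + A).
have A0 : 0 < A by rewrite /A addr_gt0// ltr_wpDl// nm_ge0.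
have B0 : 0 < B by rewrite mulr_gt0// addr_gt0.
pose t := Num.min (d / B) (e / (K * B)).
have t0 : 0 < t by rewrite lt_min !divr_gt0// mulr_gt0.
have t1 : t <= d / B by rewrite /t ge_min lexx.
have t2 : t <= e / (K * B) by rewrite /t ge_min lexx orbT.
have tB : t * B <= d by rewrite -(ler_pdivlMr _ _ B0).
have tK : t * (K * B) <= e by rewrite -(ler_pdivlMr _ _ (mulr_gt0 K0 B0)).
have N1 := @cnbhs_ball R 0 (t ^+ 2) (exprn_gt0 2 t0).
have N2 := @cnbhs_ball R 0 1 ltr01.
have N3 : \forall x \near cnbhs (0 : C), nm (x - 0) < 1 / L by apply: cnbhs_ball; rewrite divr_gt0.
have N4 : \forall x \near cnbhs (0 : C), nm (x - 0) < 1 / L' by apply: cnbhs_ball; rewrite divr_gt0.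
near=> x => sx.
have x1 : nm (x - 0) < t ^+ 2 by near: x.
have x2 : nm (x - 0) < 1 by near: x.
have x3 : nm (x - 0) < 1 / L by near: x.
have x4 : nm (x - 0) < 1 / L' by near: x.
have h1 : nm (f x - f 0) <= L * nm (x - 0) by near: x.
have h2 : nm (cexp (f x) - cexp (f 0)) <= L' * nm (x - 0) by near: x.
rewrite subr0 in x1 x2 x3 x4 h1 h2.
have x0 : x != 0 := slit_neq0 sx.
have b1 : nm (f x) <= A.
  have := nmD (f x - f 0) (f 0); rewrite subrK => q.
  move: x3; rewrite ltr_pdivlMr// mulrC => x3; have := nm_ge0 (cexp (f 0)); rewrite /A; lra.
have b2 : nm (cexp (f x)) <= A.
  have := nmD (cexp (f x) - cexp (f 0)) (cexp (f 0)); rewrite subrK => q.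
  move: x4; rewrite ltr_pdivlMr// mulrC => x4; have := nm_ge0 (f 0); rewrite /A; lra.
have r1 : nm x <= Num.sqrt (nm x) by rewrite sqrt_ge_small// nm_ge0 ltW.
have r2 := small_Log x0 (ltW x2).
have xx := nm_ge0 x; have s0 := sqrtr_ge0 (nm x).
have st : Num.sqrt (nm x) < t.
  by rewrite -(gtr0_norm t0) -sqrtr_sqr ltr_sqrt// exprn_gt0.
have M : nm (cexp (Log x + f x)) * (1 + nm (Log x + f x)) <= B * Num.sqrt (nm x).
  rewrite cexpD cexp_Log// nmM.
  have q := nmD (Log x) (f x).
  apply: (@le_trans _ _ (nm x * A * (1 + (nm (Log x) + A)))).
    apply: ler_pM; rewrite ?mulr_ge0 ?addr_ge0 ?nm_ge0//; first by rewrite ler_wpM2l.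
    by rewrite lerD2l (le_trans q)// lerD2l.
  have -> : nm x * A * (1 + (nm (Log x) + A)) =
    A * (nm x * (1 + A) + nm x * nm (Log x)) by ring.
  rewrite /B -mulrA ler_pM2l//.
  have : nm x * (1 + A) <= Num.sqrt (nm x) * (1 + A) by rewrite ler_wpM2r// addr_ge0// ltW.
  by lra.
have M2 : B * Num.sqrt (nm x) < B * t by rewrite ltr_pM2l.
have M3 : nm (cexp (Log x + f x)) * (1 + nm (Log x + f x)) < d by lra.
apply: le_lt_trans (Hd _ M3) _.
apply: le_lt_trans (ler_wpM2l (ltW K0) M) _.
have : K * (B * Num.sqrt (nm x)) < K * (B * t) by rewrite ltr_pM2l.
by lra.
Unshelve. all: by end_near. Qed.

(** The logarithms of [- x] and [- 1 / x] bring in squares of [pi i]. *)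
Lemma cexp_halfperiod : cexp (kappa * ((pi%:C * 'i) ^+ 2 / 2)) = 1.
Proof.
have -> : kappa * ((pi%:C * 'i) ^+ 2 / 2) = (-3)%:~R * twopii.
  rewrite -[(-3)%:~R]/(- 3 : C).
  have -> : pi%:C * 'i = twopii / 2 by rewrite /twopii; move: (pi%:C) => P; field.
  have -> : kappa * ((twopii / 2) ^+ 2 / 2) = (kappa * twopii) * twopii / 8 by field.
  by rewrite kappa_twopii; field.
exact: cexp_twopiiz.
Qed.

Variable n : nat.
Hypothesis n3 : (2 < n)%N.

Local Notation pencil := (pencil (Npol R n) (Dpol R n)).
Local Notation critval := (@critval R n).

Let eqn1 : (n.+1 = n.-2 + 3)%N. Proof. by have := n3; lia. Qed.
Let eqn2 : n.-1 = n.-2.+1. Proof. by have := n3; lia. Qed.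

Section OneRoot.
Variables (z : C) (zeta : C -> C) (zeta' : C).
Hypothesis Dz : cderiv zeta 0 zeta'.
Hypothesis zeta0 : zeta 0 = z.
Hypothesis zetaP : \forall x \near cnbhs (0 : C), root (pencil x) (zeta x).
Hypothesis z0 : z != 0.

Let u := loglift zeta 0.

Lemma cexp_u x : x != 0 -> root (pencil x) (zeta x) -> cexp (u x) = zeta x.
Proof.
move=> x0 rz; rewrite cexp_loglift ?zeta0//.
by have [] := pencil_rootP n3 x0 rz.
Qed.

Lemma cderiv_u : cderiv u 0 (zeta' / z).
Proof. by rewrite -zeta0; apply: cderiv_loglift; rewrite ?zeta0. Qed.

Lemma u0 : u 0 = Log z.
Proof. by rewrite /u loglift_base zeta0. Qed.

Lemma cderiv_zeta_poly (p : {poly C}) : exists l, cderiv (fun x => p.[zeta x]) 0 l.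
Proof.
by eexists; apply: (cderiv_comp Dz); exact: cderiv_poly.
Qed.

(** Near a root of [pa] the second coordinate [w] is equivalent to [- x], so its
    logarithm is [Log x + pi i] up to a function that tends to 0. The argument
    [u - v] of the second factor tends to infinity and is inverted first. *)
Lemma ctends_pa : (pa R n).[z] = 0 ->
  ctends (fun x => critval x (zeta x) * cexp (kappa * (Log x ^+ 2 / 2)))
         (cexp (- (kappa * (n.-1%:R / 2 * Log z ^+ 2)))).
Proof.
move=> ha; have hb := pa_root_pb n3 ha; have hd := pa_root_pd n3 ha.
have b0 : (pb R n).[z] != 0 by rewrite hb oppr_eq0.
pose q x := - (zeta x * (Dpol R n).[zeta x] / (pb R n).[zeta x] ^+ 2).
have q0 : q 0 = 1.
  rewrite /q zeta0 hb DpolH sqrrN.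
  rewrite (_ : z * _ = z ^+ n.-1 * (pd R n).[z] ^+ 2).
    by rewrite (pa_root n3 ha) mulfK ?expf_neq0// opprK.
  have -> : z ^+ n.-1 = z * z ^+ n.-2 by rewrite -exprS -eqn2.
  by rewrite mulrA.
have [l Dq] : exists l, cderiv q 0 l.
  have [l1 D1] := cderiv_zeta_poly (Dpol R n); have [l2 D2] := cderiv_zeta_poly (pb R n).
  have b2 : (pb R n).[zeta 0] ^+ 2 != 0 by rewrite zeta0 expf_neq0.
  by eexists; exact: (cderivN (cderiv_div (cderivM Dz D1) (cderivX 2 D2) b2)).
have sq : slit (q 0) by rewrite q0 slit_real.
pose g x := pi%:C * 'i + Log (q x).
have Dg := cderivD (cderiv_cst (pi%:C * 'i) 0) (cderiv_comp Dq (cderiv_Log sq)).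
have g0 : g 0 = pi%:C * 'i by rewrite /g q0 Log1 addr0.
have H1 := ctends_rogers (cderivD cderiv_u Dg).
have H2 := ctends_rogers (cderivB Dg cderiv_u).
pose F x := cexp (kappa * (- (n.-1%:R / 2 * u x ^+ 2) + g x ^+ 2 / 2)).
have F0 : F 0 = cexp (- (kappa * (n.-1%:R / 2 * Log z ^+ 2))).
  rewrite /F u0 g0 mulrDr cexpD cexp_halfperiod mulr1; congr cexp; ring.
have HF : ctends F (F 0).
  apply: (ctends_cderiv (l := F 0 * (kappa * (- (n.-1%:R / 2 * (2%:R * u 0 ^+ 1 * (zeta' / z)))
     + ((2%:R * g 0 ^+ 1 * (0 + (q 0)^-1 * l)) * 2^-1 + g 0 ^+ 2 * 0))))).
  apply: cderiv_cexpK; apply: cderivD.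
    by apply: cderivN; apply: cderivZ; apply: cderivX; exact: cderiv_u.
  by apply: cderivM; [apply: cderivX|exact: cderiv_cst].
have one0 : (1 : C) != 0 := oner_neq0 _.
have := ctendsM (ctendsM (ctendsV H1 one0) (ctendsV H2 one0)) HF.
rewrite invr1 !mul1r F0; apply: ctends_near.
have Nq : \forall x \near cnbhs (0 : C), q x != 0.
  have h : q 0 != 0 by rewrite q0 oner_neq0.
  exact: (cderiv_cont Dq (cnbhs_neq0 h)).
near=> x => sx; have x0 := slit_neq0 sx.
have rz : root (pencil x) (zeta x) by near: x.
have qx : q x != 0 by near: x.
have [zx0 ax0 bx0 dx0] := pencil_rootP n3 x0 rz.
pose v := Log x + g x.
have eu := cexp_u x0 rz.
have ev : cexp v = wcoord n (zeta x).
  rewrite /v /g !cexpD !cexp_Log// cexp_ipi /q /wcoord.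
  move: rz; rewrite pencil_root NpolH => /eqP E.
  transitivity (zeta x * (x * (Dpol R n).[zeta x]) / (pb R n).[zeta x] ^+ 2); first by field.
  by rewrite -E; field.
rewrite /critval -(critval_logs n3 x0 rz eu ev (cexp_NLog x0)) /crit.
have y1 : cexp (u x - v) != 1.
  have := logs_eq2 n3 x0 rz eu ev (cexp_NLog x0) => E.
  apply/eqP => h; move: E; rewrite h subrr mulr0 => /esym/eqP.
  by rewrite mulf_eq0 !(negbTE (cexp_neq0 _)).
have := rogers_inversion y1 => I.
have r1 := rogers_neq0 (u x + v); have r2 := rogers_neq0 (u x - v).
have r3 := rogers_neq0 (- (u x - v)).
have -> : rogers (u x - v) = cexp (kappa * ((u x - v) ^+ 2 / 2)) / rogers (- (u x - v)).
  by rewrite -I mulfK.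
have -> : Log x + (u x + (pi%:C * 'i + Log (q x))) = u x + v by rewrite /v /g; ring.
have -> : Log x + (pi%:C * 'i + Log (q x) - u x) = - (u x - v) by rewrite /v /g; ring.
rewrite /F; set A := rogers (u x + v) in r1 *; set B := rogers _ in r3 *.
transitivity (A^-1 * B^-1 * (cexp (kappa * ((u x - v) ^+ 2 / 2)) *
  cexp (kappa * (- (n%:~R / 2 * u x ^+ 2) + u x * v + v * - Log x)) *
  cexp (kappa * (Log x ^+ 2 / 2)))); first by ring.
rewrite -!cexpD; congr (_ * cexp _); rewrite /v.
have -> : n%:~R = n.-1%:R + 1 :> C by rewrite -pmulrn natr1 prednK// (ltn_trans _ n3).
move: (n.-1%:R : C) (u x) (g x) (Log x) => k p r t.
by field.
Unshelve. all: by end_near. Qed.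

(** Near a root of [pb] the second coordinate [w] is equivalent to [- 1 / x]; now
    [u + v] has to be inverted. *)
Lemma ctends_pb : (pb R n).[z] = 0 ->
  ctends (fun x => critval x (zeta x) * cexp (- (kappa * (Log x ^+ 2 / 2))))
         (cexp (- (kappa * (n.+1%:R / 2 * Log z ^+ 2)))).
Proof.
move=> hb; have hd := pb_root_pd n3 hb.
have D0 : (Dpol R n).[z] != 0 by exact: (Dpol_neq0 z0 hd).
pose q x := - (zeta x * (pa R n).[zeta x] ^+ 2 / (Dpol R n).[zeta x]).
have q0 : q 0 = 1.
  have E : z ^+ 2 * (pa R n).[z] = (pd R n).[z].
    by have /esym/eqP := pb_pdH n3 z; rewrite hb subr_eq0 => /eqP.
  have a0 : (pa R n).[z] != 0 by apply: contraNneq hd => h; rewrite -E h mulr0.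
  have E2 := pb_root hb.
  have E3 : z * (pa R n).[z] ^+ 2 = - (z ^+ n.+1) * (z * (pa R n).[z] ^+ 2).
    by rewrite E2 opprK mul1r.
  rewrite /q zeta0 E3 DpolH -E.
  have -> : z ^+ n.+1 = z ^+ n.-2 * z ^+ 3 by rewrite -exprD; congr (_ ^+ _); exact: eqn1.
  by field; rewrite a0 z0/= expf_neq0.
have [l Dq] : exists l, cderiv q 0 l.
  have [l1 D1] := cderiv_zeta_poly (Dpol R n); have [l2 D2] := cderiv_zeta_poly (pa R n).
  have D0' : (Dpol R n).[zeta 0] != 0 by rewrite zeta0.
  by eexists; exact: (cderivN (cderiv_div (cderivM Dz (cderivX 2 D2)) D1 D0')).
have sq : slit (q 0) by rewrite q0 slit_real.
pose g x := pi%:C * 'i + Log (q x).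
have Dg := cderivD (cderiv_cst (pi%:C * 'i) 0) (cderiv_comp Dq (cderiv_Log sq)).
have g0 : g 0 = pi%:C * 'i by rewrite /g q0 Log1 addr0.
have H1 := ctends_rogers (cderivN (cderivD cderiv_u Dg)).
have H2 := ctends_rogers (cderivB cderiv_u Dg).
pose F x := cexp (kappa * (- (n.+1%:R / 2 * u x ^+ 2) - g x ^+ 2 / 2)).
have F0 : F 0 = cexp (- (kappa * (n.+1%:R / 2 * Log z ^+ 2))).
  rewrite /F u0 g0 mulrBr cexpB cexp_halfperiod divr1; congr cexp; ring.
have HF : ctends F (F 0).
  apply: (ctends_cderiv (l := F 0 * (kappa * (- (n.+1%:R / 2 * (2%:R * u 0 ^+ 1 * (zeta' / z)))
     - ((2%:R * g 0 ^+ 1 * (0 + (q 0)^-1 * l)) * 2^-1 + g 0 ^+ 2 * 0))))).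
  apply: cderiv_cexpK; apply: cderivB.
    by apply: cderivN; apply: cderivZ; apply: cderivX; exact: cderiv_u.
  by apply: cderivM; [apply: cderivX|exact: cderiv_cst].
have := ctendsM (ctendsM H1 H2) HF.
rewrite !mul1r F0; apply: ctends_near.
have Nq : \forall x \near cnbhs (0 : C), q x != 0.
  have h : q 0 != 0 by rewrite q0 oner_neq0.
  exact: (cderiv_cont Dq (cnbhs_neq0 h)).
near=> x => sx; have x0 := slit_neq0 sx.
have rz : root (pencil x) (zeta x) by near: x.
have qx : q x != 0 by near: x.
have [zx0 ax0 bx0 dx0] := pencil_rootP n3 x0 rz.
pose v := - Log x + g x.
have eu := cexp_u x0 rz.
have ev : cexp v = wcoord n (zeta x).
  rewrite /v /g !cexpD cexpN !cexp_Log// cexp_ipi /q /wcoord.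
  have Dx0 := Dpol_neq0 zx0 dx0.
  move: rz; rewrite pencil_root NpolH => /eqP E.
  have -> : (pb R n).[zeta x] = x * (Dpol R n).[zeta x] / (pa R n).[zeta x].
    by rewrite -E mulrAC divff// mul1r.
  by field; rewrite x0 Dx0 ax0.
rewrite /critval -(critval_logs n3 x0 rz eu ev (cexp_NLog x0)) /crit.
have y1 : cexp (u x + v) != 1.
  have := logs_eq2 n3 x0 rz eu ev (cexp_NLog x0) => E.
  apply/eqP => h; move: E; rewrite h subrr mul0r => /esym/eqP.
  by rewrite mulf_eq0 !(negbTE (cexp_neq0 _)).
have := rogers_inversion y1 => I.
have r1 := rogers_neq0 (u x + v); have r3 := rogers_neq0 (- (u x + v)).
have -> : (rogers (u x + v))^-1 = rogers (- (u x + v)) * cexp (- (kappa * ((u x + v) ^+ 2 / 2))).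
  by rewrite cexpN -I; field; rewrite r1 r3.
have -> : Log x + - (u x + (pi%:C * 'i + Log (q x))) = - (u x + v) by rewrite /v /g; ring.
have -> : Log x + (u x - (pi%:C * 'i + Log (q x))) = u x - v by rewrite /v /g; ring.
rewrite /F; set A := rogers (- _); set B := rogers _.
transitivity (A * B * (cexp (- (kappa * ((u x + v) ^+ 2 / 2))) *
  cexp (kappa * (- (n%:~R / 2 * u x ^+ 2) + u x * v + v * - Log x)) *
  cexp (- (kappa * (Log x ^+ 2 / 2))))); first by ring.
rewrite -!cexpD; congr (_ * cexp _); rewrite /v.
rewrite -pmulrn -(natr1 n).
move: (n%:R : C) (u x) (g x) (Log x) => k p r t.
by field.
Unshelve. all: by end_near. Qed.

End OneRoot.
End Limit.

(** * Gaussian products and the value of the energy *)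

Section EnergyAtOne.
Variable R : realType.
Local Notation C := R[i].
Implicit Types (x y z w u v : C).

Local Notation kappa := (@kappa R).
Local Notation twopii := (@twopii R).

Lemma rootseq_uniq_factor (p : {poly C}) (s : seq C) : p \is monic ->
  uniq s -> all (root p) s -> size s = (size p).-1 -> perm_eq (rootseq p) s.
Proof.
move=> pm us rs ss.
have sub : {subset s <= rootseq p} by move=> z /(allP rs); rewrite mem_rootseq.
have sz : (size (rootseq p) <= size s)%N by rewrite size_rootseq// ss.
have [_ E] := uniq_min_size us sub sz.
by apply: uniq_perm => //; exact: (leq_size_uniq us sub sz).
Qed.

(** The contribution of a root of [X^m + 1] to the limit of the energy. *)
Definition gauss (m : nat) z := cexp (- (kappa * (m%:R / 2 * Log z ^+ 2))).

(** The equation [z^m = -1] makes the contribution independent of the choice of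
    the logarithm. *)
Lemma gauss_log (m : nat) z u (j : int) : z != 0 -> cexp u = z ->
  m%:R * u = (2 * j + 1)%:~R * (twopii / 2) ->
  gauss m z = cexp (- (kappa * (m%:R / 2 * u ^+ 2))).
Proof.
move=> z0 eu mu.
have [k ek] : exists k : int, Log z = u + k%:~R * twopii.
  by apply: cexp_inj_mod; rewrite cexp_Log.
rewrite /gauss ek.
pose t := (12 * k * (2 * j + 1) + 12 * k ^+ 2 * m%:Z)%:~R * twopii.
apply: (@cexp_mod _ _ _ t); first exact: cexp_twopiiz.
have -> : - (kappa * (m%:R / 2 * (u + k%:~R * twopii) ^+ 2)) =
   - (kappa * (m%:R / 2 * u ^+ 2)) - (kappa * twopii) * (k%:~R * (m%:R * u) + m%:R * k%:~R ^+ 2 * twopii / 2).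
  by field.
congr (_ + _); rewrite kappa_twopii mu /t expr2.
by rewrite (intrD _ (12 * k * _)) !intrM -pmulrn; field.
Qed.

Lemma sum_odd_sqr (m : nat) :
  (3 * \sum_(j < m) (2 * j + 1) ^ 2 = m * (4 * m ^ 2 - 1))%N.
Proof.
elim: m => [|m IH]; first by rewrite big_ord0.
rewrite big_ord_recr/= mulnDr IH.
have : (1 <= 4 * m.+1 ^ 2)%N by rewrite muln_gt0 expn_gt0.
case: m {IH} => [|m] //.
have : (1 <= 4 * m.+1 ^ 2)%N by rewrite muln_gt0 expn_gt0.
by nia.
Qed.

(** With the logarithms [(2 j + 1) * pi i / m], the exponent is
    [2 pi i / m] times three times the sum of the squares of [2 j + 1]. *)
Lemma prod_gauss (m : nat) : (0 < m)%N ->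
  \prod_(z <- rootseq ('X^m + 1 : {poly C})) gauss m z = 1.
Proof.
move=> m0.
have pm : ('X^m + 1 : {poly C}) \is monic by exact: Xn1_monic.
have mR : (m%:R : C) != 0 by rewrite pnatr_eq0 -lt0n.
pose th (j : nat) : C := (2 * j + 1)%:R * (twopii / (2 * m%:R)).
have thm j : m%:R * th j = (2 * j%:Z + 1)%:~R * (twopii / 2).
  have -> : (2 * j%:Z + 1)%:~R = (2 * j + 1)%:R :> C by rewrite intrD intrM -!pmulrn natrD natrM.
  by rewrite /th; field.
have P : perm_eq (rootseq ('X^m + 1 : {poly C})) [seq cexp (th j) | j <- iota 0 m].
  apply: rootseq_uniq_factor => //.
  - rewrite map_inj_in_uniq ?iota_uniq// => i j; rewrite !mem_iota !add0n => /andP[_ hi] /andP[_ hj].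
    move=> /cexp_inj_mod[k ek].
    have : (i%:Z - j%:Z - k * m%:Z)%:~R * twopii = 0 :> C.
      have -> : (i%:Z - j%:Z - k * m%:Z)%:~R * twopii = m%:R * (th i - (th j + k%:~R * twopii)).
        by rewrite /th !intrB intrM -!pmulrn; field.
      by rewrite ek subrr mulr0.
    have t0 : twopii != 0.
      by rewrite /twopii !mulf_neq0 ?pnatr_eq0 ?pi_neq0// -nm_eq0 nm_i oner_eq0.
    move/eqP; rewrite mulf_eq0 (negbTE t0) orbF intr_eq0 => /eqP E.
    have m0' : 0 <= m%:Z by [].
    case: (ltgtP k 0) => hk.
    + have := ler_wpM2r m0' (_ : k <= -1); rewrite mulN1r => /(_ _) q.
      have : k * m%:Z <= - m%:Z by apply: q; move: hk; lia.
      by move: E hi hj; move: (k * m%:Z) => c; lia.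
    + have := ler_wpM2r m0' (_ : 1 <= k); rewrite mul1r => /(_ _) q.
      have : m%:Z <= k * m%:Z by apply: q; move: hk; lia.
      by move: E hi hj; move: (k * m%:Z) => c; lia.
    + by move: E; rewrite hk mul0r; lia.
  - apply/allP => z /mapP[j _ ->]; rewrite /root !hornerE -cexpMn thm.
    rewrite intrD intrM mulrDl cexpD -mulrA.
    have -> : 2%:~R * (j%:~R * (twopii / 2)) = j%:~R * twopii :> C by field.
    rewrite cexp_twopiiz mul1r mul1r (_ : twopii / 2 = pi%:C * 'i).
      by rewrite cexp_ipi addNr.
    by rewrite /twopii; move: (pi%:C) => p; field.
  - by rewrite size_map size_iota -[1]/(1%:P) size_XnaddC.
rewrite (perm_big _ P)/= big_map.
transitivity (\prod_(j <- iota 0 m) cexp ((3 * ((2 * j + 1) ^ 2)%N%:R) * (twopii / m%:R))).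
  apply: eq_bigr => j _; rewrite (gauss_log (u := th j) (j := j%:Z)) ?cexp_neq0//.
  congr cexp.
  have -> : - (kappa * (m%:R / 2 * th j ^+ 2)) = - (kappa * twopii) * (2 * j + 1)%:R ^+ 2 * twopii / (8 * m%:R).
    by rewrite /th; field.
  by rewrite kappa_twopii natrX; field.
rewrite -cexp_sum -mulr_suml -mulr_sumr -natr_sum.
have -> : \sum_(j <- iota 0 m) ((2 * j + 1) ^ 2)%N = (\sum_(j < m) (2 * j + 1) ^ 2)%N.
  by rewrite -(big_mkord xpredT (fun j => (2 * j + 1) ^ 2)%N) /index_iota subn0.
rewrite -(natrM _ 3) sum_odd_sqr natrM.
rewrite (_ : _ * _ = (4 * m ^ 2 - 1)%N%:Z%:~R * twopii); first exact: cexp_twopiiz.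
by rewrite -pmulrn; field.
Qed.

Variable n : nat.
Hypothesis n3 : (2 < n)%N.

Local Notation pencil := (pencil (Npol R n) (Dpol R n)).
Local Notation energy := (@energy R n).

(** Hence the spurious root removed by [cpoly] does not affect the product. *)
Lemma gauss_N1 (m : nat) : gauss m (-1) = 1.
Proof.
have L : Log (-1 : C) = pi%:C * 'i.
  apply: Log_uniq; first exact: cexp_ipi.
  have -> : Im (pi%:C * 'i : C) = pi by rewrite !ReIm/=; ring.
  by rewrite lexx andbT; have := @pi_gt0 R; lra.
have := cexp_halfperiod R => H.
rewrite /gauss L.
have -> : - (kappa * (m%:R / 2 * (pi%:C * 'i) ^+ 2)) = - (m%:R * (kappa * ((pi%:C * 'i) ^+ 2 / 2))).
  by ring.
by rewrite cexpN cexpMn H expr1n invr1.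
Qed.

Lemma rootseq_mul (p q r : {poly C}) : p \is monic -> q \is monic -> p * q = r ->
  (forall z, root r z -> r^`().[z] != 0) ->
  perm_eq (rootseq r) (rootseq p ++ rootseq q).
Proof.
move=> pm qm E S.
have rm : r \is monic by rewrite -E monicMl.
apply: rootseq_uniq_factor => //.
- rewrite cat_uniq !uniq_rootseq//=.
  + rewrite andbT; apply/hasPn => z; rewrite !mem_rootseq// => /eqP hq; apply/negP => /eqP hp.
    have := S z; rewrite -E /root hornerM hp mul0r eqxx => /(_ isT).
    by rewrite derivM hornerD !hornerM hp hq mulr0 mul0r addr0 eqxx.
  + move=> z /eqP hz; have := S z; rewrite -E /root hornerM hz mulr0 eqxx => /(_ isT).
    by rewrite derivM hornerD !hornerM hz mulr0 add0r mulf_eq0 negb_or => /andP[].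
  + move=> z /eqP hz; have := S z; rewrite -E /root hornerM hz mul0r eqxx => /(_ isT).
    by rewrite derivM hornerD !hornerM hz mul0r addr0 mulf_eq0 negb_or => /andP[].
- apply/allP => z; rewrite mem_cat !mem_rootseq// -E /root hornerM mulf_eq0.
  by [].
- rewrite size_cat !size_rootseq// -E size_monicM// ?monic_neq0//.
  have := monic_neq0 pm; have := monic_neq0 qm; rewrite -!size_poly_gt0.
  by move: (size p) (size q) => a b; lia.
Qed.

Lemma Xn1_simple (m : nat) z : (0 < m)%N -> root ('X^m + 1 : {poly C}) z ->
  ('X^m + 1 : {poly C})^`().[z] != 0.
Proof.
move=> m0 rz; rewrite derivXn1 hornerMn hornerXn mulrn_eq0 negb_or -lt0n m0 /=.
rewrite expf_neq0//; apply: contraTneq rz => ->.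
by rewrite /root !hornerE expr0n eqn0Ngt m0 add0r oner_eq0.
Qed.

Lemma prod_gauss_factor (m : nat) (p : {poly C}) : (0 < m)%N -> p \is monic ->
  p * cpoly R n = 'X^m + 1 -> \prod_(z <- rootseq p) gauss m z = 1.
Proof.
move=> m0 pm E; have cm := cpoly_monic R n.
have P := rootseq_mul pm cm E (fun z => @Xn1_simple m z m0).
have := prod_gauss m0; rewrite (perm_big _ P) big_cat/=.
have -> : \prod_(z <- rootseq (cpoly R n)) gauss m z = 1; last by rewrite mulr1.
rewrite big_seq big1// => z; rewrite mem_rootseq// /cpoly.
case: ifP => _; first by rewrite /root hornerC oner_eq0.
by rewrite root_XsubC => /eqP ->; exact: gauss_N1.
Qed.

Lemma prodMc (T : Type) (s : seq T) (f : T -> C) (a : C) :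
  \prod_(t <- s) (f t * a) = \prod_(t <- s) f t * a ^+ size s.
Proof. by rewrite big_split/= prod_const. Qed.

(** There are two more roots of [pb] than of [pa], which accounts for the factor
    [exp (- kappa * Log x ^+ 2)] of the energy. *)
Lemma ctends_energy : ctends energy 1.
Proof.
have n1 : (0 < n.-1)%N by have := n3; lia.
have sz : ((size (pb R n)).-1 = (size (pa R n)).-1 + 2)%N.
  have := size_pa R n3; have := size_pb R n; have := size_cpoly R n; have := n3.
  by move: (size (pa R n)) (size (pb R n)) (size (cpoly R n)) => ? ? ?; lia.
have Nm := @Npol_monic R n n3; have DN := @Dpol_size R n n3; have N1 := @Npol_size1 R n n3.
have S := @Npol_simple R n n3.
have [zeta [Dz Z0 P]] := local_roots Nm DN N1 S.
set r0 := rootseq (pencil 0) in Dz Z0 P.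
have /choice[zeta' Dz'] : forall z, exists l, z \in r0 -> cderiv (zeta z) 0 l.
  by move=> z; case: (boolP (z \in r0)) => [/Dz[l Hl]|_]; [exists l|exists 0].
have p0 : pencil 0 = Npol R n by rewrite /pencil scale0r subr0.
have am := pa_monic R n3; have bm := pb_monic R n.
have Pr : perm_eq r0 (rootseq (pa R n) ++ rootseq (pb R n)).
  by apply: rootseq_mul.
have Rall z : z \in r0 -> \forall x \near cnbhs (0 : C), root (pencil x) (zeta z x).
  move=> zr; apply: filterS P => x Px; rewrite -mem_rootseq ?pencilm// (perm_mem Px).
  exact: map_f.
have ra z : z \in rootseq (pa R n) -> (pa R n).[z] = 0 /\ z \in r0.
  by move=> h; rewrite (perm_mem Pr) mem_cat h; split=> //;
    apply/eqP; rewrite -/(root _ _) -mem_rootseq.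
have rb z : z \in rootseq (pb R n) -> (pb R n).[z] = 0 /\ z \in r0.
  by move=> h; rewrite (perm_mem Pr) mem_cat h orbT; split=> //;
    apply/eqP; rewrite -/(root _ _) -mem_rootseq.
have Ta := @ctends_prod _ _ (rootseq (pa R n))
   (fun z x => critval n x (zeta z x) * cexp (kappa * (Log x ^+ 2 / 2))) (gauss n.-1).
have Tb := @ctends_prod _ _ (rootseq (pb R n))
   (fun z x => critval n x (zeta z x) * cexp (- (kappa * (Log x ^+ 2 / 2)))) (gauss n.+1).
have {}Ta := Ta _; have {}Tb := Tb _.
have Ha : forall z, z \in rootseq (pa R n) ->
    ctends (fun x => critval n x (zeta z x) * cexp (kappa * (Log x ^+ 2 / 2))) (gauss n.-1 z).
  move=> z /ra[hz zr]; apply: (ctends_pa n3 (Dz' z zr) (Z0 z zr) (Rall z zr)) => //.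
  exact: (pa_root_neq0 n3 hz).
have Hb : forall z, z \in rootseq (pb R n) ->
    ctends (fun x => critval n x (zeta z x) * cexp (- (kappa * (Log x ^+ 2 / 2)))) (gauss n.+1 z).
  move=> z /rb[hz zr]; apply: (ctends_pb n3 (Dz' z zr) (Z0 z zr) (Rall z zr)) => //.
  exact: (pb_root_neq0 hz).
have := ctendsM (Ta Ha) (Tb Hb).
rewrite (prod_gauss_factor (m := n.-1) n1 am (paE R n3)).
rewrite (prod_gauss_factor (m := n.+1) _ bm (pbE R n))// mulr1.
apply: ctends_near; near=> x => sx.
have Px : perm_eq (rootseq (pencil x)) [seq zeta z x | z <- r0] by near: x.
rewrite /energy (perm_big _ Px)/= big_map (perm_big _ Pr) big_cat/=.
rewrite !prodMc !size_rootseq//.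
rewrite sz.
set X := \prod_(z <- rootseq (pa R n)) _; set Y := \prod_(z <- rootseq (pb R n)) _.
rewrite (cexpN (kappa * (Log x ^+ 2 / 2))); set e := cexp (kappa * (Log x ^+ 2 / 2)).
have e0 : e != 0 by exact: cexp_neq0.
have -> : cexp (- (kappa * Log x ^+ 2)) = e^-1 ^+ 2.
  by rewrite /e -cexpN -cexpMn; congr cexp; field.
rewrite exprD !exprVn; move: (e ^+ _) (expf_neq0 (size (pa R n)).-1 e0) => E E0.
move: X Y e e0 => X Y e e0.
by field; rewrite e0 E0.
Unshelve. all: by end_near. Qed.

(** The energy is equal to [energy 1] along a path that ends at 0. *)
Lemma energy1 : simple_roots (pencil 1) -> energy 1 = 1.
Proof.
move=> S1; have [eta He] := energy_detour n3 S1.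
apply/eqP; rewrite -subr_eq0 -nm_eq0 eq_le nm_ge0 andbT leNgt; apply/negP => h.
have [d d0 Hd] := ctends_energy h.
pose s := Num.min 1 (d / (2 * (1 + `|eta|))).
have A0 : 0 < 2 * (1 + `|eta|) by rewrite mulr_gt0// ltr_pwDl.
have s0 : 0 < s by rewrite lt_min ltr01 divr_gt0.
have s1 : s <= 1 by rewrite /s ge_min lexx.
have s2 : s <= d / (2 * (1 + `|eta|)) by rewrite /s ge_min lexx orbT.
have sl : slit (detour eta (s%:C)) by rewrite /slit Re_detour negb_and -!ltNge s0 orbT.
have nd : nm (detour eta (s%:C) - 0) < d.
  rewrite subr0 (le_lt_trans (nm_le _))// Re_detour Im_detour normrM (ger0_norm (ltW s0)).
  rewrite ler_pdivlMr// in s2.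
  have : `|s * (1 - s)| <= s.
    by rewrite ger0_norm ?mulr_ge0 ?subr_ge0 ?(ltW s0)// ler_piMr ?ltW//; lra.
  move=> /(ler_wpM2l (normr_ge0 eta)) q.
  have := normr_ge0 eta; nra.
by have := Hd _ nd sl; rewrite He ?s0// ltxx.
Qed.

End EnergyAtOne.

(** * Chebyshev polynomials and double roots *)

Section Chebyshev.

(** Chebyshev polynomials, normalized by [cheb k (z + z^-1) = z^k + z^-k], in
    consecutive pairs. *)
Fixpoint cheb2 (A : comNzRingType) (k : nat) : {poly A} * {poly A} :=
  if k is k'.+1 then let: (p, q) := cheb2 A k' in (q, 'X * q - p) else (2%:R, 'X).

Definition cheb (A : comNzRingType) k := (cheb2 A k).1.

Lemma cheb0 (A : comNzRingType) : cheb A 0 = 2%:R. Proof. by []. Qed.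
Lemma cheb1 (A : comNzRingType) : cheb A 1 = 'X. Proof. by []. Qed.
Lemma chebSS (A : comNzRingType) k : cheb A k.+2 = 'X * cheb A k.+1 - cheb A k.
Proof. by rewrite /cheb /=; case: (cheb2 A k). Qed.

Lemma chebSSH (A : comNzRingType) k (x : A) :
  (cheb A k.+2).[x] = x * (cheb A k.+1).[x] - (cheb A k).[x].
Proof. by rewrite chebSS hornerD hornerN mulrC hornerMX mulrC. Qed.

Lemma cheb0H (A : comNzRingType) (x : A) : (cheb A 0).[x] = 2%:R.
Proof. by rewrite cheb0 -polyC_natr hornerC. Qed.

Lemma cheb1H (A : comNzRingType) (x : A) : (cheb A 1).[x] = x.
Proof. by rewrite cheb1 hornerX. Qed.

Lemma nat_ind2 (P : nat -> Prop) : P 0%N -> P 1%N ->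
  (forall k, P k -> P k.+1 -> P k.+2) -> forall k, P k.
Proof.
move=> p0 p1 H k; suff : P k /\ P k.+1 by case.
by elim: k => [|k [h1 h2]]; split=> //; apply: H.
Qed.

Lemma cheb_map (A B : comNzRingType) (f : {rmorphism A -> B}) k :
  map_poly f (cheb A k) = cheb B k.
Proof.
elim/nat_ind2: k => [||k h1 h2]; first by rewrite !cheb0 rmorph_nat.
  by rewrite !cheb1 map_polyX.
by rewrite !chebSS rmorphB rmorphM/= map_polyX h1 h2.
Qed.

Lemma cheb_horner (F : fieldType) (z : F) k : z != 0 ->
  (cheb F k).[z + z^-1] = z ^+ k + z ^- k.
Proof.
move=> z0; elim/nat_ind2: k => [||k h1 h2].
- by rewrite cheb0H expr0 invr1 -natr1.
- by rewrite cheb1H expr1.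
rewrite chebSSH h1 h2 !exprS.
by field; rewrite z0 expf_neq0.
Qed.

Lemma cheb_size (A : comNzRingType) k : (0 < k)%N ->
  size (cheb A k) = k.+1 /\ lead_coef (cheb A k) = 1.
Proof.
case: k => // k _.
suff : (size (cheb A k) <= k.+1)%N /\ (size (cheb A k.+1) = k.+2 /\ lead_coef (cheb A k.+1) = 1).
  by case.
elim: k => [|k [h1 [h2 h3]]].
  rewrite cheb0 cheb1 size_polyX lead_coefX -polyC_natr; split=> //.
  exact: size_polyC_leq1.
split; first by rewrite h2.
have p0 : cheb A k.+1 != 0 by rewrite -size_poly_gt0 h2.
have e1 : size ('X * cheb A k.+1) = k.+3 by rewrite mulrC size_mulX// h2.
have lt : (size (- cheb A k)%R < size ('X * cheb A k.+1)%R)%N.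
  by rewrite size_polyN e1 (leq_ltn_trans h1).
rewrite chebSS size_polyDl// e1; split=> //.
by rewrite lead_coefDl// mulrC lead_coefMX.
Qed.

Section RealBounds.
Variable R : realFieldType.
Implicit Types (x : R).

Lemma cheb_incr x k : 2 <= x ->
  2 <= (cheb R k).[x] /\ (cheb R k).[x] <= (cheb R k.+1).[x].
Proof.
move=> x2; elim: k => [|k [h1 h2]].
  by rewrite cheb0H cheb1H.
split; first exact: le_trans h1 h2.
rewrite chebSSH.
have h3 : 2 <= (cheb R k.+1).[x] := le_trans h1 h2.
by nra.
Qed.

Lemma cheb_le x k j : 2 <= x -> (cheb R k).[x] <= (cheb R (k + j)).[x].
Proof.
move=> x2; elim: j => [|j IH]; first by rewrite addn0.
by rewrite addnS (le_trans IH)//; have [] := cheb_incr (k + j) x2.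
Qed.

Lemma cheb_opp x k : (cheb R k).[- x] = (-1) ^+ k * (cheb R k).[x].
Proof.
elim/nat_ind2: k => [||k h1 h2].
- by rewrite !cheb0H expr0 mul1r.
- by rewrite !cheb1H expr1 mulN1r.
by rewrite !chebSSH h1 h2 !exprS; ring.
Qed.

Lemma cheb3 x : (cheb R 3).[x] = x ^+ 3 - 3 * x.
Proof.
by rewrite !chebSSH cheb0H cheb1H; ring.
Qed.

Lemma cheb4 x : (cheb R 4).[x] = x ^+ 4 - 4 * x ^+ 2 + 2.
Proof.
by rewrite !chebSSH cheb0H cheb1H; ring.
Qed.

(** For [|x| >= 2] the growth of [cheb n] forbids equality with the right-hand
    side, the trace polynomial of the figure eight knot, except at [-2]. *)
Lemma cheb_real_root x n : (2 < n)%N -> 2 <= `|x| ->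
  (cheb R n).[x] = x ^+ 2 - x - 4 -> x = - 2.
Proof.
move=> n3 x2 E; have [x0|x0] := leP 0 x.
  rewrite ger0_norm// in x2.
  have := @cheb_le x 3 (n - 3) x2; rewrite subnKC// cheb3 E => h.
  have : 0 <= x * (x - 2) * (x + 1) by rewrite !mulr_ge0//; lra.
  have -> : x * (x - 2) * (x + 1) = x ^+ 3 - x ^+ 2 - 2 * x by ring.
  by lra.
rewrite ltr0_norm// in x2; set y := - x in x2.
have ex : x = - y by rewrite /y opprK.
move: E; rewrite ex cheb_opp sqrrN opprK => E.
have [on|en] := boolP (odd n).
  have [h _] := cheb_incr n x2; move: E; rewrite -signr_odd on expr1 => E.
  by have := sqr_ge0 (y - 2); nra.
have n4 : (4 <= n)%N by case: n n3 en E => [|[|[|[]]]].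
have := @cheb_le y 4 (n - 4) x2; rewrite subnKC// cheb4.
move: E; rewrite -signr_odd (negbTE en) expr0 mul1r => -> h.
congr (- _); apply/eqP; rewrite eq_le x2 andbT leNgt; apply/negP => y2.
have : 0 < (y - 2) * (y ^+ 3 + 2 * y ^+ 2 - y - 3).
  apply: mulr_gt0; first by rewrite subr_gt0.
  have : 4 <= y ^+ 2 by rewrite expr2; nra.
  have : 0 <= y ^+ 3 by rewrite exprn_ge0//; lra.
  have : y <= y ^+ 2 by rewrite expr2; nra.
  by lra.
have -> : (y - 2) * (y ^+ 3 + 2 * y ^+ 2 - y - 3) = y ^+ 4 - 5 * y ^+ 2 - y + 6 by ring.
by lra.
Qed.

End RealBounds.

Lemma dvd_root (F : fieldType) (p q : {poly F}) x : p %| q -> root p x -> root q x.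
Proof. by move=> /dvdpP[r ->]; rewrite rootM => ->; rewrite orbT. Qed.

(** A rational algebraic integer is an integer. *)
Lemma rat_root_int (p : {poly int}) (r : rat) : p \is monic ->
  root (map_poly intr p : {poly rat}) r -> exists k : int, r = k%:~R.
Proof.
move=> pm rr.
have h : (ratr r : algC) \in Num.int.
  apply: Cint_rat_Aint; first by apply/CratP; exists r.
  apply: (@root_monic_Aint (map_poly intr p)).
  - have -> : map_poly intr p = map_poly (ratr : rat -> algC) (map_poly intr p) :> {poly algC}.
      by rewrite -map_poly_comp; apply: eq_map_poly => a /=; rewrite ratr_int.
    by rewrite fmorph_root.
  - by rewrite monic_map.
  - by apply/polyOverP => i; rewrite coef_map/= intr_int.
have /intrP[k hk] := h; exists k.
by apply: (@fmorph_inj _ _ (ratr : {rmorphism rat -> algC})); rewrite /= hk ratr_int.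
Qed.

Lemma quad_signs (F : realFieldType) (N : F) : 9 <= N ->
  let q x := (N - 4%:R) * x ^+ 2 - (2%:R * N - 4%:R) * x - (3%:R * N + 1) in
  [/\ q 0 < 0, q 1 < 0, q (-1) < 0, 0 < q (-2) & q 2 <= 0 <= q 5].
Proof.
move=> h q; rewrite /q.
have -> : (N - 4%:R) * 0 ^+ 2 - (2%:R * N - 4%:R) * 0 - (3%:R * N + 1) = - (3 * N + 1) by ring.
have -> : (N - 4%:R) * 1 ^+ 2 - (2%:R * N - 4%:R) * 1 - (3%:R * N + 1) = - (4 * N + 1) by ring.
have -> : (N - 4%:R) * (-1) ^+ 2 - (2%:R * N - 4%:R) * (-1) - (3%:R * N + 1) = - 9 by ring.
have -> : (N - 4%:R) * (-2) ^+ 2 - (2%:R * N - 4%:R) * (-2) - (3%:R * N + 1) = 5 * N - 25 by ring.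
have -> : (N - 4%:R) * 2 ^+ 2 - (2%:R * N - 4%:R) * 2 - (3%:R * N + 1) = - (3 * N + 9) by ring.
have -> : (N - 4%:R) * 5 ^+ 2 - (2%:R * N - 4%:R) * 5 - (3%:R * N + 1) = 12 * N - 81 by ring.
by split; lra.
Qed.

Section DoubleRoots.
Variable R : rcfType.
Local Notation C := R[i].
Variable n : nat.
Hypothesis n3 : (2 < n)%N.

(** The condition on [t = z + z^-1] imposed by a double root [z]: it results from
    the equation and its derivative by elimination of [z^n]; see
    [pencil1_simple]. *)
Definition quad (A : comNzRingType) : {poly A} :=
  (n%:R ^+ 2 - 4%:R) *: 'X^2 - (2%:R * n%:R ^+ 2 - 4%:R) *: 'X - (3%:R * n%:R ^+ 2 + 1)%:P.

(** The surgery equation in the variable [z + z^-1]. *)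
Definition tracep (A : comNzRingType) : {poly A} := cheb A n - ('X^2 - 'X - 4%:R%:P).

Lemma quadH (A : comNzRingType) (x : A) : (quad A).[x] =
  (n%:R ^+ 2 - 4%:R) * x ^+ 2 - (2%:R * n%:R ^+ 2 - 4%:R) * x - (3%:R * n%:R ^+ 2 + 1).
Proof. by rewrite /quad !hornerE. Qed.

Lemma tracepH (A : comNzRingType) (x : A) : (tracep A).[x] =
  (cheb A n).[x] - (x ^+ 2 - x - 4).
Proof. by rewrite /tracep !hornerE. Qed.

Lemma quad_map (A B : comNzRingType) (f : {rmorphism A -> B}) :
  map_poly f (quad A) = quad B.
Proof.
rewrite /quad !rmorphB/= !map_polyZ map_polyXn map_polyX map_polyC/=.
by rewrite !(rmorphB, rmorphD, rmorphM, rmorphXn, rmorph_nat, rmorph1).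
Qed.

Lemma tracep_map (A B : comNzRingType) (f : {rmorphism A -> B}) :
  map_poly f (tracep A) = tracep B.
Proof.
by rewrite /tracep !rmorphB/= cheb_map map_polyXn map_polyX map_polyC/= rmorph_nat.
Qed.

Lemma tracep_monic (A : comNzRingType) : tracep A \is monic.
Proof.
have [s l] := @cheb_size A n (ltn_trans (isT : 0 < 2)%N n3).
rewrite monicE lead_coefDl ?l// size_polyN s.
apply: leq_ltn_trans (_ : 3 < n.+1)%N => //.
rewrite -addrA (leq_trans (size_polyD _ _))// geq_max size_polyXn/=.
rewrite (leq_trans (size_polyD _ _))// geq_max !size_polyN size_polyX/=.
by rewrite (leq_trans (size_polyC_leq1 _)).
Qed.

(** A common root makes the greatest common divisor over the rationals nontrivial.
    If it is linear, its root is an integer, which is [-2] by [cheb_real_root]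
    unless it is [-1], 0 or 1; but [quad] vanishes at none of these.
    If it is quadratic it is [quad] up to a factor, and the root of [quad] between
    2 and 5 contradicts [cheb_real_root]. *)
Lemma quad_trace_coprime (x : C) : (quad C).[x] = 0 -> (tracep C).[x] = 0 -> False.
Proof.
move=> hq ht.
pose g := gcdp (quad rat) (tracep rat).
have nn : (9 : rat) <= n%:R ^+ 2.
  by rewrite (_ : 9 = 3%:R ^+ 2) ?ler_sqr ?nnegrE ?ler0n ?ler_nat//; ring.
have nnR : (9 : R) <= n%:R ^+ 2.
  by rewrite (_ : 9 = 3%:R ^+ 2) ?ler_sqr ?nnegrE ?ler0n ?ler_nat//; ring.
have rx : root (map_poly (ratr : rat -> C) g) x.
  by rewrite gcdp_map quad_map tracep_map root_gcd /root hq ht eqxx.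
have q0 : quad rat != 0.
  apply/eqP => h; have [+ _ _ _ _] := quad_signs nn.
  by have := quadH (0 : rat); rewrite h horner0 => <-; rewrite ltxx.
have g0 : g != 0 by rewrite gcdp_eq0 negb_and q0.
have sq : (size (quad rat) <= 3)%N.
  rewrite /quad (leq_trans (size_polyD _ _))// geq_max size_polyN.
  rewrite (leq_trans (size_polyC_leq1 _))// andbT.
  rewrite (leq_trans (size_polyD _ _))// geq_max size_polyN.
  rewrite (leq_trans (size_scale_leq _ _)) ?size_polyXn//=.
  by rewrite (leq_trans (size_scale_leq _ _)) ?size_polyX.
have sg : (size g <= 3)%N := leq_trans (leq_gcdpl _ q0) sq.
have sg1 : (1 < size g)%N.
  rewrite ltnNge; apply/negP => /size1_polyC hg; move: rx g0.
  rewrite hg map_polyC/= rootC fmorph_eq0 => /eqP ->.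
  by rewrite eqxx.
have [gq gt] : (g %| quad rat) /\ (g %| tracep rat) by rewrite dvdp_gcdl dvdp_gcdr.
have [s2|s3] : size g = 2%N \/ size g = 3%N by lia.
  have [r rr] : exists r, root g r.
    exists (- g`_0 / g`_1); rewrite /root horner_coef s2 !big_ord_recl big_ord0/= expr0 expr1.
    have : lead_coef g != 0 by rewrite lead_coef_eq0.
    by rewrite lead_coefE s2 /= /bump/= => g1; apply/eqP; field.
  have rq : (quad rat).[r] = 0 by apply/eqP; exact: dvd_root gq rr.
  have rt : (tracep rat).[r] = 0 by apply/eqP; exact: dvd_root gt rr.
  have [k ek] : exists k : int, r = k%:~R.
    apply: (@rat_root_int (tracep int)); first exact: tracep_monic.
    by rewrite tracep_map /root rt.
  have [k2|k2] := lerP 2 `|k|.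
    have : r = - 2.
      apply: (@cheb_real_root rat r n) => //.
        by rewrite ek -intr_norm (ler_int _ 2).
      by move: rt; rewrite tracepH => /eqP; rewrite subr_eq0 => /eqP.
    move=> e2; have [_ _ _ + _] := quad_signs nn.
    by rewrite -[X in 0 < X]quadH -e2 rq ltxx.
  have : k \in [:: 0; 1; -1] by rewrite !inE; lia.
  have [+ + + _ _] := quad_signs nn; rewrite -!quadH => q0' q1 q2.
  by rewrite !inE => /or3P[] /eqP hk; move: rq q0' q1 q2; rewrite ek hk => ->; rewrite ltxx.
have qg : g %= quad rat.
  rewrite -dvdp_size_eqp// s3 eqn_leq sq andbT -s3.
  exact: dvdp_leq q0 gq.
have qt : (quad R) %| (tracep R).
  rewrite -(quad_map (ratr : {rmorphism rat -> R})).
  by rewrite -(tracep_map (ratr : {rmorphism rat -> R})) dvdp_map -(eqp_dvdl _ qg).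
have h25 : (2 : R) <= 5 by lra.
have [|y /andP[y2 y5] ry] := @Num.Theory.poly_ivt R (quad R) 2 5 h25.
  by rewrite !quadH; have [_ _ _ _ ?] := quad_signs nnR.
have : y = -2.
  apply: (@cheb_real_root R y n) => //; first by rewrite ger0_norm//; lra.
  have := dvd_root qt ry; rewrite /root tracepH subr_eq0 => /eqP; exact.
by lra.
Qed.

End DoubleRoots.
End Chebyshev.

(** * The equation at parameter one *)

Section SurgeryEquation.
Variable R : realType.
Local Notation C := R[i].
Variable n : nat.
Hypothesis n3 : (2 < n)%N.
Implicit Types (z w : C).

Local Notation pencil1 := (pencil (Npol R n) (Dpol R n) 1).
Local Notation c := (cpoly R n).
Local Notation wcoord := (@wcoord R n).

Let pow1 z : z ^+ n.-1 = z * z ^+ n.-2.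
Proof. by rewrite -exprS; congr (_ ^+ _); have := n3; lia. Qed.
Let pow0 z : z ^+ n = z ^+ 2 * z ^+ n.-2.
Proof. by rewrite -exprD; congr (_ ^+ _); have := n3; lia. Qed.
Let pow2 z : z ^+ n.+1 = z ^+ 3 * z ^+ n.-2.
Proof. by rewrite -exprD; congr (_ ^+ _); have := n3; lia. Qed.

Lemma pencil1_ND z : root pencil1 z -> (Npol R n).[z] = (Dpol R n).[z].
Proof. by rewrite pencil_root mul1r => /eqP. Qed.

(** At the spurious root [-1] the three factors take the values [n - 1], [n + 1]
    and [- 2], so that the equation would read [n^2 - 1 = 4]. *)
Lemma pencil1_cpoly z : root pencil1 z -> c.[z] != 0.
Proof.
move=> /pencil1_ND; rewrite NpolH DpolH => E; apply/eqP => hc.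
have dP := congr1 (fun p : {poly C} => p^`().[z]) (paE R n3).
have dQ := congr1 (fun p : {poly C} => p^`().[z]) (pbE R n).
have dS := congr1 (fun p : {poly C} => p^`().[z]) (pdE R n).
move: hc dP dQ dS; rewrite /= !derivM !hornerD !hornerM => hc.
rewrite hc !mulr0 !add0r !derivXn1 derivB derivXn -polyC1 derivC subr0 !hornerMn !hornerXn.
move: hc; rewrite /cpoly; case: ifPn => on; first by move/eqP; rewrite hornerC oner_eq0.
rewrite hornerXsubC derivXsubC hornerC => /eqP; rewrite subr_eq0 => /eqP ez.
rewrite !mulr1 ez /= expr1 => ea eb ed.
move: E; rewrite ez ea eb ed.
have e1 : (-1) ^+ n = 1 :> C := expN1_even R on.
have e2 : (-1) ^+ n.-2 = 1 :> C.
  by have := pow0 (-1); rewrite e1 sqrrN expr1n mul1r.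
rewrite e2 e1 mul1r mulNrn sqrrN -natrM -natrX => /eqP.
rewrite eqr_nat => /eqP h; move: n3 h; clear; case: n => [|[|[|k]]]//= _.
by rewrite expnS expn1; nia.
Qed.

Lemma pencil1_neq0 z : root pencil1 z -> z != 0 /\ z ^+ 2 - 1 != 0.
Proof.
move=> rz; have [z0 _ _ d0] := pencil_rootP n3 (oner_neq0 C) rz.
by split=> //; rewrite -(pdH n z) mulf_neq0// pencil1_cpoly.
Qed.

Lemma pencil1_eq z : root pencil1 z ->
  (z ^+ n.-1 + 1) * (z ^+ n.+1 + 1) = z ^+ n.-2 * (z ^+ 2 - 1) ^+ 2.
Proof.
move=> /pencil1_ND; rewrite NpolH DpolH => E.
rewrite -(paH n3) -(pbH n) -(pdH n).
transitivity ((pa R n).[z] * (pb R n).[z] * c.[z] ^+ 2); first by ring.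
by rewrite E; ring.
Qed.

(** In the variable [z + z^-1] the equation compares a Chebyshev polynomial with
    the trace polynomial of the figure eight knot. *)
Lemma pencil1_trace z : root pencil1 z -> (tracep n C).[z + z^-1] = 0.
Proof.
move=> rz; have [z0 _] := pencil1_neq0 rz; have := pencil1_eq rz.
rewrite tracepH cheb_horner// pow0 pow1 pow2 => E.
have y0 : z ^+ n.-2 != 0 by rewrite expf_neq0.
move: (z ^+ n.-2) y0 E => y y0 E.
apply: (mulIf y0); apply: (mulIf (expf_neq0 2 z0)).
transitivity ((z * y + 1) * (z ^+ 3 * y + 1) - y * (z ^+ 2 - 1) ^+ 2).
  by field; rewrite z0 y0.
by rewrite E subrr !mul0r.
Qed.

(** For a double root, the equation determines [y + z^-4 y^-1] and its derivative
    determines [n * (y - z^-4 y^-1)], where [y = z^(n-2)]. The squares of sum and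
    difference differ by [4 z^-4], which eliminates [y] and leaves [quad]. *)
Lemma pencil1_simple : simple_roots pencil1.
Proof.
move=> z rz; apply/eqP => dz.
have [z0 s0] := pencil1_neq0 rz; have E0 := pencil1_eq rz; have ht := pencil1_trace rz.
apply: (quad_trace_coprime n3 _ ht).
pose G : {poly C} := ('X^(n.-1) + 1) * ('X^(n.+1) + 1) - 'X^(n.-2) * ('X^2 - 1) ^+ 2.
have GE : G = c ^+ 2 * pencil1.
  rewrite /G -(paE R n3) -(pbE R n) -(pdE R n) /pencil scale1r /Npol /Dpol.
  by move: (pa R n) (pb R n) (pd R n) ('X^(n.-2) : {poly C}) => p q r s; ring.
have dG : G^`().[z] = 0.
  rewrite GE derivM hornerD !hornerM dz mulr0 addr0.
  by move: rz => /eqP ->; rewrite mulr0.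
have e3 : n.-2 = n.-2.-1.+1 by have := n3; case: (n) => [|[|[]]].
have y0 : z ^+ n.-2 != 0 by rewrite expf_neq0.
pose p : {poly C} := 'X^(n.-1) + 1; pose q : {poly C} := 'X^(n.+1) + 1.
pose r : {poly C} := 'X^(n.-2); pose t : {poly C} := 'X^2 - 1.
have pz : p.[z] = z * z ^+ n.-2 + 1 by rewrite /p !hornerE pow1.
have qz : q.[z] = z ^+ 3 * z ^+ n.-2 + 1 by rewrite /q !hornerE pow2.
have rz' : r.[z] = z ^+ n.-2 by rewrite /r hornerXn.
have tz : t.[z] = z ^+ 2 - 1 by rewrite /t !hornerE.
have p'z : p^`().[z] = n.-1%:R * z ^+ n.-2.
  by rewrite /p derivXn1 hornerMn hornerXn -mulr_natl.
have q'z : q^`().[z] = n.+1%:R * (z ^+ 2 * z ^+ n.-2).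
  by rewrite /q derivXn1 hornerMn hornerXn -mulr_natl pow0.
have r'z : z * r^`().[z] = n.-2%:R * z ^+ n.-2.
  by rewrite /r derivXn hornerMn hornerXn -mulr_natl mulrCA -exprS -e3.
have t'z : t^`().[z] = 2 * z.
  by rewrite /t derivB derivXn -polyC1 derivC subr0 hornerMn hornerXn expr1 mulr_natl.
have {}dG : z * (p^`().[z] * q.[z] + p.[z] * q^`().[z]
    - (r^`().[z] * t.[z] ^+ 2 + r.[z] * (2 * t.[z] * t^`().[z]))) = 0.
  rewrite -[RHS](mulr0 z) -dG; congr (_ * _).
  have -> : G = p * q - r * (t * t) by rewrite /G expr2.
  move: p q r t {pz qz rz' tz p'z q'z r'z t'z} => p q r t.
  by rewrite derivB !derivM !(hornerD, hornerN, hornerM); ring.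
move: dG; rewrite pz qz p'z q'z rz' tz t'z => dG.
have {}dG : z * (n.-1%:R * z ^+ n.-2 * (z ^+ 3 * z ^+ n.-2 + 1) + (z * z ^+ n.-2 + 1) *
    (n.+1%:R * (z ^+ 2 * z ^+ n.-2)) - z ^+ n.-2 * (2 * (z ^+ 2 - 1) * (2 * z)))
    - n.-2%:R * z ^+ n.-2 * (z ^+ 2 - 1) ^+ 2 = 0.
  by rewrite -r'z -[RHS]dG; ring.
have en1 : n.-1%:R = n%:R - 1 :> C.
  by rewrite -[in RHS](prednK (ltn_trans (isT : 0 < 2)%N n3)) -(natr1 n.-1); ring.
have en2 : n.-2%:R = n%:R - 2 :> C.
  have -> : n%:R = n.-2%:R + 2 :> C by rewrite -natrD addn2 [in LHS](nE n3).
  by ring.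
move: E0 dG; rewrite pow1 pow2 en1 en2 -(natr1 n) quadH => E0 dG.
move: (z ^+ n.-2) y0 (n%:R : C) E0 dG => y y0 N E0 dG.
(* difference and sum of [z^4 y^2] and 1, from the derivative and the equation *)
have K1 : N * (z ^+ 4 * y ^+ 2 - 1) = (z ^+ 2 - 1) * y * (2 * z ^+ 2 - z + 2).
  apply/eqP; rewrite -subr_eq0; apply/eqP.
  have E0' : (z * y + 1) * (z ^+ 3 * y + 1) - y * (z ^+ 2 - 1) ^+ 2 = 0.
    by rewrite E0 subrr.
  transitivity (0 - N * 0 : C); last by rewrite mulr0 subr0.
  by rewrite -{1}dG -{1}E0'; ring.
have K2 : z ^+ 4 * y ^+ 2 + 1 = y * (z ^+ 4 - z ^+ 3 - 2 * z ^+ 2 - z + 1).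
  apply/eqP; rewrite -subr_eq0; apply/eqP.
  transitivity ((z * y + 1) * (z ^+ 3 * y + 1) - y * (z ^+ 2 - 1) ^+ 2); first by ring.
  by rewrite E0 subrr.
apply: (mulIf (expf_neq0 2 z0)); apply: (mulIf (expf_neq0 2 s0)).
apply: (mulIf (expf_neq0 2 y0)); rewrite !mul0r.
have K3 : N ^+ 2 * ((z ^+ 4 * y ^+ 2 + 1) ^+ 2 - (z ^+ 4 * y ^+ 2 - 1) ^+ 2) =
   N ^+ 2 * (4 * z ^+ 4 * y ^+ 2) by ring.
have K4 : N ^+ 2 * (z ^+ 4 * y ^+ 2 - 1) ^+ 2 = ((z ^+ 2 - 1) * y * (2 * z ^+ 2 - z + 2)) ^+ 2.
  by rewrite -K1 exprMn.
rewrite K2 in K3; rewrite mulrBr K4 in K3.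
transitivity (N ^+ 2 * (y * (z ^+ 4 - z ^+ 3 - 2 * z ^+ 2 - z + 1)) ^+ 2 -
   ((z ^+ 2 - 1) * y * (2 * z ^+ 2 - z + 2)) ^+ 2 - N ^+ 2 * (4 * z ^+ 4 * y ^+ 2)).
  by field.
by rewrite K3 subrr.
Qed.

Lemma sqr_real_pos (a : C) (r : R) : 0 < r -> a ^+ 2 = r%:C -> Im a = 0.
Proof.
move=> r0; case: a => a b; rewrite expr2 => E.
have e1 : a * b + b * a = 0 by have := congr1 (@complex.Im R) E.
have e2 : a * a - b * b = r by have := congr1 (@complex.Re R) E.
rewrite /=; apply/eqP; apply: contraT => b0.
have a0 : a = 0.
  by apply: (mulfI b0); rewrite mulr0; lra.
by move: e2; rewrite a0 mulr0 sub0r => e2; have := sqr_ge0 b; rewrite expr2; lra.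
Qed.

(** If [z] is real then [|z + z^-1| >= 2], so that [cheb_real_root] leaves only
    [z = -1]. *)
Lemma pencil1_not_real z : root pencil1 z -> Im z != 0.
Proof.
move=> rz; apply/eqP => iz; have [z0 s0] := pencil1_neq0 rz; have ht := pencil1_trace rz.
have ez : z = (Re z)%:C by apply: complex_eq.
set r := Re z in ez.
have r0 : r != 0 by apply: contraNneq z0 => h; rewrite ez h.
have ex : z + z^-1 = (r + r^-1)%:C by rewrite ez rcD rcV.
have {}ht : (tracep n R).[r + r^-1] = 0.
  apply: (@complexI R); rewrite -horner_map/= tracep_map.
  by rewrite -ex ht.
have h2 : 2 <= `|r + r^-1|.
  rewrite -ler_sqr ?nnegrE// real_normK ?num_real//.
  have -> : (r + r^-1) ^+ 2 = (r - r^-1) ^+ 2 + 2 ^+ 2 by field.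
  by rewrite lerDr sqr_ge0.
have : r + r^-1 = -2.
  apply: (cheb_real_root n3 h2); move: ht; rewrite tracepH => /eqP.
  by rewrite subr_eq0 => /eqP.
move=> h; have : (r + 1) ^+ 2 = 0.
  transitivity (r * (r + r^-1) + 2 * r); last by rewrite h; ring.
  by field.
move=> /eqP; rewrite sqrf_eq0 addr_eq0 => /eqP er.
by move: s0; rewrite ez er rcN sqrrN expr1n subrr eqxx.
Qed.

(** The dilogarithms of a solution are evaluated off their cut: if [y = z w] is
    real and at least 1, then [(1 - z w) (1 - z / w) = z] is a quadratic equation
    for [z] with real coefficients and positive discriminant, but [z] is not real.
    The same applies to [z / w]. *)
Lemma pencil1_slit z : root pencil1 z ->
  slit (1 - z * wcoord z) /\ slit (1 - z / wcoord z).
Proof.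
move=> rz; have z0 := (pencil1_neq0 rz).1.
have w0 := wcoord_neq0 n3 (oner_neq0 C) rz.
have := wcoord_eq2 n3 (oner_neq0 C) rz; rewrite invr1 mul1r => E2.
have iz := pencil1_not_real rz.
have P y w : y = z * w -> (1 - z * w) * (1 - z / w) = z -> w != 0 -> slit (1 - y).
  move=> ey E w0'; apply: contraT => /not_slit_1B[iy ry].
  have y1 : 1 - y != 0.
    by rewrite ey; apply: contraNneq z0 => h; rewrite -E h mul0r.
  have eyr : y = (Re y)%:C by apply: complex_eq.
  set r := Re y in ry eyr.
  have r1 : r != 1 by apply: contraNneq y1 => h; rewrite eyr h subrr.
  have rgt : 1 < r by rewrite lt_neqAle eq_sym r1.
  have y0 : y != 0 by rewrite ey mulf_neq0.
  have E3 : (1 - y) * (1 - z ^+ 2 / y) = z.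
    by rewrite -[RHS]E ey; congr (_ * _); field; rewrite z0 w0'.
  have h : (z - (r / (r - 1) / 2)%:C) ^+ 2 = ((r / (r - 1) / 2) ^+ 2 + r)%:C.
    have rr : r%:C - 1 != 0 :> C by rewrite -eyr -opprB oppr_eq0.
    have er : (r / (r - 1) / 2)%:C = y / (y - 1) / 2.
      by rewrite !rcM !rcV rcB -(natC R 2) eyr.
    rewrite rcD [X in _ = X + _]rmorphXn/= er -eyr.
    have y1' : y - 1 != 0 by rewrite -opprB oppr_eq0.
    have {}E3 : (1 - y) * (y - z ^+ 2) = y * z.
      by rewrite -[in RHS]E3; field.
    apply: (mulfI y1'); apply: (addrI ((1 - y) * (y - z ^+ 2))).
    transitivity ((1 - y) * (y - z ^+ 2) - y * z
        + (y - 1) * ((y / (y - 1) / 2) ^+ 2) + (y - 1) * z ^+ 2); first by field.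
    by rewrite {1}E3; ring.
  have p : 0 < (r / (r - 1) / 2) ^+ 2 + r by rewrite ltr_wpDl ?sqr_ge0//; lra.
  have := sqr_real_pos p h; rewrite ImD ImN/= subr0 => hi.
  by rewrite hi eqxx in iz.
split; first exact: P E2 w0.
have wV0 : (wcoord z)^-1 != 0 by rewrite invr_eq0.
by apply: (P _ (wcoord z)^-1) => //; rewrite invrK mulrC.
Qed.

End SurgeryEquation.

(** * Solutions of the system *)

Section Solutions.
Variable R : realType.
Local Notation C := R[i].
Variable n : nat.
Hypothesis n3 : (2 < n)%N.
Implicit Types (z w : C).

Local Notation pencil1 := (pencil (Npol R n) (Dpol R n) 1).
Local Notation wcoord := (@wcoord R n).

Lemma surgery_eqE z (a b d c : C) : z != 0 -> a != 0 -> b != 0 -> c != 0 ->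
  b = a + z ^+ n.-1 * d -> b = z ^+ 2 * a - d ->
  z ^+ 2 - (z * (a * c) / (b * c) + 1 + b * c / (z * (a * c))) * z + 1 =
  z / (a * b) * (z ^+ n.-2 * d ^+ 2 - a * b).
Proof.
move=> z0 a0 b0 c0 e1 e2.
have e3 : z ^+ n.-1 = z * z ^+ n.-2.
  by rewrite -exprS; congr (_ ^+ _); have := n3; lia.
transitivity (((b - a) * (z ^+ 2 * a - b) - z * (a * b)) / (a * b)).
  by field; rewrite z0 a0 b0 c0.
have -> : b - a = z ^+ n.-1 * d by rewrite e1; ring.
have -> : z ^+ 2 * a - b = d by rewrite e2; ring.
by rewrite e3; field; rewrite a0 b0.
Qed.

Lemma solution_root z w :
  is_solution (2 * n%:Z) z w <-> root pencil1 z /\ w = wcoord z.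
Proof.
rewrite /is_solution mulKz// -exprnP.
have e1 : z + z ^+ n = z * ((pa R n).[z] * (cpoly R n).[z]).
  rewrite (paH n3) mulrDr mulr1 -exprS addrC; congr (_ ^+ _ + _).
  by have := n3; lia.
have e2 : z ^+ n * z + 1 = (pb R n).[z] * (cpoly R n).[z] by rewrite pbH -exprSr.
rewrite (addrC 1) (addrC _ z) e1 e2.
have f1 := pb_paH n3 z; have f2 := pb_pdH n3 z.
rewrite /wcoord pencil_root mul1r NpolH DpolH.
split=> [[]|[/eqP rz ->]].
  rewrite !mulf_eq0 !negb_or => /andP[z0 _] /andP[b0 c0] /andP[_ /andP[a0 _]] ->.
  rewrite (surgery_eqE z0 a0 b0 c0 f1 f2) => /eqP.
  rewrite mulf_eq0 subr_eq0 => /orP[|/eqP ->].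
    by rewrite !mulf_eq0 invr_eq0 mulf_eq0 !(negbTE z0, negbTE a0, negbTE b0).
  by rewrite eqxx; split=> //; field; rewrite b0 c0.
have rz' : root pencil1 z by rewrite pencil_root mul1r NpolH DpolH rz.
have [z0 a0 b0 d0] := pencil_rootP n3 (oner_neq0 C) rz'.
have c0 := pencil1_cpoly n3 rz'.
rewrite (surgery_eqE z0 a0 b0 c0 f1 f2) rz subrr mulr0.
split; rewrite ?mulf_neq0 ?invr_neq0 ?mulf_neq0//.
by field; rewrite b0 c0.
Qed.

(** Reduces negative parameters to positive ones. *)
Lemma solution_opp z w :
  is_solution (- (2 * n%:Z)) z w <-> is_solution (2 * n%:Z) z w^-1.
Proof.
rewrite /is_solution -mulrN !mulKz// -invr_expz -exprnP !mulf_eq0 invr_eq0.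
have [->|z0] /= := eqVneq z 0; first by split=> -[].
have y0 : z ^+ n != 0 by rewrite expf_neq0.
move: (z ^+ n) y0 => y y0.
have e1 : y^-1 * z + 1 = (z + y) / y by field.
have e2 : y^-1 + z = (y * z + 1) / y by field; rewrite y0.
have e3 : z + y^-1 = (y * z + 1) / y by rewrite addrC e2.
have e4 : 1 + y^-1 * z = (z + y) / y by rewrite addrC e1.
rewrite e1 e2 e3 e4 !mulf_eq0 !invr_eq0 !(negbTE y0) !orbF (addrC 1) (addrC y z).
split=> -[w0 h1 h2 ew E]; split=> //.
- by rewrite ew; field; rewrite h1 h2 y0.
- by rewrite -[RHS]E; field; rewrite h1 h2 y0.
- by rewrite -(invrK w) ew; field; rewrite h1 h2 y0.
- by rewrite -[RHS]E; field; rewrite h1 h2 y0.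
Qed.

End Solutions.

(** * From critical values to the potential *)

Section Conclusion.
Variable R : realType.
Local Notation C := R[i].
Implicit Types (z w : C) (m : int).

Local Notation kappa := (@kappa R).

(** The potential at a critical point, once the integers [c] and [d] are
    eliminated by means of the critical point equations. *)
Definition critpot m z w : C :=
  - Li2 (z * w) + Li2 (z / w) - m%:~R / 2 * Log z ^+ 2 + Log z * Log w
  - Log (1 - z * w) * (Log z + Log w) + Log (1 - z / w) * (Log z - Log w).

Lemma crit_critpot m z w : z != 0 -> w != 0 ->
  slit (1 - z * w) -> slit (1 - z / w) ->
  crit m (Log z) (Log w) 0 = cexp (kappa * critpot m z w).
Proof.
move=> z0 w0 s1 s2.
have e1 : cexp (Log z + Log w) = z * w by rewrite cexpD !cexp_Log.
have e2 : cexp (Log z - Log w) = z / w by rewrite cexpB !cexp_Log.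
rewrite /crit !rogersE ?e1 ?e2// /rogers0 e1 e2 -cexpN -!cexpD /critpot.
by congr cexp; ring.
Qed.

Lemma Vtilde_critpot m z w (c d : int) : z != 0 -> w != 0 ->
  dVtilde_dz (2 * m) z w + 2 * pi%:C * 'i * (c%:~R / z) = 0 ->
  dVtilde_dw z w + 2 * pi%:C * 'i * (d%:~R / w) = 0 ->
  Vtilde (2 * m) z w + 2 * pi%:C * 'i * (c%:~R * Log z + d%:~R * Log w) =
  critpot m z w.
Proof.
move=> z0 w0 hc hd.
have {}hc : Log (1 - z * w) - Log (1 - z / w) + m%:~R * Log z - Log w
    + 2 * pi%:C * 'i * c%:~R = 0.
  rewrite -[RHS](mul0r z) -hc /dVtilde_dz intrM.
  by move: (pi%:C) => P; field.
have {}hd : Log (1 - z * w) + Log (1 - z / w) - Log z + 2 * pi%:C * 'i * d%:~R = 0.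
  by rewrite -[RHS](mul0r w) -hd /dVtilde_dw; move: (pi%:C) => P; field.
rewrite /Vtilde /critpot intrM; move: (pi%:C) hc hd => P hc hd.
have ec : 2 * P * 'i * c%:~R = - (Log (1 - z * w) - Log (1 - z / w) + m%:~R * Log z - Log w).
  by apply/eqP; rewrite -addr_eq0 addrC; apply/eqP.
have ed : 2 * P * 'i * d%:~R = - (Log (1 - z * w) + Log (1 - z / w) - Log z).
  by apply/eqP; rewrite -addr_eq0 addrC; apply/eqP.
rewrite mulrDr !mulrA ec ed.
by field.
Qed.

Variable n : nat.
Hypothesis n3 : (2 < n)%N.

Local Notation pencil1 := (pencil (Npol R n) (Dpol R n) 1).
Local Notation wcoord := (@wcoord R n).

Lemma prod_crit : \prod_(z <- rootseq pencil1) crit n (Log z) (Log (wcoord z)) 0 = 1.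
Proof.
have := energy1 n3 (@pencil1_simple R n n3).
by rewrite /energy /critval Log1 expr0n mulr0 oppr0 cexp0 mulr1.
Qed.

Lemma prod_cexp_critpot :
  \prod_(z <- rootseq pencil1) cexp (kappa * critpot n z (wcoord z)) = 1.
Proof.
rewrite -[RHS]prod_crit; apply: eq_big_seq => z.
rewrite mem_rootseq ?(pencil_monic (Npol_monic R n3) (Dpol_size R n3))// => rz.
have [s1 s2] := pencil1_slit n3 rz.
have z0 : z != 0 by have [] := pencil_rootP n3 (oner_neq0 C) rz.
have w0 := wcoord_neq0 n3 (oner_neq0 C) rz.
by rewrite -crit_critpot.
Qed.

(** Up to the choice of logarithms, which is immaterial by [critval_logs], the
    substitution of [w^-1] for [w] inverts the critical value. *)
Lemma prod_cexp_critpot_opp :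
  \prod_(z <- rootseq pencil1) cexp (kappa * critpot (- n%:Z) z (wcoord z)^-1) = 1.
Proof.
rewrite -[RHS]invr1 -[X in _ = X^-1]prod_crit -prodfV; apply: eq_big_seq => z.
rewrite mem_rootseq ?(pencil_monic (Npol_monic R n3) (Dpol_size R n3))// => rz.
have z0 : z != 0 by have [] := pencil_rootP n3 (oner_neq0 C) rz.
have w0 := wcoord_neq0 n3 (oner_neq0 C) rz.
have wV0 : (wcoord z)^-1 != 0 by rewrite invr_eq0.
have [s1 s2] := pencil1_slit n3 rz.
rewrite -crit_critpot ?invrK//.
have ev : cexp (- Log (wcoord z)^-1) = wcoord z by rewrite cexpN cexp_Log// invrK.
have e0 : cexp 0 = 1^-1 :> C by rewrite cexp0 invr1.
rewrite -(critval_logs n3 (oner_neq0 C) rz (cexp_Log z0) ev e0) /crit opprK.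
move: (Log z) (Log (wcoord z)^-1) => u v.
rewrite (_ : kappa * (- ((- n%:Z)%:~R / 2 * u ^+ 2) + u * v + v * 0) =
    - (kappa * (- (n%:~R / 2 * u ^+ 2) + u * - v + - v * 0))); last first.
  by rewrite mulrNz; move: kappa => K; field.
rewrite cexpN; move: (cexp_neq0 (kappa * (- (n%:~R / 2 * u ^+ 2) + u * - v + - v * 0))).
move: (rogers_neq0 (u - v)) (rogers_neq0 (u + v)) (cexp _).
move: (rogers _) (rogers _) => r1 r2 r10 r20 e e1.
by field; rewrite r10 r20 e1.
Qed.

End Conclusion.

(** The given enumeration of the solutions is a rearrangement of the roots. *)
Lemma prod_solutions (R : realType) (N : nat) (zeta omega : 'I_N -> R[i])
    (s : seq R[i]) (wf : R[i] -> R[i]) (F : R[i] -> R[i] -> R[i]) : uniq s ->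
  injective (fun i => (zeta i, omega i)) ->
  (forall z w, (exists i, zeta i = z /\ omega i = w) <-> z \in s /\ w = wf z) ->
  \prod_(i < N) F (zeta i) (omega i) = \prod_(z <- s) F z (wf z).
Proof.
move=> us inj H.
have ew i : zeta i \in s /\ omega i = wf (zeta i) by apply/H; exists i.
have izeta : injective zeta.
  by move=> i j e; apply: inj; rewrite /= (ew i).2 (ew j).2 e.
have P : perm_eq [seq zeta i | i <- enum 'I_N] s.
  apply: uniq_perm => //; first by rewrite map_inj_uniq ?enum_uniq.
  move=> z; apply/mapP/idP => [[i _ ->]|zs]; first exact: (ew i).1.
  have [i [ei _]] : exists i, zeta i = z /\ omega i = wf z by apply/H.
  by exists i; rewrite ?mem_enum.
rewrite -(perm_big _ P) big_map big_enum/=.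
by apply: eq_bigr => i _; rewrite (ew i).2.
Qed.

Lemma prod_critpot (R : realType) (m : int) (N : nat) (zeta omega : 'I_N -> R[i]) :
  (2 < `|m|)%N -> injective (fun i => (zeta i, omega i)) ->
  (forall z w : R[i],
     is_solution (2 * m) z w <-> exists i, zeta i = z /\ omega i = w) ->
  \prod_(i < N) cexp (kappa R * critpot m (zeta i) (omega i)) = 1.
Proof.
move=> m2 inj H; have [n [n3 em]] : exists n : nat, (2 < n)%N /\ (m = n \/ m = - n%:Z).
  by exists `|m|%N; split=> //; lia.
have Pm := pencil_monic (Npol_monic R n3) (Dpol_size R n3) 1.
have Pu := uniq_rootseq Pm (pencil1_simple n3).
case: em => em; subst m.
  rewrite -[RHS](prod_cexp_critpot R n3).
  apply: (prod_solutions (fun z w => cexp (kappa R * critpot n z w)) Pu inj) => z w.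
  by rewrite -H mem_rootseq//; exact: solution_root.
rewrite -[RHS](prod_cexp_critpot_opp R n3).
apply: (prod_solutions (wf := fun z => (wcoord n z)^-1)
  (fun z w => cexp (kappa R * critpot (- n%:Z) z w)) Pu inj) => z w.
rewrite -H mem_rootseq// mulrN solution_opp solution_root//.
by split=> -[-> e]; split=> //; [rewrite -e invrK|rewrite e invrK].
Qed.

Theorem corollary2p4 (R : realType) (p : int)
    (p_even : (2 %| p)%Z) (p_ge6 : 6 <= `|p|)
    (N : nat) (zeta omega : 'I_N -> R[i])
    (distinct : injective (fun i => (zeta i, omega i)))
    (all_solutions : forall z w : R[i],
       is_solution p z w <-> exists i, zeta i = z /\ omega i = w)
    (c d : 'I_N -> int)
    (hc : forall i, dVtilde_dz p (zeta i) (omega i)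
                    + 2 * pi%:C * 'i%C * ((c i)%:~R / zeta i) = 0)
    (hd : forall i, dVtilde_dw (zeta i) (omega i)
                    + 2 * pi%:C * 'i%C * ((d i)%:~R / omega i) = 0) :
  exists k : int,
    6 / pi%:C ^+ 2 *
      \sum_(i < N)
         (Vtilde p (zeta i) (omega i)
          + 2 * pi%:C * 'i%C * ((c i)%:~R * Log (zeta i)
                              + (d i)%:~R * Log (omega i)))
    = k%:~R.
Proof.
have /dvdzP[m ep] := p_even; rewrite mulrC in ep; subst p.
have m2 : (2 < `|m|)%N by clear -p_ge6; lia.
rewrite (eq_bigr (fun i => critpot m (zeta i) (omega i))) => [|i _]; last first.
  have [] : is_solution (2 * m) (zeta i) (omega i) by apply/all_solutions; exists i.
  rewrite mulf_eq0 negb_or => /andP[z0 w0] _ _ _ _.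
  exact: Vtilde_critpot z0 w0 (hc i) (hd i).
have := prod_critpot m2 distinct all_solutions.
rewrite -cexp_sum -mulr_sumr => /cexp_eq1[k]; move: (\sum_(i < N) _) => S.
rewrite /kappa /twopii => E; exists k.
have P0 := pi_neq0 R; move: (pi%:C) P0 E => P P0 E.
have i0 : 'i != 0 :> R[i].
  apply/eqP => h; have := sqr_i R; rewrite h expr0n => /eqP.
  by rewrite eq_sym oppr_eq0 oner_eq0.
have t0 : 2 != 0 :> R[i] by rewrite pnatr_eq0.
apply: (mulIf (mulf_neq0 (mulf_neq0 t0 P0) i0)).
rewrite -E.
by transitivity (6 / P ^+ 2 * S * (2 * P * 'i)); [|field].
Qed.
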